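(* Let $k$ be a positive integer and let $t$ be a real number with $t\ge k$. Then $$\left|\frac{\widetilde{R}_{k+1}(t)}{\widetilde{T}_k(t)}\right| < \eta_k\,\frac{(k/t)^2}{\pi^2-1}.$$
   Context: For integers $k\ge1$, $\eta_k = 1/(1-2^{1-2k})$. $B_{2j}(u)$ is the Bernoulli polynomial. $\log$ is the principal branch of the logarithm on $\mathbb{C}\setminus(-\infty,0]$. $\ln\Gamma$ denotes the analytic function on $\mathbb{C}\setminus(-\infty,0]$ with $\exp(\ln\Gamma(z))=\Gamma(z)$ that is real and equal to $\log(\Gamma(x))$ for real $x>0$. For integers $j\ge 1$, $\widehat{T}_j(z) = \frac{B_{2j}(\frac12)}{2j(2j-1)z^{2j-1}}$, and for integers $k\ge 1$ and $z\in\mathbb{C}$ with $\Re(z)\ge0$, $z\neq0$, the remainder $\widehat{R}_k(z)$ is defined by $$\ln\Gamma(z+\tfrac12) = z\log z - z + \tfrac12\log(2\pi) + \sum_{j=1}^{k-1}\widehat{T}_j(z) + \widehat{R}_k(z).$$ For real $t>0$, $\widetilde{T}_j(t) := \tfrac12|\widehat{T}_j(t)| = \frac{|B_{2j}(\frac12)|}{4j(2j-1)t^{2j-1}}$ and $\widetilde{R}_{k}(t) := \Im\left(\tfrac12\widehat{R}_{k}(it)\right)$. These are the terms and remainder in the expansion $$\vartheta(t) = \frac{t}{2} \log\left(\frac{t}{2\pi e}\right) - \frac{\pi}{8} + \frac{\arctan(e^{-\pi t})}{2} + \sum_{j=1}^{k-1}\widetilde{T}_j(t) + \widetilde{R}_{k}(t)$$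 of the Riemann-Siegel theta function $\vartheta(t) = \arg\Gamma\left(\frac{it}{2}+\frac14\right) - \frac{t}{2}\log\pi$ (argument chosen so that $\vartheta$ is continuous on $\mathbb{R}$ with $\vartheta(0)=0$). *)

(* Defs.v *)
(* Stdlib world, on the concrete reals R, with Coquelicot for C, limits
   and complex derivatives. *)
From Stdlib Require Import Reals Lra Lia ZArith Arith.
From Coquelicot Require Export Coquelicot.
Open Scope R_scope.

(* [bernoulli_upto n i] is the Bernoulli number B_i for i <= n; the table only
   serves to turn the course-of-values recursion of [bernoulli_rec] below into
   a structural one.  [Binomial.C] is the binomial coefficient, [C] being the
   complex numbers. *)
Fixpoint bernoulli_upto (n : nat) : nat -> R :=
  match n with
  | O => fun _ => 1
  | S m => fun i =>
      if (i <=? m)%nat then bernoulli_upto m i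
      else - / INR (n + 1)
           * sum_f_R0 (fun j => Binomial.C (n + 1) j * bernoulli_upto m j) m
  end.

Definition bernoulli (n : nat) : R := bernoulli_upto n n.

Lemma bernoulli_upto_stable (n i : nat) :
  (i <= n)%nat -> bernoulli_upto n i = bernoulli i.
Proof.
induction n as [|n IH]; intros Hi.
- now replace i with O by lia.
- destruct (Nat.eq_dec i (S n)) as [->|Hne]; [reflexivity|].
  rewrite <- IH by lia; cbn [bernoulli_upto].
  destruct (Nat.leb_spec i n) as [_|H]; [reflexivity | lia].
Qed.

Lemma bernoulli_0 : bernoulli 0 = 1.
Proof. reflexivity. Qed.

Lemma bernoulli_rec (n : nat) :
  sum_f_R0 (fun j => Binomial.C (S n + 1) j * bernoulli j) (S n) = 0.
Proof.
rewrite tech5.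
assert (E : bernoulli (S n) = - / INR (S n + 1)
  * sum_f_R0 (fun j => Binomial.C (S n + 1) j * bernoulli j) n).
{ unfold bernoulli at 1; cbn [bernoulli_upto].
  destruct (Nat.leb_spec (S n) n) as [H|_]; [lia|].
  f_equal; apply sum_eq; intros j Hj.
  now rewrite bernoulli_upto_stable. }
rewrite E.
assert (B : Binomial.C (S n + 1) (S n) = INR (S n + 1)).
{ unfold Binomial.C.
  replace (S n + 1 - S n)%nat with 1%nat by lia.
  replace (S n + 1)%nat with (S (S n)) by lia.
  rewrite (fact_simpl (S n)), mult_INR; change (fact 1) with 1%nat.
  change (INR 1) with 1.
  field; apply not_0_INR, fact_neq_0. }
rewrite B; field; apply not_0_INR; lia.
Qed.

Definition bernoulli_poly (n : nat) (u : R) : R :=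
  sum_f_R0 (fun j => Binomial.C n j * bernoulli j * u ^ (n - j)) n.

Definition Cexp (z : C) : C := (exp (Re z) * cos (Im z), exp (Re z) * sin (Im z)).

(* The argument in (-PI, PI] of z <> 0. *)
Definition Carg (z : C) : R :=
  if Rle_dec 0 (Im z) then acos (Re z / Cmod z) else - acos (Re z / Cmod z).

Definition Clog (z : C) : C := (ln (Cmod z), Carg z).

(* C minus (-oo, 0]. *)
Definition slit_plane (z : C) : Prop := ~ (Im z = 0 /\ Re z <= 0).

Fixpoint rising (z : C) (n : nat) : C :=
  match n with
  | O => RtoC 1
  | S m => Cmult (rising z m) (Cplus z (RtoC (INR m)))
  end.

(* Euler's limit n! n^z / (z (z+1) ... (z+n)), which exists for every z other
   than 0, -1, -2, ...; it is taken on real and imaginary parts. *)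
Definition Gamma_approx (z : C) (n : nat) : C :=
  Cdiv (Cmult (RtoC (INR (fact n))) (Cexp (Cmult z (RtoC (ln (INR n))))))
       (rising z (S n)).

Definition Gamma (z : C) : C :=
  (real (Lim_seq (fun n => Re (Gamma_approx z n))),
   real (Lim_seq (fun n => Im (Gamma_approx z n)))).

(* The slit plane being connected, these conditions determine L on it. *)
Record is_lnGamma (L : C -> C) : Prop := {
  lnGamma_analytic : forall z : C, slit_plane z ->
    @ex_derive C_AbsRing C_NormedModule L z;
  lnGamma_exp : forall z : C, slit_plane z -> Cexp (L z) = Gamma z;
  lnGamma_real : forall x : R, 0 < x ->
    L (RtoC x) = RtoC (ln (Re (Gamma (RtoC x))))
}.

Definition eta (k : nat) : R := 1 / (1 - powerRZ 2 (1 - 2 * Z.of_nat k)).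

Definition That (j : nat) (z : C) : C :=
  Cdiv (RtoC (bernoulli_poly (2 * j) (1 / 2)))
       (Cmult (RtoC (2 * INR j * (2 * INR j - 1))) (Cpow z (2 * j - 1))).

(* The remainder depends on the branch [lnGamma], passed as an argument. *)
Definition Rhat (lnGamma : C -> C) (k : nat) (z : C) : C :=
  (lnGamma (z + RtoC (1 / 2))
   - (z * Clog z - z + RtoC (1 / 2 * ln (2 * PI))
      + @sum_n_m C_AbelianMonoid (fun j => That j z) 1 (k - 1)))%C.

Definition Ttilde (j : nat) (t : R) : R := 1 / 2 * Cmod (That j (RtoC t)).

Definition Rtilde (lnGamma : C -> C) (k : nat) (t : R) : R :=
  Im (RtoC (1 / 2) * Rhat lnGamma k (Ci * RtoC t))%C.

Lemma Ttilde_eq (j : nat) (t : R) : (1 <= j)%nat -> 0 < t ->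
  Ttilde j t = Rabs (bernoulli_poly (2 * j) (1 / 2))
               / (4 * INR j * (2 * INR j - 1) * t ^ (2 * j - 1)).
Proof.
intros Hj Ht; unfold Ttilde, That.
assert (Hj1 : 1 <= INR j) by now apply (le_INR 1).
assert (Hp : 0 < t ^ (2 * j - 1)) by now apply pow_lt.
assert (Hq : 0 < 2 * INR j * (2 * INR j - 1) * t ^ (2 * j - 1))
  by (repeat apply Rmult_lt_0_compat; lra).
rewrite <- RtoC_pow, <- RtoC_mult, <- RtoC_div by lra.
rewrite Cmod_R, Rabs_div, (Rabs_pos_eq (_ * _)) by lra.
field; repeat split; lra.
Qed.

(* Main.v *)
Require Import Defs.
From Stdlib Require Import Reals Lra Lia Arith Machin.
From Coquelicot Require Import Coquelicot.
Open Scope R_scope.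

(** On the positive imaginary axis all the terms of the expansion of
    lnGamma (z + 1/2) have imaginary parts of the same sign: the axis is a
    Stokes line, and the remainder is not controlled by an alternation of
    signs.  The proof splits the expansion into Fourier modes and bounds the
    remainder of each of them.

    Euler's limit gives Im lnGamma (1/2 + i t) as the limit of
    t ln n - sum_(j <= n) arctan (t / (j + 1/2)), the branch being fixed by
    continuity ([Im_lnGamma_critical_line]).  This is a midpoint sum for
    x |-> arctan (t / x).  The integral of that function produces
    t ln t - t ([arctan_area_limit]), and the convergence of Fourier series at
    the centres of the unit cells ([midpoint_sum_fourier]) expresses the rest
    as an alternating sum, over the frequencies a = 2 pi nu, of (2 / a) S (a t),
    where S (s) is the integral of sin (s v) / (1 + v^2) over v > 0.  The same
    theorem applied to Bernoulli polynomials expresses B_(2j) (1/2) as an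
    alternating sum of powers (2 pi nu)^(- 2j) ([bernoulli_half_series]), so
    that the terms of the expansion split into the same modes, in which they
    are the terms (2q)! / s^(2q+1) of the asymptotic expansion of S at s = a t.
    What has to be bounded is therefore S (s) minus a partial sum of this
    expansion, for s >= 2 pi k.

    The function S solves S'' = S - 1/s, so that S - S' and S + S' solve
    first-order equations, with the divergent formal solutions
    sum j! / s^(j+1) and sum (-1)^j j! / s^(j+1).  Boundedness of S + S' makes
    the second series enclosing ([growing_mode_sign]).  For S - S' the error,
    multiplied by e^s, stays bounded along truncations of index close to s
    ([gap_upper_at], [gap_lower_at]), which leaves an exponentially small term.
    Numerical estimates then bound the remainder of the mode by
    U (2k)! / s^(2k+1), where U = 2k pi^2 / ((2k-1) (pi^2 - 1))
    ([stokes_mode_bound]).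

    The value of U is such that, mode by mode, this is the bound of the theorem
    multiplied by nu^(-2): the sum of the bounds contains zeta (2k+2).  The
    term T_k contains the alternating sum of nu^(- 2k), which is
    zeta (2k) / eta_k ([Rabs_bernoulli_half]), and the strict inequality is
    zeta (2k+2) < zeta (2k).

    To work with proper integrals only, the sum is kept to N cells and S is
    replaced by an integral cut at M = 2 pi nu N, after the substitution
    y = s v.  As sin M = 0 and cos M = 1, the cut integral solves the same
    equation up to an error of at most 1 / (2 M), which disappears when N tends
    to infinity. *)

(** * Calculus on a segment *)

Lemma le_of_derive_nonneg (f df : R -> R) (a b : R) :
  a <= b ->
  (forall x, a <= x <= b -> is_derive f x (df x)) ->
  (forall x, a <= x <= b -> 0 <= df x) ->
  f a <= f b.
Proof.
intros Hab Hd Hp.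
destruct (MVT_gen f a b df) as [c [Hc E]].
- rewrite Rmin_left, Rmax_right by lra; intros x Hx; apply Hd; lra.
- rewrite Rmin_left, Rmax_right by lra; intros x Hx.
  apply continuity_pt_filterlim, (@ex_derive_continuous R_AbsRing R_NormedModule).
  exists (df x); apply Hd; lra.
- rewrite Rmin_left, Rmax_right in Hc by lra.
  specialize (Hp c Hc).
  assert (0 <= df c * (b - a)) by (apply Rmult_le_pos; lra).
  lra.
Qed.

Lemma Rabs_increment_le (f df : R -> R) (a b B : R) :
  a <= b ->
  (forall x, a <= x <= b -> is_derive f x (df x)) ->
  (forall x, a <= x <= b -> Rabs (df x) <= B) ->
  Rabs (f b - f a) <= B * (b - a).
Proof.
intros Hab Hd HB.
destruct (MVT_gen f a b df) as [c [Hc E]].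
- rewrite Rmin_left, Rmax_right by lra; intros x Hx; apply Hd; lra.
- rewrite Rmin_left, Rmax_right by lra; intros x Hx.
  apply continuity_pt_filterlim, (@ex_derive_continuous R_AbsRing R_NormedModule).
  exists (df x); apply Hd; lra.
- rewrite Rmin_left, Rmax_right in Hc by lra.
  rewrite E, Rabs_mult, (Rabs_pos_eq (b - a)) by lra.
  apply Rmult_le_compat_r; [lra | now apply HB].
Qed.

Lemma continuous_of_is_derive (f : R -> R) (x l : R) :
  is_derive f x l -> continuous f x.
Proof.
intros H; apply (@ex_derive_continuous R_AbsRing R_NormedModule); now exists l.
Qed.

Lemma is_derive_Rplus (f g : R -> R) (x a b : R) :
  is_derive f x a -> is_derive g x b -> is_derive (fun u => f u + g u) x (a + b).
Proof. exact (@is_derive_plus R_AbsRing R_NormedModule f g x a b). Qed.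

Lemma is_derive_Rmult_const (k x : R) : is_derive (fun u => k * u) x k.
Proof. auto_derive; [trivial | ring]. Qed.

Lemma is_derive_sum_f_R0 (f df : nat -> R -> R) (n : nat) (x : R) :
  (forall i, (i <= n)%nat -> is_derive (f i) x (df i x)) ->
  is_derive (fun u => sum_f_R0 (fun i => f i u) n) x (sum_f_R0 (fun i => df i x) n).
Proof.
induction n as [|n IH]; intros H; [apply H; lia|].
apply (is_derive_Rplus (fun u => sum_f_R0 (fun i => f i u) n)).
- apply IH; intros i Hi; apply H; lia.
- apply H; lia.
Qed.

Lemma is_RInt_primitive (f df : R -> R) (a b v : R) :
  a <= b ->
  (forall x, a <= x <= b -> is_derive f x (df x)) ->
  (forall x, a <= x <= b -> continuous df x) ->
  f b - f a = v -> is_RInt df a b v.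
Proof.
intros Hab Hd Hc <-.
apply (is_RInt_derive f df); rewrite Rmin_left, Rmax_right by lra; assumption.
Qed.

Lemma sum_f_R0_eq0 (f : nat -> R) (n : nat) :
  (forall i, (i <= n)%nat -> f i = 0) -> sum_f_R0 f n = 0.
Proof.
intros H; rewrite (sum_eq f (fun _ => 0) n H), sum_cte; ring.
Qed.

Lemma bounded_on_segment (f : R -> R) (a b : R) :
  a <= b -> (forall x, continuous f x) ->
  exists B, forall x, a <= x <= b -> Rabs (f x) <= B.
Proof.
intros Hab Hc.
assert (Hc' : forall c, a <= c <= b -> continuity_pt (fun x => Rabs (f x)) c).
{ intros c _; apply continuity_pt_filterlim.
  apply (continuous_comp f Rabs); [apply Hc | apply continuous_Rabs]. }
destruct (continuity_ab_maj _ a b Hab Hc') as [M [HM _]].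
exists (Rabs (f M)); intros x Hx; now apply HM.
Qed.

Lemma Rle_of_forall_small (a b K h0 : R) :
  0 < h0 -> (forall h, 0 < h < h0 -> a <= b + K * h) -> a <= b.
Proof.
intros Hh0 H; apply Rnot_lt_le; intros Hlt.
set (h := Rmin (h0 / 2) ((a - b) / (2 * (Rabs K + 1)))).
assert (HK : 0 <= Rabs K) by apply Rabs_pos.
assert (Hq : 0 < (a - b) / (2 * (Rabs K + 1)))
  by (apply Rdiv_lt_0_compat; lra).
assert (Hh : 0 < h) by (apply Rmin_pos; lra).
assert (Hh1 : h <= h0 / 2) by apply Rmin_l.
assert (Hh2 : h <= (a - b) / (2 * (Rabs K + 1))) by apply Rmin_r.
specialize (H h ltac:(lra)).
assert (K * h <= Rabs K * h) by (apply Rmult_le_compat_r; [lra | apply Rle_abs]).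
assert ((Rabs K + 1) * h <= (a - b) / 2).
{ apply Rle_trans with ((Rabs K + 1) * ((a - b) / (2 * (Rabs K + 1)))).
  - apply Rmult_le_compat_l; lra.
  - right; field; lra. }
lra.
Qed.

(** A crude form of Jordan's inequality: sin x = 2 sin y cos y with y = x/2,
    where sin y >= y cos y and 2 (cos y)^2 = 1 + cos x >= 1. *)
Lemma sin_ge_half (x : R) : 0 <= x <= PI / 2 -> x / 2 <= sin x.
Proof.
intros Hx.
assert (Hpi := PI_RGT_0).
set (y := x / 2).
assert (Hy : 0 <= y <= PI / 4) by (unfold y; lra).
assert (Hcos : 0 < cos y) by (apply cos_gt_0; lra).
assert (H1 : y * cos y <= sin y).
{ assert (H := le_of_derive_nonneg (fun u => sin u - u * cos u)
    (fun u => u * sin u) 0 y ltac:(lra)).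
  cbv beta in H; rewrite sin_0, cos_0 in H.
  enough (0 - 0 * 1 <= sin y - y * cos y) by lra.
  apply H; intros u Hu.
  - auto_derive; [trivial | ring].
  - apply Rmult_le_pos; [lra | apply sin_ge_0; lra]. }
replace (sin x) with (sin (2 * y)) by (f_equal; unfold y; field).
rewrite sin_2a.
assert (H2 : 1 <= 2 * (cos y * cos y)).
{ assert (H := cos_2a_cos y).
  assert (0 <= cos (2 * y)) by (apply cos_ge_0; lra). lra. }
assert (H3 : y * (cos y * cos y) <= sin y * cos y).
{ rewrite <- Rmult_assoc; apply Rmult_le_compat_r; lra. }
assert (y * 1 <= y * (2 * (cos y * cos y))) by (apply Rmult_le_compat_l; lra).
fold y; lra.
Qed.

(** * Fourier series at the centre of a cell *)

(** The index i stands for the frequency i + 1, so the kernel has V + 1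
    frequencies and equals sin ((2V+3) pi u) / sin (pi u). *)
Definition dirichlet (V : nat) (u : R) : R :=
  1 + 2 * sum_f_R0 (fun i => cos (2 * PI * INR (S i) * u)) V.

Lemma dirichlet_mul_sin (V : nat) (u : R) :
  dirichlet V u * sin (PI * u) = sin (INR (2 * V + 3) * PI * u).
Proof.
unfold dirichlet.
assert (step : forall nu : R, 2 * cos (2 * PI * nu * u) * sin (PI * u)
  = sin ((2 * nu + 1) * PI * u) - sin ((2 * nu - 1) * PI * u)).
{ intros nu.
  replace ((2 * nu + 1) * PI * u) with (2 * PI * nu * u + PI * u) by ring.
  replace ((2 * nu - 1) * PI * u) with (2 * PI * nu * u - PI * u) by ring.
  rewrite sin_plus, sin_minus; ring. }
induction V as [|V IH].
- simpl sum_f_R0; rewrite Rmult_plus_distr_r, step.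
  replace ((2 * 1 - 1) * PI * u) with (PI * u) by ring.
  replace (INR (2 * 0 + 3)) with (2 * 1 + 1) by (simpl; ring).
  ring.
- rewrite tech5, Rmult_plus_distr_l, <- Rplus_assoc, Rmult_plus_distr_r, IH, step.
  replace (INR (2 * S V + 3)) with (2 * INR (S (S V)) + 1)
    by (rewrite plus_INR, mult_INR, !S_INR; simpl; ring).
  replace (2 * INR (S (S V)) - 1) with (INR (2 * V + 3))
    by (rewrite plus_INR, mult_INR, !S_INR; simpl; ring).
  ring.
Qed.

Lemma dirichlet_even (V : nat) (u : R) : dirichlet V (- u) = dirichlet V u.
Proof.
unfold dirichlet; do 2 f_equal; apply sum_eq; intros i _.
rewrite <- cos_neg; f_equal; ring.
Qed.

Lemma dirichlet_bound (V : nat) (u : R) : Rabs (dirichlet V u) <= INR (2 * V + 3).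
Proof.
unfold dirichlet.
eapply Rle_trans; [apply Rabs_triang|].
rewrite Rabs_mult, (Rabs_pos_eq 1), (Rabs_pos_eq 2) by lra.
assert (H : Rabs (sum_f_R0 (fun i => cos (2 * PI * INR (S i) * u)) V)
  <= INR (S V)).
{ eapply Rle_trans; [apply Rsum_abs|].
  induction V as [|V IH].
  - simpl; apply Rabs_le, COS_bound.
  - rewrite tech5, (S_INR (S V)).
    apply Rplus_le_compat; [exact IH | apply Rabs_le, COS_bound]. }
replace (INR (2 * V + 3)) with (2 * INR V + 3)
  by (rewrite plus_INR, mult_INR; simpl; ring).
rewrite S_INR in H; lra.
Qed.

Lemma is_derive_dirichlet_primitive (V : nat) (u : R) :
  is_derive (fun x => x + 2 * sum_f_R0
    (fun i => sin (2 * PI * INR (S i) * x) / (2 * PI * INR (S i))) V) u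
    (dirichlet V u).
Proof.
assert (Hpi := PI_RGT_0).
unfold dirichlet.
apply (is_derive_Rplus (fun x => x)); [apply (@is_derive_id R_AbsRing)|].
apply is_derive_scal.
apply (is_derive_sum_f_R0
  (fun i x => sin (2 * PI * INR (S i) * x) / (2 * PI * INR (S i)))
  (fun i x => cos (2 * PI * INR (S i) * x))).
intros i _; cbv beta.
assert (Hc : 0 < 2 * PI * INR (S i))
  by (apply Rmult_lt_0_compat; [lra | apply lt_0_INR; lia]).
set (c := 2 * PI * INR (S i)) in *.
auto_derive; [trivial | field; lra].
Qed.

Lemma continuous_dirichlet (V : nat) (u : R) : continuous (dirichlet V) u.
Proof.
eapply continuous_of_is_derive; unfold dirichlet.
apply (is_derive_Rplus (fun _ => 1)); [apply (@is_derive_const R_AbsRing)|].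
apply is_derive_scal.
apply (is_derive_sum_f_R0 (fun i x => cos (2 * PI * INR (S i) * x))
  (fun i x => - (2 * PI * INR (S i)) * sin (2 * PI * INR (S i) * x))).
intros i _; cbv beta; set (c := 2 * PI * INR (S i)).
auto_derive; [trivial | ring].
Qed.

Lemma sin_PI_INR (n : nat) : sin (PI * INR n) = 0.
Proof. apply sin_eq_0_1; exists (Z.of_nat n); rewrite <- INR_IZR_INZ; ring. Qed.

Lemma RInt_dirichlet_half (V : nat) : is_RInt (dirichlet V) 0 (1 / 2) (1 / 2).
Proof.
assert (H := is_RInt_derive (fun x => x + 2 * sum_f_R0
    (fun i => sin (2 * PI * INR (S i) * x) / (2 * PI * INR (S i))) V)
    (dirichlet V) 0 (1 / 2)
    (fun u _ => is_derive_dirichlet_primitive V u)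
    (fun u _ => continuous_dirichlet V u)).
replace (minus _ _) with (1 / 2) in H; [exact H|].
assert (E : forall x, (forall i, sin (2 * PI * INR (S i) * x) = 0) ->
  sum_f_R0 (fun i => sin (2 * PI * INR (S i) * x) / (2 * PI * INR (S i))) V = 0).
{ intros x Hx; apply sum_f_R0_eq0; intros i _; rewrite Hx; unfold Rdiv; ring. }
rewrite !E.
- unfold minus, plus, opp; simpl; field.
- intros i; rewrite Rmult_0_r; apply sin_0.
- intros i; replace (2 * PI * INR (S i) * (1 / 2)) with (PI * INR (S i)) by field.
  apply sin_PI_INR.
Qed.

(** As e vanishes at 0, the pole of the kernel cancels: the integrand is
    q (u) sin ((2V+3) pi u) with q = e / sin (pi u), and q' is bounded because
    its numerator N vanishes to second order at 0.  One integration by parts on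
    [h, 1/2] gives the rate.  The integral over [0, h] tends to 0 with h for
    each V, which spares the study of q at 0. *)
Lemma dirichlet_half_estimate (e e1 e2 : R -> R) (B : R) :
  (forall u, is_derive e u (e1 u)) ->
  (forall u, is_derive e1 u (e2 u)) ->
  (forall u, 0 <= u <= 1 / 2 -> Rabs (e u) <= B) ->
  (forall u, 0 <= u <= 1 / 2 -> Rabs (e1 u) <= B) ->
  (forall u, 0 <= u <= 1 / 2 -> Rabs (e2 u) <= B) ->
  e 0 = 0 ->
  exists C, forall V,
    Rabs (RInt (fun u => e u * dirichlet V u) 0 (1 / 2)) <= C / INR (2 * V + 3).
Proof.
intros He He1 HB0 HB1 HB2 H0.
assert (Hpi := PI_RGT_0).
assert (HB : 0 <= B).
{ apply Rle_trans with (Rabs (e 0)); [apply Rabs_pos | apply HB0; lra]. }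
assert (Hlin : forall u, 0 <= u <= 1 / 2 -> Rabs (e u) <= B * u).
{ intros u Hu.
  assert (H := Rabs_increment_le e e1 0 u B ltac:(lra) (fun x _ => He x)).
  rewrite H0, !Rminus_0_r in H; apply H; intros x Hx; apply HB1; lra. }
assert (Hsin : forall u, 0 <= u <= 1 / 2 -> PI * u / 2 <= sin (PI * u)).
{ intros u Hu; apply sin_ge_half; split; [apply Rmult_le_pos; lra|].
  apply Rle_trans with (PI * (1 / 2)); [apply Rmult_le_compat_l|]; lra. }
set (q := fun u => e u / sin (PI * u)).
set (N := fun u => e1 u * sin (PI * u) - PI * e u * cos (PI * u)).
set (q1 := fun u => N u / (sin (PI * u)) ^ 2).
set (C1 := 4 * (B + PI ^ 2 * B) / PI).
assert (Hpos : forall u, 0 < u <= 1 / 2 -> 0 < sin (PI * u)).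
{ intros u Hu; apply Rlt_le_trans with (PI * u / 2); [|apply Hsin; lra].
  apply Rmult_lt_0_compat; [apply Rmult_lt_0_compat|]; lra. }
(* In the derivative of N the terms in e' cancel, which leaves a factor sin (pi u). *)
assert (HN : forall u, 0 < u <= 1 / 2 -> Rabs (N u) <= (B + PI ^ 2 * B) * PI * u * u).
{ intros u Hu.
  assert (H := Rabs_increment_le N
     (fun x => sin (PI * x) * (e2 x + PI ^ 2 * e x)) 0 u
     ((B + PI ^ 2 * B) * PI * u) ltac:(lra)).
  rewrite Rminus_0_r in H.
  assert (E0 : N 0 = 0) by (unfold N; rewrite H0, Rmult_0_r, sin_0; ring).
  rewrite E0, Rminus_0_r in H; apply H.
  - intros x _; unfold N.
    auto_derive.
    + split; [exists (e2 x); apply He1 | split; [exists (e1 x); apply He | trivial]].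
    + replace (Derive (fun y => e1 y) x) with (e2 x)
        by (symmetry; apply is_derive_unique, He1).
      replace (Derive (fun y => e y) x) with (e1 x)
        by (symmetry; apply is_derive_unique, He).
      ring.
  - intros x Hx; rewrite Rabs_mult, (Rmult_assoc _ PI u), (Rmult_comm _ (PI * u)).
    assert (Hx' : 0 <= PI * x <= PI * u)
      by (split; [apply Rmult_le_pos | apply Rmult_le_compat_l]; lra).
    apply Rmult_le_compat; try apply Rabs_pos.
    + assert (Hs : Rabs (sin (PI * x)) <= PI * x); [|lra].
      destruct (Req_dec x 0) as [->|Hx0].
      * rewrite Rmult_0_r, sin_0, Rabs_R0; lra.
      * assert (0 < sin (PI * x)) by (apply Hpos; lra).
        rewrite Rabs_pos_eq by lra; left; apply sin_lt_x.
        apply Rmult_lt_0_compat; lra.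
    + eapply Rle_trans; [apply Rabs_triang|].
      rewrite Rabs_mult, (Rabs_pos_eq (PI ^ 2)) by (apply pow2_ge_0).
      apply Rplus_le_compat; [apply HB2; lra|].
      apply Rmult_le_compat_l; [apply pow2_ge_0 | apply HB0; lra]. }
assert (Hq1 : forall u, 0 < u <= 1 / 2 -> Rabs (q1 u) <= C1).
{ intros u Hu; unfold q1, C1.
  assert (Hs := Hsin u ltac:(lra)); assert (Hp := Hpos u Hu).
  rewrite Rabs_div by (apply pow_nonzero; lra).
  rewrite (Rabs_pos_eq (_ ^ 2)) by apply pow2_ge_0.
  assert (Hpu : 0 < PI * u) by (apply Rmult_lt_0_compat; lra).
  apply Rle_trans with ((B + PI ^ 2 * B) * PI * u * u / (PI * u / 2) ^ 2).
  - unfold Rdiv; apply Rmult_le_compat.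
    + apply Rabs_pos.
    + left; apply Rinv_0_lt_compat, pow_lt; lra.
    + now apply HN.
    + apply Rinv_le_contravar; [apply pow_lt; lra|].
      apply pow_incr; lra.
  - right; field; split; lra. }
assert (Hq : forall u, 0 < u <= 1 / 2 -> Rabs (q u) <= 2 * B / PI).
{ intros u Hu; unfold q.
  assert (Hs := Hsin u ltac:(lra)); assert (Hp := Hpos u Hu).
  assert (Hpu : 0 < PI * u) by (apply Rmult_lt_0_compat; lra).
  rewrite Rabs_div by lra; rewrite (Rabs_pos_eq (sin _)) by lra.
  apply Rle_trans with (B * u / (PI * u / 2)).
  - unfold Rdiv; apply Rmult_le_compat.
    + apply Rabs_pos.
    + left; now apply Rinv_0_lt_compat.
    + apply Hlin; lra.
    + apply Rinv_le_contravar; lra.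
  - right; field; split; lra. }
exists ((4 * B / PI + C1 / 2) / PI); intros V.
set (L := INR (2 * V + 3)).
assert (HL : 3 <= L).
{ unfold L; replace (INR (2 * V + 3)) with (2 * INR V + 3)
    by (rewrite plus_INR, mult_INR; simpl; ring).
  assert (H := pos_INR V); lra. }
set (lam := L * PI).
assert (Hlam : 0 < lam) by (unfold lam; apply Rmult_lt_0_compat; lra).
set (g := fun u => e u * dirichlet V u).
assert (Hcg : forall u, continuous g u).
{ intros u; apply (continuous_mult e (dirichlet V)).
  - eapply continuous_of_is_derive, He.
  - apply continuous_dirichlet. }
assert (Hig : forall a b, ex_RInt g a b).
{ intros a b; apply (@ex_RInt_continuous R_CompleteNormedModule); intros; apply Hcg. }
apply Rle_of_forall_small with (K := B * L) (h0 := 1 / 2); [lra|].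
intros h Hh.
rewrite <- (RInt_Chasles (V := R_CompleteNormedModule) g 0 h (1 / 2)) by apply Hig.
eapply Rle_trans; [apply Rabs_triang|]; rewrite Rplus_comm.
apply Rplus_le_compat.
- set (psi := fun u => - q u * cos (lam * u) / lam).
  set (rest := fun u => q1 u * cos (lam * u) / lam).
  assert (Hpsi : forall u, h <= u <= 1 / 2 ->
    is_derive psi u (g u - rest u)).
  { intros u Hu; assert (Hp := Hpos u ltac:(lra)).
    assert (Eg : g u = q u * sin (lam * u)).
    { unfold g, q, lam, L; rewrite <- dirichlet_mul_sin; field; lra. }
    rewrite Eg; unfold psi, rest, q1, N, q.
    auto_derive.
    - split; [exists (e1 u); apply He | split; [lra | trivial]].
    - replace (Derive (fun y => e y) u) with (e1 u)
        by (symmetry; apply is_derive_unique, He).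
      field; split; lra. }
  assert (Hcr : forall u, h <= u <= 1 / 2 -> continuous rest u).
  { intros u Hu; assert (Hp := Hpos u ltac:(lra)).
    apply (@ex_derive_continuous R_AbsRing R_NormedModule).
    unfold rest, q1, N; auto_derive.
    repeat split; try (exists (e2 u); apply He1); try (exists (e1 u); apply He).
    apply Rmult_integral_contrapositive_currified; [lra|].
    apply Rmult_integral_contrapositive_currified; lra. }
  assert (HR : is_RInt (fun u => g u - rest u) h (1 / 2) (psi (1 / 2) - psi h)).
  { apply (is_RInt_derive psi (fun u => g u - rest u)).
    - rewrite Rmin_left, Rmax_right by lra; exact Hpsi.
    - rewrite Rmin_left, Rmax_right by lra; intros u Hu.
      apply (continuous_minus g rest); [apply Hcg | now apply Hcr]. }
  assert (HI : ex_RInt rest h (1 / 2)).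
  { apply (@ex_RInt_continuous R_CompleteNormedModule).
    rewrite Rmin_left, Rmax_right by lra; exact Hcr. }
  assert (E : RInt g h (1 / 2) = psi (1 / 2) - psi h + RInt rest h (1 / 2)).
  { apply is_RInt_unique.
    apply (is_RInt_ext (fun u => plus (g u - rest u) (rest u))).
    - intros u _; unfold plus; simpl; ring.
    - apply (is_RInt_plus (V := R_NormedModule)); [exact HR|].
      now apply (RInt_correct (V := R_CompleteNormedModule)). }
  rewrite E.
  assert (Hrest : Rabs (RInt rest h (1 / 2)) <= (1 / 2 - h) * (C1 / lam)).
  { apply (norm_RInt_le_const (V := R_NormedModule) rest h (1 / 2)); [lra | |].
    - intros u Hu; unfold norm; simpl; unfold abs; simpl.
      unfold rest, Rdiv; rewrite !Rabs_mult, (Rabs_pos_eq (/ lam))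
        by (left; now apply Rinv_0_lt_compat).
      apply Rmult_le_compat_r; [left; now apply Rinv_0_lt_compat|].
      rewrite <- (Rmult_1_r C1); apply Rmult_le_compat; try apply Rabs_pos.
      + apply Hq1; lra.
      + apply Rabs_le, COS_bound.
    - now apply (RInt_correct (V := R_CompleteNormedModule)). }
  assert (Hps : forall u, 0 < u <= 1 / 2 -> Rabs (psi u) <= 2 * B / PI / lam).
  { intros u Hu; unfold psi, Rdiv at 1; rewrite !Rabs_mult, Rabs_Ropp.
    rewrite (Rabs_pos_eq (/ lam)) by (left; now apply Rinv_0_lt_compat).
    apply Rmult_le_compat_r; [left; now apply Rinv_0_lt_compat|].
    rewrite <- (Rmult_1_r (2 * B / PI)); apply Rmult_le_compat; try apply Rabs_pos.
    + now apply Hq.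
    + apply Rabs_le, COS_bound. }
  assert (HC1 : 0 <= C1 / lam).
  { apply Rle_trans with ((1 / lam) * Rabs (q1 (1 / 2))).
    - apply Rmult_le_pos; [left; apply Rdiv_lt_0_compat; lra | apply Rabs_pos].
    - replace (C1 / lam) with (1 / lam * C1) by (field; lra).
      apply Rmult_le_compat_l; [left; apply Rdiv_lt_0_compat; lra|].
      apply Hq1; lra. }
  assert (H1 := Hps (1 / 2) ltac:(lra)); assert (H2 := Hps h ltac:(lra)).
  assert (T1 := Rabs_triang (psi (1 / 2) - psi h) (RInt rest h (1 / 2))).
  assert (T2 := Rabs_triang (psi (1 / 2)) (- psi h)).
  rewrite Rabs_Ropp in T2.
  replace ((4 * B / PI + C1 / 2) / PI / L)
    with (2 * (2 * B / PI / lam) + 1 / 2 * (C1 / lam))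
    by (unfold lam; field; split; lra).
  assert (0 <= h * (C1 / lam)) by (apply Rmult_le_pos; lra).
  unfold Rminus in *; lra.
- replace (B * L * h) with ((h - 0) * (B * L)) by ring.
  apply (norm_RInt_le_const (V := R_NormedModule) g 0 h); [lra | |].
  + intros u Hu; unfold norm; simpl; unfold abs; simpl; unfold g.
    rewrite Rabs_mult; apply Rmult_le_compat; try apply Rabs_pos.
    * apply HB0; lra.
    * apply dirichlet_bound.
  + apply (RInt_correct (V := R_CompleteNormedModule)), Hig.
Qed.

Lemma continuous_dirichlet_shift (f : R -> R) (V : nat) (c x : R) :
  (forall x, continuous f x) ->
  continuous (fun x => f x * dirichlet V (x - c)) x.
Proof.
intros Hf; apply (continuous_mult f (fun x => dirichlet V (x - c))); [apply Hf|].
apply (continuous_comp (fun x => x - c) (dirichlet V)); [|apply continuous_dirichlet].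
apply (continuous_of_is_derive _ _ 1); auto_derive; [trivial | ring].
Qed.

Lemma is_lim_seq_of_error (u : nat -> R) (l C : R) :
  (forall V, Rabs (u V - l) <= C / INR (2 * V + 3)) -> is_lim_seq u l.
Proof.
intros H.
apply (is_lim_seq_ext (fun V => l + (u V - l))); [intros; ring|].
replace (Finite l) with (Finite (l + 0)) by (f_equal; ring).
apply is_lim_seq_plus'; [apply is_lim_seq_const|].
apply is_lim_seq_abs_0.
apply (is_lim_seq_le_le (fun _ => 0) _ (fun V => C * / INR (2 * V + 3))).
- intros V; split; [apply Rabs_pos | apply H].
- apply is_lim_seq_const.
- replace (Finite 0) with (Rbar_mult C 0) by (simpl; f_equal; ring).
  apply is_lim_seq_scal_l.
  apply (is_lim_seq_inv _ p_infty).
  + apply (is_lim_seq_le_p_loc INR).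
    * exists O; intros n _; apply le_INR; lia.
    * apply is_lim_seq_INR.
  + discriminate.
Qed.

(** Folding the cell about its centre replaces f by its even part, and
    e (u) = f (c + u) + f (c - u) - 2 f (c) vanishes at 0; the constant 2 f (c)
    contributes f (c) because the kernel has integral 1/2 on [0, 1/2]. *)
Lemma dirichlet_cell_limit (f f1 f2 : R -> R) (c : R) :
  (forall x, is_derive f x (f1 x)) ->
  (forall x, is_derive f1 x (f2 x)) ->
  (forall x, continuous f2 x) ->
  is_lim_seq (fun V => RInt (fun x => f x * dirichlet V (x - c)) (c - 1 / 2) (c + 1 / 2))
    (f c).
Proof.
intros H0 H1 Hc2.
set (e := fun u => f (c + u) + f (c - u) - 2 * f c).
set (e1 := fun u => f1 (c + u) - f1 (c - u)).
set (e2 := fun u => f2 (c + u) + f2 (c - u)).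
assert (He : forall u, is_derive e u (e1 u)).
{ intros u; unfold e, e1; auto_derive.
  - split; [eexists; apply H0 | split; [eexists; apply H0 | trivial]].
  - rewrite (is_derive_unique (fun x : R => f x) _ _ (H0 (c + u))),
      (is_derive_unique (fun x : R => f x) _ _ (H0 (c + - u))).
    unfold Rminus; ring. }
assert (He1 : forall u, is_derive e1 u (e2 u)).
{ intros u; unfold e1, e2; auto_derive.
  - split; [eexists; apply H1 | split; [eexists; apply H1 | trivial]].
  - rewrite (is_derive_unique (fun x : R => f1 x) _ _ (H1 (c + u))),
      (is_derive_unique (fun x : R => f1 x) _ _ (H1 (c + - u))).
    unfold Rminus; ring. }
assert (Ce : forall u, continuous e u) by (intros u; eapply continuous_of_is_derive, He).
assert (Ce1 : forall u, continuous e1 u) by (intros u; eapply continuous_of_is_derive, He1).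
assert (Ce2 : forall u, continuous e2 u).
{ intros u; apply (continuous_plus (fun u => f2 (c + u)) (fun u => f2 (c - u))).
  - apply (continuous_comp (fun u => c + u) f2); [|apply Hc2].
    apply (continuous_of_is_derive _ _ 1); auto_derive; [trivial | ring].
  - apply (continuous_comp (fun u => c - u) f2); [|apply Hc2].
    apply (continuous_of_is_derive _ _ (-1)); auto_derive; [trivial | ring]. }
destruct (bounded_on_segment e 0 (1 / 2) ltac:(lra) Ce) as [B0 HB0].
destruct (bounded_on_segment e1 0 (1 / 2) ltac:(lra) Ce1) as [B1 HB1].
destruct (bounded_on_segment e2 0 (1 / 2) ltac:(lra) Ce2) as [B2 HB2].
set (B := Rmax B0 (Rmax B1 B2)).
assert (M0 : B0 <= B) by apply Rmax_l.
assert (M1 : B1 <= B) by (eapply Rle_trans; [apply Rmax_l | apply Rmax_r]).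
assert (M2 : B2 <= B) by (eapply Rle_trans; [apply Rmax_r | apply Rmax_r]).
destruct (dirichlet_half_estimate e e1 e2 B He He1) as [C HC].
- intros u Hu; eapply Rle_trans; [now apply HB0 | exact M0].
- intros u Hu; eapply Rle_trans; [now apply HB1 | exact M1].
- intros u Hu; eapply Rle_trans; [now apply HB2 | exact M2].
- unfold e; rewrite Rplus_0_r, Rminus_0_r; ring.
- apply is_lim_seq_of_error with (C := C); intros V.
  enough (E : is_RInt (fun x => f x * dirichlet V (x - c)) (c - 1 / 2) (c + 1 / 2)
     (f c + RInt (fun u => e u * dirichlet V u) 0 (1 / 2))).
  { rewrite (is_RInt_unique _ _ _ _ E).
    assert (Esub : forall a b : R, a + b - a = b) by (intros; ring).
    rewrite Esub; apply HC. }
  set (g := fun x => f x * dirichlet V (x - c)).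
  assert (Cf : forall x, continuous f x) by (intros x; eapply continuous_of_is_derive, H0).
  assert (Cg : forall x, continuous g x)
    by (intros x; now apply continuous_dirichlet_shift).
  assert (Ig : forall a b, is_RInt g a b (RInt g a b)).
  { intros a b; apply (RInt_correct (V := R_CompleteNormedModule)).
    apply (@ex_RInt_continuous R_CompleteNormedModule); intros; apply Cg. }
  assert (Right : is_RInt (fun u => f (c + u) * dirichlet V u) 0 (1 / 2)
    (RInt g c (c + 1 / 2))).
  { apply (is_RInt_ext (fun u => scal 1 (g (1 * u + c)))).
    - intros u _; unfold scal; simpl; unfold mult; simpl; unfold g.
      replace (1 * u + c - c) with u by ring.
      replace (1 * u + c) with (c + u) by ring; ring.
    - apply (is_RInt_comp_lin (V := R_NormedModule) g).
      replace (1 * 0 + c) with c by ring.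
      replace (1 * (1 / 2) + c) with (c + 1 / 2) by ring.
      apply Ig. }
  assert (Left : is_RInt (fun u => f (c - u) * dirichlet V u) 0 (1 / 2)
    (RInt g (c - 1 / 2) c)).
  { apply (is_RInt_ext (fun u => opp (scal (-1) (g (-1 * u + c))))).
    - intros u _; unfold opp, scal; simpl; unfold mult; simpl; unfold g.
      replace (-1 * u + c - c) with (- u) by ring.
      rewrite dirichlet_even.
      replace (-1 * u + c) with (c - u) by ring; ring.
    - replace (RInt g (c - 1 / 2) c) with (opp (RInt g c (c - 1 / 2))).
      + apply (is_RInt_opp (V := R_NormedModule)).
        apply (is_RInt_comp_lin (V := R_NormedModule) g).
        replace (-1 * 0 + c) with c by ring.
        replace (-1 * (1 / 2) + c) with (c - 1 / 2) by ring.
        apply Ig.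
      + apply (opp_RInt_swap (V := R_CompleteNormedModule)).
        eexists; apply Ig. }
  assert (Mid := is_RInt_scal _ _ _ (2 * f c) _ (RInt_dirichlet_half V)).
  assert (All := is_RInt_minus _ _ _ _ _ _ (is_RInt_plus _ _ _ _ _ _ Right Left) Mid).
  replace (RInt (fun u => e u * dirichlet V u) 0 (1 / 2))
    with (RInt g c (c + 1 / 2) + RInt g (c - 1 / 2) c - f c).
  + assert (Eadd : forall a b : R, f c + (a + b - f c) = b + a) by (intros; ring).
    rewrite Eadd; apply (is_RInt_Chasles (V := R_NormedModule) g _ c); apply Ig.
  + symmetry; apply is_RInt_unique.
    replace (RInt g c (c + 1 / 2) + RInt g (c - 1 / 2) c - f c) with
     (minus (plus (RInt g c (c + 1 / 2)) (RInt g (c - 1 / 2) c)) (scal (2 * f c) (1 / 2))).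
    * eapply is_RInt_ext; [|exact All].
      intros u _; unfold minus, plus, opp, scal; simpl; unfold mult; simpl.
      unfold e; ring.
    * unfold minus, plus, opp, scal; simpl; unfold mult; simpl; field.
Qed.

Lemma dirichlet_add_INR (V n : nat) (u : R) :
  dirichlet V (u - INR n) = dirichlet V u.
Proof.
unfold dirichlet; do 2 f_equal; apply sum_eq; intros i _.
rewrite <- (cos_period _ (S i * n)), mult_INR; f_equal; ring.
Qed.

Lemma midpoint_sum_limit (f f1 f2 : R -> R) (n : nat) :
  (forall x, is_derive f x (f1 x)) ->
  (forall x, is_derive f1 x (f2 x)) ->
  (forall x, continuous f2 x) ->
  is_lim_seq (fun V => RInt (fun x => f x * dirichlet V (x - 1 / 2)) 0 (INR (S n)))
    (sum_f_R0 (fun j => f (INR j + 1 / 2)) n).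
Proof.
intros H0 H1 H2.
assert (cell : forall j, is_lim_seq
  (fun V => RInt (fun x => f x * dirichlet V (x - 1 / 2)) (INR j) (INR (S j)))
  (f (INR j + 1 / 2))).
{ intros j.
  eapply is_lim_seq_ext; [|apply (dirichlet_cell_limit f f1 f2 (INR j + 1 / 2) H0 H1 H2)].
  intros V; cbv beta.
  replace (INR j + 1 / 2 - 1 / 2) with (INR j) by ring.
  replace (INR j + 1 / 2 + 1 / 2) with (INR (S j)) by (rewrite S_INR; field).
  apply RInt_ext; intros x _; cbv beta.
  rewrite <- (dirichlet_add_INR V j (x - 1 / 2)).
  do 2 f_equal; ring. }
induction n as [|n IH]; [apply (cell O)|].
rewrite tech5.
eapply is_lim_seq_ext; [|apply (is_lim_seq_plus' _ _ _ _ IH (cell (S n)))].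
intros V; cbv beta.
assert (Hi : forall a b, ex_RInt (fun x => f x * dirichlet V (x - 1 / 2)) a b).
{ intros a b; apply (@ex_RInt_continuous R_CompleteNormedModule); intros x _.
  apply continuous_dirichlet_shift; intros y; eapply continuous_of_is_derive, H0. }
apply (RInt_Chasles (V := R_CompleteNormedModule)); apply Hi.
Qed.

Lemma is_RInt_sum_f_R0 (f : nat -> R -> R) (I : nat -> R) (a b : R) (n : nat) :
  (forall i, is_RInt (f i) a b (I i)) ->
  is_RInt (fun x => sum_f_R0 (fun i => f i x) n) a b (sum_f_R0 I n).
Proof.
intros H; induction n as [|n IH]; [apply H|].
apply (is_RInt_plus (V := R_NormedModule) (fun x => sum_f_R0 (fun i => f i x) n));
  [exact IH | apply H].
Qed.

(** The Poisson summation formula for midpoints; the sign (-1)^nu is the value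
    of cos (pi nu), from the shift of the kernel by 1/2. *)
Lemma midpoint_sum_fourier (f f1 f2 : R -> R) (n : nat) (I0 : R) (I : nat -> R) :
  (forall x, is_derive f x (f1 x)) ->
  (forall x, is_derive f1 x (f2 x)) ->
  (forall x, continuous f2 x) ->
  is_RInt f 0 (INR (S n)) I0 ->
  (forall i, is_RInt (fun x => f x * cos (2 * PI * INR (S i) * x)) 0 (INR (S n)) (I i)) ->
  is_lim_seq (fun V => sum_f_R0 (fun i => 2 * (-1) ^ S i * I i) V)
    (sum_f_R0 (fun j => f (INR j + 1 / 2)) n - I0).
Proof.
intros H0 H1 H2 HI0 HI.
assert (L := midpoint_sum_limit f f1 f2 n H0 H1 H2).
apply (is_lim_seq_ext (fun V =>
  RInt (fun x => f x * dirichlet V (x - 1 / 2)) 0 (INR (S n)) - I0)).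
- intros V.
  enough (E : RInt (fun x => f x * dirichlet V (x - 1 / 2)) 0 (INR (S n))
     = I0 + sum_f_R0 (fun i => 2 * (-1) ^ S i * I i) V) by (rewrite E; ring).
  apply is_RInt_unique.
  assert (HS := is_RInt_sum_f_R0
    (fun i x => 2 * (-1) ^ S i * (f x * cos (2 * PI * INR (S i) * x))) _ 0 (INR (S n)) V
    (fun i => is_RInt_scal _ _ _ (2 * (-1) ^ S i) _ (HI i))).
  eapply is_RInt_ext; [|apply (is_RInt_plus _ _ _ _ _ _ HI0 HS)].
  intros x _; unfold plus, dirichlet; simpl plus.
  rewrite Rmult_plus_distr_l, Rmult_1_r; apply f_equal.
  rewrite <- Rmult_assoc, (Rmult_comm (f x) 2), Rmult_assoc, !scal_sum.
  apply sum_eq; intros i _.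
  replace (2 * PI * INR (S i) * (x - 1 / 2))
    with (2 * PI * INR (S i) * x - PI * INR (S i)) by field.
  rewrite cos_minus, sin_PI_INR.
  assert (Hc : cos (PI * INR (S i)) = (-1) ^ S i).
  { clear; induction (S i) as [|m IH].
    - simpl; rewrite Rmult_0_r; apply cos_0.
    - rewrite S_INR, Rmult_plus_distr_l, Rmult_1_r, neg_cos, IH; simpl; ring. }
  rewrite Hc; ring.
- apply (is_lim_seq_minus' _ _ _ _ L), is_lim_seq_const.
Qed.

(** * Bernoulli polynomials at one half *)

Lemma binomial_absorb (n j : nat) : (j <= n)%nat ->
  Binomial.C (S n) j * INR (S n - j) = INR (S n) * Binomial.C n j.
Proof.
intros Hj; unfold Binomial.C.
replace (S n - j)%nat with (S (n - j)) by lia.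
rewrite !fact_simpl, !mult_INR.
field; repeat split; try apply INR_fact_neq_0; apply not_0_INR; lia.
Qed.

Lemma binomial_diag (n : nat) : Binomial.C n n = 1.
Proof.
unfold Binomial.C; rewrite Nat.sub_diag.
change (INR (fact 0)) with 1; field; apply INR_fact_neq_0.
Qed.

Lemma is_derive_bernoulli_poly (n : nat) (u : R) :
  is_derive (bernoulli_poly (S n)) u (INR (S n) * bernoulli_poly n u).
Proof.
unfold bernoulli_poly.
apply (is_derive_ext (fun u => sum_f_R0
  (fun j => Binomial.C (S n) j * bernoulli j * u ^ (S n - j)) n + bernoulli (S n))).
- intros x; rewrite tech5, Nat.sub_diag, binomial_diag; simpl; ring.
- replace (INR (S n) * _) with (sum_f_R0 (fun j => Binomial.C (S n) j * bernoulli j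
    * (INR (S n - j) * u ^ (n - j))) n + 0).
  + apply (is_derive_Rplus (fun u => sum_f_R0 _ n)).
    * apply (is_derive_sum_f_R0
        (fun j u => Binomial.C (S n) j * bernoulli j * u ^ (S n - j))
        (fun j u => Binomial.C (S n) j * bernoulli j * (INR (S n - j) * u ^ (n - j)))).
      intros j Hj; apply is_derive_scal.
      replace (n - j)%nat with (pred (S n - j)) by lia.
      rewrite <- (Rmult_1_r (INR _)) at 1.
      apply (is_derive_pow (fun x => x)), (@is_derive_id R_AbsRing).
    * apply (@is_derive_const R_AbsRing).
  + rewrite Rplus_0_r, scal_sum; apply sum_eq; intros j Hj.
    replace (Binomial.C (S n) j * bernoulli j * (INR (S n - j) * u ^ (n - j)))
      with (Binomial.C (S n) j * INR (S n - j) * bernoulli j * u ^ (n - j)) by ring.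
    rewrite binomial_absorb by exact Hj; ring.
Qed.

Lemma bernoulli_poly_0 (n : nat) : bernoulli_poly n 0 = bernoulli n.
Proof.
unfold bernoulli_poly; destruct n as [|n].
- simpl; rewrite binomial_diag; ring.
- rewrite tech5, Nat.sub_diag, binomial_diag.
  rewrite sum_f_R0_eq0; [simpl; ring|].
  intros j Hj; rewrite pow_i by lia; ring.
Qed.

(** The recursion that defines the Bernoulli numbers says exactly this. *)
Lemma bernoulli_poly_1_sub_0 (n : nat) :
  bernoulli_poly (S (S n)) 1 = bernoulli_poly (S (S n)) 0.
Proof.
rewrite bernoulli_poly_0; unfold bernoulli_poly.
rewrite tech5, binomial_diag, pow1.
rewrite (sum_eq _ (fun j => Binomial.C (S n + 1) j * bernoulli j)).
- rewrite bernoulli_rec; ring.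
- intros j _; rewrite pow1, Rmult_1_r; f_equal; f_equal; lia.
Qed.

Lemma bernoulli_poly_1_jump : bernoulli_poly 1 1 - bernoulli_poly 1 0 = 1.
Proof.
rewrite bernoulli_poly_0; unfold bernoulli_poly; simpl.
rewrite binomial_diag; unfold Binomial.C; simpl; rewrite bernoulli_0; field.
Qed.

Lemma continuous_bernoulli_poly (n : nat) (u : R) : continuous (bernoulli_poly n) u.
Proof.
destruct n as [|n].
- apply (continuous_ext (fun _ => bernoulli_poly 0 0)); [|apply continuous_const].
  intros x; unfold bernoulli_poly; simpl; ring.
- eapply continuous_of_is_derive, is_derive_bernoulli_poly.
Qed.

Lemma RInt_bernoulli_poly (n : nat) : is_RInt (bernoulli_poly (S n)) 0 1 0.
Proof.
apply (is_RInt_primitive (fun u => bernoulli_poly (S (S n)) u / INR (S (S n))));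
  [lra | | |].
- intros x _.
  replace (bernoulli_poly (S n) x)
    with (/ INR (S (S n)) * (INR (S (S n)) * bernoulli_poly (S n) x))
    by (field; apply not_0_INR; lia).
  apply (is_derive_ext (fun u => / INR (S (S n)) * bernoulli_poly (S (S n)) u)).
  + intros t; apply Rmult_comm.
  + apply is_derive_scal, is_derive_bernoulli_poly.
- intros x _; apply continuous_bernoulli_poly.
- rewrite bernoulli_poly_1_sub_0; ring.
Qed.

(** Two integrations by parts; the boundary terms containing the sine vanish. *)
Lemma RInt_bernoulli_poly_cos_step (n : nat) (a I : R) :
  a <> 0 -> sin a = 0 -> cos a = 1 ->
  is_RInt (fun x => bernoulli_poly n x * cos (a * x)) 0 1 I ->
  is_RInt (fun x => bernoulli_poly (S (S n)) x * cos (a * x)) 0 1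
    (INR (S (S n)) / a ^ 2 * (bernoulli_poly (S n) 1 - bernoulli_poly (S n) 0)
     - INR (S (S n)) * INR (S n) / a ^ 2 * I).
Proof.
intros Ha Hs Hc HI.
set (psi := fun x => bernoulli_poly (S (S n)) x * sin (a * x) / a
  + INR (S (S n)) * bernoulli_poly (S n) x * cos (a * x) / a ^ 2).
set (dpsi := fun x => bernoulli_poly (S (S n)) x * cos (a * x)
  + INR (S (S n)) * INR (S n) / a ^ 2 * (bernoulli_poly n x * cos (a * x))).
assert (H : is_RInt dpsi 0 1 (INR (S (S n)) / a ^ 2
  * (bernoulli_poly (S n) 1 - bernoulli_poly (S n) 0))).
{ apply (is_RInt_primitive psi); [lra | | |].
  - intros x _; unfold psi, dpsi.
    assert (D2 := is_derive_bernoulli_poly (S n) x).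
    assert (D1 := is_derive_bernoulli_poly n x).
    set (k2 := INR (S (S n))) in *; set (k1 := INR (S n)) in *.
    auto_derive.
    + repeat split; eexists; eassumption.
    + replace (Derive (fun y => bernoulli_poly (S (S n)) y) x)
        with (k2 * bernoulli_poly (S n) x)
        by (symmetry; apply is_derive_unique, D2).
      replace (Derive (fun y => bernoulli_poly (S n) y) x)
        with (k1 * bernoulli_poly n x)
        by (symmetry; apply is_derive_unique, D1).
      field; exact Ha.
  - assert (Cc : forall m y, continuous (fun x => bernoulli_poly m x * cos (a * x)) y).
    { intros m y; apply (continuous_mult (bernoulli_poly m) (fun x => cos (a * x)));
        [apply continuous_bernoulli_poly|].
      apply (continuous_of_is_derive _ _ (- a * sin (a * y))).
      auto_derive; [trivial | ring]. }
    intros x _; apply (continuous_plus (fun x => bernoulli_poly (S (S n)) x * cos (a * x)));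
      [apply Cc|].
    apply (continuous_scal_r _ (fun x => bernoulli_poly n x * cos (a * x))), Cc.
  - unfold psi.
    rewrite Rmult_1_r, Rmult_0_r, Hs, Hc, sin_0, cos_0; field; exact Ha. }
set (k := INR (S (S n)) * INR (S n) / a ^ 2) in *.
apply (is_RInt_ext (fun x => minus (dpsi x) (scal k (bernoulli_poly n x * cos (a * x))))).
- intros x _; unfold minus, plus, opp, scal; simpl; unfold mult; simpl.
  unfold dpsi; ring.
- apply (is_RInt_minus (V := R_NormedModule)); [exact H|].
  now apply (is_RInt_scal (V := R_NormedModule)).
Qed.

(** Among the Bernoulli polynomials only B_1 differs at 0 and 1, so the chain
    of integrations by parts has a single boundary contribution. *)
Lemma RInt_bernoulli_poly_cos (m : nat) (a : R) :
  a <> 0 -> sin a = 0 -> cos a = 1 ->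
  is_RInt (fun x => bernoulli_poly (2 * S m) x * cos (a * x)) 0 1
    ((-1) ^ m * INR (fact (2 * S m)) / a ^ (2 * S m)).
Proof.
intros Ha Hs Hc; induction m as [|m IH].
- assert (H0 : is_RInt (fun x => bernoulli_poly 0 x * cos (a * x)) 0 1 0).
  { apply (is_RInt_ext (fun x => cos (a * x))).
    - intros x _; unfold bernoulli_poly; simpl.
      rewrite binomial_diag, bernoulli_0; ring.
    - apply (is_RInt_primitive (fun x => sin (a * x) / a)); [lra | | |].
      + intros x _; auto_derive; [trivial | field; exact Ha].
      + intros x _; apply (continuous_of_is_derive _ _ (- a * sin (a * x))).
        auto_derive; [trivial | ring].
      + rewrite Rmult_1_r, Rmult_0_r, Hs, sin_0; field; exact Ha. }
  assert (H := RInt_bernoulli_poly_cos_step 0 a 0 Ha Hs Hc H0).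
  rewrite bernoulli_poly_1_jump in H.
  replace ((-1) ^ 0 * INR (fact (2 * 1)) / a ^ (2 * 1))
    with (INR 2 / a ^ 2 * 1 - INR 2 * INR 1 / a ^ 2 * 0); [exact H|].
  simpl; field; exact Ha.
- assert (H := RInt_bernoulli_poly_cos_step (2 * S m) a _ Ha Hs Hc IH).
  replace (2 * S (S m))%nat with (S (S (2 * S m))) by lia.
  replace (2 * S m)%nat with (S (S (2 * m))) in H |- * by lia.
  rewrite bernoulli_poly_1_sub_0, Rminus_diag, Rmult_0_r in H.
  replace ((-1) ^ S m * INR (fact (S (S (S (S (2 * m)))))) / a ^ S (S (S (S (2 * m)))))
    with (0 - INR (S (S (S (S (2 * m))))) * INR (S (S (S (2 * m)))) / a ^ 2
      * ((-1) ^ m * INR (fact (S (S (2 * m)))) / a ^ S (S (2 * m)))); [exact H|].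
  rewrite (fact_simpl (S (S (S (2 * m))))), (fact_simpl (S (S (2 * m)))), !mult_INR.
  simpl pow; field; split; [now apply pow_nonzero | exact Ha].
Qed.

Lemma sin_2PI_INR (n : nat) : sin (2 * PI * INR n) = 0.
Proof.
replace (2 * PI * INR n) with (0 + 2 * INR n * PI) by ring.
rewrite sin_period; apply sin_0.
Qed.

Lemma cos_2PI_INR (n : nat) : cos (2 * PI * INR n) = 1.
Proof.
replace (2 * PI * INR n) with (0 + 2 * INR n * PI) by ring.
rewrite cos_period; apply cos_0.
Qed.

Lemma bernoulli_half_series (m : nat) :
  is_lim_seq (fun V => sum_f_R0
    (fun i => 2 * (-1) ^ S i
       * ((-1) ^ m * INR (fact (2 * S m)) / (2 * PI * INR (S i)) ^ (2 * S m))) V)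
    (bernoulli_poly (2 * S m) (1 / 2)).
Proof.
replace (bernoulli_poly (2 * S m) (1 / 2))
  with (sum_f_R0 (fun j => bernoulli_poly (2 * S m) (INR j + 1 / 2)) 0 - 0)
  by (simpl; rewrite Rplus_0_l; ring).
replace (2 * S m)%nat with (S (S (2 * m))) by lia.
apply (midpoint_sum_fourier (bernoulli_poly (S (S (2 * m))))
  (fun x => INR (S (S (2 * m))) * bernoulli_poly (S (2 * m)) x)
  (fun x => INR (S (S (2 * m))) * (INR (S (2 * m)) * bernoulli_poly (2 * m) x))
  0 0).
- intros x; apply is_derive_bernoulli_poly.
- intros x; apply is_derive_scal, is_derive_bernoulli_poly.
- intros x; apply (continuous_scal_r _ (fun x => INR (S (2 * m)) * bernoulli_poly (2 * m) x)).
  apply (continuous_scal_r _ (bernoulli_poly (2 * m))), continuous_bernoulli_poly.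
- apply RInt_bernoulli_poly.
- intros i; replace (S (S (2 * m))) with (2 * S m)%nat by lia.
  apply RInt_bernoulli_poly_cos.
  + apply Rmult_integral_contrapositive_currified; [|apply not_0_INR; lia].
    assert (H := PI_RGT_0); lra.
  + apply sin_2PI_INR.
  + apply cos_2PI_INR.
Qed.

(** * The equation F'' = F - 1/s and factorial series *)

(** For sg = 1 or -1, the partial sums of the formal solution of
    y + sg y' = 1 / s. *)
Fixpoint factorial_sum (sg : R) (n : nat) (s : R) : R :=
  match n with
  | O => 0
  | S m => factorial_sum sg m s + sg ^ m * INR (fact m) / s ^ S m
  end.

(** In the form y + sg y' = 1 / s - sg^n n! / s^(n+1): consecutive terms
    telescope up to the first omitted one. *)
Lemma is_derive_factorial_sum (sg : R) (n : nat) (s : R) :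
  sg * sg = 1 -> 0 < s ->
  is_derive (factorial_sum sg n) s
    (sg * (1 / s - sg ^ n * INR (fact n) / s ^ S n - factorial_sum sg n s)).
Proof.
intros Hsg Hs; induction n as [|n IH].
- replace (sg * _) with 0.
  + apply (@is_derive_const R_AbsRing).
  + simpl; field; lra.
- cbn [factorial_sum].
  replace (sg * (1 / s - sg ^ S n * INR (fact (S n)) / s ^ S (S n)
     - (factorial_sum sg n s + sg ^ n * INR (fact n) / s ^ S n)))
  with (sg * (1 / s - sg ^ n * INR (fact n) / s ^ S n - factorial_sum sg n s)
     + sg ^ n * INR (fact n) * (- INR (S n) / s ^ S (S n))).
  + apply (is_derive_Rplus (factorial_sum sg n)); [exact IH|].
    apply (is_derive_ext (fun x => sg ^ n * INR (fact n) * / x ^ S n)); [reflexivity|].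
    apply is_derive_scal.
    auto_derive; [apply Rmult_integral_contrapositive_currified;
      [lra | apply pow_nonzero; lra]|].
    simpl pow; replace (pred (S n)) with n by reflexivity.
    assert (s ^ n <> 0) by (apply pow_nonzero; lra).
    change (match n with O => 1 | S _ => INR n + 1 end) with (INR (S n)).
    generalize (INR (S n)); intros c; field; split; lra.
  + replace (sg * (1 / s - sg ^ S n * INR (fact (S n)) / s ^ S (S n)
      - (factorial_sum sg n s + sg ^ n * INR (fact n) / s ^ S n)))
    with (sg * (1 / s - factorial_sum sg n s) - sg * (sg ^ n * INR (fact n) / s ^ S n)
       - (sg * sg) * (sg ^ n * INR (fact (S n)) / s ^ S (S n)))
      by (simpl pow; field; split; [apply pow_nonzero; lra | lra]).
    rewrite Hsg, fact_simpl, mult_INR; simpl pow.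
    assert (s ^ n <> 0) by (apply pow_nonzero; lra).
    generalize (INR (S n)); intros c; field; split; lra.
Qed.

Lemma factorial_sum_bounded (sg : R) (n : nat) :
  Rabs sg = 1 -> exists K, forall s, 1 <= s -> Rabs (factorial_sum sg n s) <= K.
Proof.
intros Hsg; induction n as [|n [K IH]].
- exists 0; intros s _; simpl; rewrite Rabs_R0; lra.
- exists (K + INR (fact n)); intros s Hs; cbn [factorial_sum].
  eapply Rle_trans; [apply Rabs_triang|]; apply Rplus_le_compat; [now apply IH|].
  assert (1 <= s ^ S n) by now apply pow_R1_Rle.
  unfold Rdiv; rewrite !Rabs_mult, <- RPow_abs, Hsg, pow1.
  rewrite (Rabs_pos_eq (INR _)), (Rabs_pos_eq (/ _)), Rmult_1_l
    by (try apply pos_INR; left; apply Rinv_0_lt_compat; lra).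
  rewrite <- (Rmult_1_r (INR (fact n))) at 2.
  apply Rmult_le_compat_l; [apply pos_INR|].
  rewrite <- Rinv_1; apply Rinv_le_contravar; lra.
Qed.

Definition exp_over_pow (m : nat) (u : R) : R := exp u / u ^ m.

Lemma is_derive_exp_over_pow (m : nat) (u : R) : 0 < u ->
  is_derive (exp_over_pow m) u (exp u / u ^ S m * (u - INR m)).
Proof.
intros Hu; unfold exp_over_pow.
assert (H : u ^ m <> 0) by (apply pow_nonzero; lra).
auto_derive; [exact H|].
destruct m as [|m].
- simpl; field; lra.
- simpl pow in *; simpl pred.
  assert (u ^ m <> 0) by (apply pow_nonzero; lra).
  generalize (INR (S m)); intros c; field; split; lra.
Qed.

Lemma exp_over_pow_incr (m : nat) (a b : R) :
  0 < a -> INR m <= a -> a <= b -> exp_over_pow m a <= exp_over_pow m b.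
Proof.
intros Ha Hm Hab.
apply (le_of_derive_nonneg _ (fun u => exp u / u ^ S m * (u - INR m))); [exact Hab | |].
- intros x Hx; apply is_derive_exp_over_pow; lra.
- intros x Hx; apply Rmult_le_pos; [|lra].
  left; apply Rdiv_lt_0_compat; [apply exp_pos | apply pow_lt; lra].
Qed.

Lemma exp_over_pow_decr (m : nat) (a b : R) :
  0 < a -> b <= INR m -> a <= b -> exp_over_pow m b <= exp_over_pow m a.
Proof.
intros Ha Hm Hab; apply Ropp_le_cancel.
apply (le_of_derive_nonneg (fun u => - exp_over_pow m u)
  (fun u => - (exp u / u ^ S m * (u - INR m)))); [exact Hab | |].
- intros x Hx; apply (is_derive_opp (V := R_NormedModule)), is_derive_exp_over_pow; lra.
- intros x Hx; rewrite Ropp_mult_distr_r; apply Rmult_le_pos; [|lra].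
  left; apply Rdiv_lt_0_compat; [apply exp_pos | apply pow_lt; lra].
Qed.

Section Comparison.

Variables (P eps : R -> R) (del : R).
Hypothesis Heps : forall s, 1 <= s -> Rabs (eps s) <= del.
Hypothesis HP : forall s, 1 <= s -> is_derive P s (1 / s - P s - eps s).
Hypothesis HP1 : Rabs (P 1) <= 1.

(** The factor e^s turns the equation for P into a quadrature, and the choice
    c = - del or c = del absorbs the perturbation eps. *)
Let gap (c : R) (n : nat) (s : R) := exp s * (P s + c - factorial_sum 1 n s).

Lemma is_derive_gap (c : R) (n : nat) (s : R) : 1 <= s ->
  is_derive (gap c n) s (INR (fact n) * exp_over_pow (S n) s + exp s * (c - eps s)).
Proof.
intros Hs; unfold gap.
assert (D := is_derive_factorial_sum 1 n s (Rmult_1_l 1) ltac:(lra)).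
rewrite pow1 in D.
assert (DP := HP s Hs).
auto_derive.
- repeat split; eexists; eassumption.
- rewrite (is_derive_unique (fun x : R => P x) _ _ DP).
  rewrite (is_derive_unique (fun x : R => factorial_sum 1 n x) _ _ D).
  unfold exp_over_pow.
  assert (s ^ S n <> 0) by (apply pow_nonzero; lra).
  field; split; lra.
Qed.

Lemma gap_succ (c : R) (n : nat) (s : R) : 0 < s ->
  gap c (S n) s = gap c n s - INR (fact n) * exp_over_pow (S n) s.
Proof.
intros Hs; unfold gap, exp_over_pow; cbn [factorial_sum]; rewrite pow1.
field; apply pow_nonzero; lra.
Qed.

Lemma gap_upper_step (n : nat) (a b : R) : INR (S n) <= a -> a <= b ->
  gap (- del) n b <= gap (- del) n a + INR (fact n) * exp_over_pow (S n) b * (b - a).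
Proof.
intros Ha Hab.
assert (Hn : 1 <= INR (S n)) by (rewrite S_INR; assert (Q := pos_INR n); lra).
set (M := INR (fact n) * exp_over_pow (S n) b).
assert (G := le_of_derive_nonneg (fun s => M * s - gap (- del) n s)
  (fun s => M - (INR (fact n) * exp_over_pow (S n) s + exp s * (- del - eps s))) a b Hab).
cbv beta in G.
enough (M * a - gap (- del) n a <= M * b - gap (- del) n b) by lra.
apply G; intros s Hs.
- apply (is_derive_minus (V := R_NormedModule) (fun s => M * s)).
  + apply is_derive_Rmult_const.
  + apply is_derive_gap; lra.
- assert (H1 := Heps s ltac:(lra)); apply Rabs_le_between in H1.
  assert (0 <= exp s * (del + eps s))
    by (apply Rmult_le_pos; [left; apply exp_pos | lra]).
  assert (INR (fact n) * exp_over_pow (S n) s <= M).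
  { apply Rmult_le_compat_l; [apply pos_INR|].
    apply exp_over_pow_incr; lra. }
  lra.
Qed.

Lemma gap_lower_step (n : nat) (a b : R) : 1 <= a -> a <= b -> b <= INR (S n) ->
  gap del n a + INR (fact n) * exp_over_pow (S n) b * (b - a) <= gap del n b.
Proof.
intros Ha Hab Hb.
set (M := INR (fact n) * exp_over_pow (S n) b).
assert (G := le_of_derive_nonneg (fun s => gap del n s - M * s)
  (fun s => (INR (fact n) * exp_over_pow (S n) s + exp s * (del - eps s)) - M) a b Hab).
cbv beta in G.
enough (gap del n a - M * a <= gap del n b - M * b) by lra.
apply G; intros s Hs.
- apply (is_derive_minus (V := R_NormedModule) (gap del n)).
  + apply is_derive_gap; lra.
  + apply is_derive_Rmult_const.
- assert (H1 := Heps s ltac:(lra)); apply Rabs_le_between in H1.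
  assert (0 <= exp s * (del - eps s))
    by (apply Rmult_le_pos; [left; apply exp_pos | lra]).
  assert (M <= INR (fact n) * exp_over_pow (S n) s).
  { apply Rmult_le_compat_l; [apply pos_INR|].
    apply exp_over_pow_decr; lra. }
  lra.
Qed.

Lemma gap_lower_mono (n : nat) (a b : R) : 1 <= a -> a <= b -> gap del n a <= gap del n b.
Proof.
intros Ha Hab.
apply (le_of_derive_nonneg (gap del n)
  (fun s => INR (fact n) * exp_over_pow (S n) s + exp s * (del - eps s)) a b Hab);
  intros s Hs; [apply is_derive_gap; lra|].
assert (H1 := Heps s ltac:(lra)); apply Rabs_le_between in H1.
apply Rplus_le_le_0_compat; apply Rmult_le_pos.
- apply pos_INR.
- left; apply Rdiv_lt_0_compat; [apply exp_pos | apply pow_lt; lra].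
- left; apply exp_pos.
- lra.
Qed.

Lemma del_nonneg : 0 <= del.
Proof. eapply Rle_trans; [apply Rabs_pos | apply (Heps 1); lra]. Qed.

(** Passing from index n at the point n + 1 to index n + 1 at the point n + 2
    does not increase the gap: over the unit step it grows by at most
    n! e^(n+2) / (n+2)^(n+1), since e^u / u^(n+1) increases for u >= n + 1, and
    the new term of the sum subtracts precisely this amount. *)
Lemma gap_upper_at (n : nat) : gap (- del) n (INR (S n)) <= exp 1.
Proof.
assert (Hd := del_nonneg).
induction n as [|n IH].
- simpl; unfold gap; simpl.
  apply Rabs_le_between in HP1.
  rewrite <- (Rmult_1_r (exp 1)) at 2.
  apply Rmult_le_compat_l; [left; apply exp_pos | lra].
- assert (Hp : 0 < INR (S (S n))) by (apply lt_0_INR; lia).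
  rewrite gap_succ by exact Hp.
  assert (St := gap_upper_step n (INR (S n)) (INR (S (S n))) (Rle_refl _)
    ltac:(rewrite (S_INR (S n)); lra)).
  replace (INR (S (S n)) - INR (S n)) with 1 in St by (rewrite (S_INR (S n)); ring).
  lra.
Qed.

(** The same comparison with the truncation one unit later: e^u / u^(n+1)
    decreases on [n, n+1], so the growth over the step is at least the new
    term.  The starting point is the index 1 at the point 1. *)
Lemma gap_lower_at (n : nat) : - (2 * exp 1) <= gap del (S n) (INR (S n)).
Proof.
assert (Hd := del_nonneg).
induction n as [|n IH].
- unfold gap; simpl.
  apply Rabs_le_between in HP1.
  replace (- (2 * exp 1)) with (exp 1 * (- 2)) by ring.
  apply Rmult_le_compat_l; [left; apply exp_pos | lra].
- assert (Hp : 0 < INR (S (S n))) by (apply lt_0_INR; lia).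
  assert (Hn : 1 <= INR (S n)) by (rewrite S_INR; assert (Q := pos_INR n); lra).
  rewrite gap_succ by exact Hp.
  assert (St := gap_lower_step (S n) (INR (S n)) (INR (S (S n))) Hn
    ltac:(rewrite (S_INR (S n)); lra) (Rle_refl _)).
  replace (INR (S (S n)) - INR (S n)) with 1 in St by (rewrite (S_INR (S n)); ring).
  lra.
Qed.

Lemma decaying_mode_upper (n : nat) (s : R) : INR (S n) <= s ->
  P s - factorial_sum 1 n s
    <= exp (1 - s) + INR (fact n) * (s - INR (S n)) / s ^ S n + del.
Proof.
intros Hs.
assert (Hn : 1 <= INR (S n)) by (rewrite S_INR; assert (Q := pos_INR n); lra).
assert (A := gap_upper_at n).
assert (B := gap_upper_step n (INR (S n)) s (Rle_refl _) Hs).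
assert (He := exp_pos s).
assert (E1 : exp (1 - s) = exp 1 / exp s)
  by (unfold Rminus; rewrite exp_plus, exp_Ropp; reflexivity).
assert (Hsn : s ^ S n <> 0) by (apply pow_nonzero; lra).
apply (Rmult_le_reg_l (exp s)); [exact He|].
replace (exp s * (exp (1 - s) + INR (fact n) * (s - INR (S n)) / s ^ S n + del))
  with (exp 1 + INR (fact n) * exp_over_pow (S n) s * (s - INR (S n)) + exp s * del).
- assert (AB := Rle_trans _ _ _ B (Rplus_le_compat_r _ _ _ A)).
  unfold gap in AB; lra.
- rewrite E1; unfold exp_over_pow; generalize (INR (S n)); intros c; field; lra.
Qed.

Lemma decaying_mode_lower (n : nat) (s : R) : INR (S n) <= s ->
  - 2 * exp (1 - s) - del <= P s - factorial_sum 1 (S n) s.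
Proof.
intros Hs.
assert (Hn : 1 <= INR (S n)) by (rewrite S_INR; assert (Q := pos_INR n); lra).
assert (A := gap_lower_at n).
assert (B := gap_lower_mono (S n) (INR (S n)) s Hn Hs).
assert (He := exp_pos s).
assert (E1 : exp (1 - s) = exp 1 / exp s)
  by (unfold Rminus; rewrite exp_plus, exp_Ropp; reflexivity).
apply (Rmult_le_reg_l (exp s)); [exact He|].
replace (exp s * (- 2 * exp (1 - s) - del)) with (- (2 * exp 1) - exp s * del)
  by (rewrite E1; field; lra).
assert (AB := Rle_trans _ _ _ A B); unfold gap in AB; lra.
Qed.

End Comparison.

(** If Z s > 0, then Z stays above that value, against the decay of Z; the
    point v at which this is read off is s + |K| / Z s. *)
Lemma nonpos_of_incr_decay (Z : R -> R) (K s : R) : 1 <= s ->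
  (forall u v, s <= u -> u <= v -> Z u <= Z v) ->
  (forall u, 1 <= u -> Z u <= exp (- u) * K) -> Z s <= 0.
Proof.
intros Hs Hmono Hdec; apply Rnot_lt_le; intros Hpos.
set (v := s + Rabs K / Z s).
assert (HK := Rabs_pos K).
assert (Hv : 0 <= Rabs K / Z s) by (apply Rmult_le_pos; [|left; apply Rinv_0_lt_compat]; lra).
assert (H1 := Hmono s v (Rle_refl _) ltac:(unfold v; lra)).
assert (H2 := Hdec v ltac:(unfold v; lra)).
assert (Hexp : v < exp v) by (assert (E := exp_ineq1 v ltac:(unfold v; lra)); lra).
assert (H3 : exp v * Z s <= Rabs K).
{ apply Rle_trans with (exp v * (exp (- v) * K)).
  - apply Rmult_le_compat_l; [left; apply exp_pos | lra].
  - rewrite <- Rmult_assoc, <- exp_plus, Rplus_opp_r, exp_0, Rmult_1_l; apply Rle_abs. }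
assert (H4 : v * Z s = s * Z s + Rabs K) by (unfold v; field; lra).
assert (0 < s * Z s) by (apply Rmult_lt_0_compat; lra).
assert (v * Z s <= exp v * Z s) by (apply Rmult_le_compat_r; lra).
lra.
Qed.

Section GrowingMode.

Variables (Q eps : R -> R) (del K : R).
Hypothesis Heps : forall s, 1 <= s -> Rabs (eps s) <= del.
Hypothesis HQ : forall s, 1 <= s -> is_derive Q s (Q s - 1 / s + eps s).
Hypothesis HK : forall s, 1 <= s -> Rabs (Q s) <= K.

(** The homogeneous solution e^s is excluded by the bound on Q: the function
    e^(-s) (sg (Q - sum) - del) increases to 0.  Sums of even and of odd length
    thus lie on opposite sides of Q, up to del. *)
Lemma growing_mode_sign (sg : R) (m : nat) (s : R) : 1 <= s ->
  sg * (-1) ^ m = - 1 -> Rabs sg = 1 ->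
  sg * (Q s - factorial_sum (-1) m s) <= del.
Proof.
intros Hs Hsg Habs.
set (Z := fun u => exp (- u) * (sg * (Q u - factorial_sum (-1) m u) - del)).
destruct (factorial_sum_bounded (-1) m) as [K' HK'];
  [rewrite Rabs_left; lra|].
assert (Hd : 0 <= del)
  by (eapply Rle_trans; [apply Rabs_pos | apply (Heps 1); lra]).
enough (HZ : Z s <= 0).
{ unfold Z in HZ; apply Rnot_lt_le; intros Hlt.
  assert (0 < Z s) by (apply Rmult_lt_0_compat; [apply exp_pos | lra]).
  unfold Z in *; lra. }
apply nonpos_of_incr_decay with (K := K + K'); [exact Hs | |].
- intros u v Hu Huv.
  apply (le_of_derive_nonneg Z
    (fun u => exp (- u) * (sg * eps u + del + INR (fact m) / u ^ S m)) u v Huv).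
  + intros x Hx; unfold Z.
    assert (D := is_derive_factorial_sum (-1) m x ltac:(lra) ltac:(lra)).
    assert (DQ := HQ x ltac:(lra)).
    auto_derive; [repeat split; eexists; eassumption|].
    rewrite (is_derive_unique (fun x : R => Q x) _ _ DQ).
    rewrite (is_derive_unique (fun y : R => factorial_sum (-1) m y) _ _ D).
    replace (INR (fact m) / x ^ S m) with (- (sg * (-1) ^ m * INR (fact m) / x ^ S m)).
    * assert (x ^ S m <> 0) by (apply pow_nonzero; lra).
      field; split; lra.
    * rewrite Hsg; field; apply pow_nonzero; lra.
  + intros x Hx; apply Rmult_le_pos; [left; apply exp_pos|].
    assert (He := Heps x ltac:(lra)).
    assert (Hse : Rabs (sg * eps x) <= del) by (rewrite Rabs_mult, Habs; lra).
    apply Rabs_le_between in Hse.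
    assert (0 <= INR (fact m) / x ^ S m).
    { apply Rmult_le_pos; [apply pos_INR|].
      left; apply Rinv_0_lt_compat, pow_lt; lra. }
    lra.
- intros u Hu; unfold Z; apply Rmult_le_compat_l; [left; apply exp_pos|].
  assert (H1 := HK u Hu); assert (H2 := HK' u Hu).
  assert (H3 : Rabs (sg * (Q u - factorial_sum (-1) m u)) <= K + K').
  { rewrite Rabs_mult, Habs, Rmult_1_l.
    eapply Rle_trans; [apply Rabs_triang|]; rewrite Rabs_Ropp; lra. }
  apply Rabs_le_between in H3; lra.
Qed.

End GrowingMode.

Fixpoint even_factorial_sum (p : nat) (s : R) : R :=
  match p with
  | O => 0
  | S q => even_factorial_sum q s + INR (fact (2 * q)) / s ^ (2 * q + 1)
  end.

Lemma even_factorial_sum_split (p : nat) (s : R) : 0 < s ->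
  factorial_sum 1 (2 * p) s + factorial_sum (-1) (2 * p) s = 2 * even_factorial_sum p s.
Proof.
intros Hs; induction p as [|p IH]; [simpl; ring|].
replace (2 * S p)%nat with (S (S (2 * p))) by lia.
cbn [factorial_sum even_factorial_sum].
rewrite Nat.add_1_r, !pow1, pow_1_odd.
replace ((-1) ^ (2 * p)) with 1 by (symmetry; apply pow_1_even).
assert (s ^ S (2 * p) <> 0) by (apply pow_nonzero; lra).
assert (s ^ S (S (2 * p)) <> 0) by (apply pow_nonzero; lra).
rewrite Rmult_plus_distr_l, <- IH; field; split; assumption.
Qed.

(** The difference P and the sum Q of a solution and its derivative solve the
    two first-order equations studied above, and the half-sum of their formal
    solutions keeps the even factorials only. *)
Section Mode.

Variables (F F1 eps : R -> R) (del K : R).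
Hypothesis Heps : forall s, 1 <= s -> Rabs (eps s) <= del.
Hypothesis HF : forall s, 1 <= s -> is_derive F s (F1 s).
Hypothesis HF1 : forall s, 1 <= s -> is_derive F1 s (F s - 1 / s + eps s).
Hypothesis Hinit : Rabs (F 1 - F1 1) <= 1.
Hypothesis HK : forall s, 1 <= s -> Rabs (F s + F1 s) <= K.

Let P (s : R) := F s - F1 s.
Let Q (s : R) := F s + F1 s.

Lemma is_derive_P (s : R) : 1 <= s -> is_derive P s (1 / s - P s - eps s).
Proof.
intros Hs; replace (1 / s - P s - eps s) with (minus (F1 s) (F s - 1 / s + eps s))
  by (unfold P, minus, plus, opp; simpl; ring).
apply (is_derive_minus (V := R_NormedModule)); auto.
Qed.

Lemma is_derive_Q (s : R) : 1 <= s -> is_derive Q s (Q s - 1 / s + eps s).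
Proof.
intros Hs; replace (Q s - 1 / s + eps s) with (F1 s + (F s - 1 / s + eps s))
  by (unfold Q; ring).
apply is_derive_Rplus; auto.
Qed.

Lemma mode_upper (p : nat) (s : R) : INR (S (2 * p)) <= s ->
  F s - even_factorial_sum p s
    <= exp (1 - s) / 2 + INR (fact (2 * p)) * (s - INR (2 * p)) / (2 * s ^ S (2 * p)) + del.
Proof.
intros Hs.
assert (H1 : 1 <= s) by (rewrite S_INR in Hs; assert (Z := pos_INR (2 * p)); lra).
assert (A := decaying_mode_upper P eps del Heps is_derive_P Hinit (2 * p) s Hs).
assert (B := growing_mode_sign Q eps del K Heps is_derive_Q HK 1 (S (2 * p)) s H1).
rewrite pow_1_odd in B.
specialize (B ltac:(ring) Rabs_R1).
cbn [factorial_sum] in B; rewrite pow_1_even in B.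
assert (E := even_factorial_sum_split p s ltac:(lra)).
unfold P, Q in A, B; rewrite (S_INR (2 * p)) in A.
assert (Hp : s ^ S (2 * p) <> 0) by (apply pow_nonzero; lra).
replace (INR (fact (2 * p)) * (s - INR (2 * p)) / (2 * s ^ S (2 * p))) with
  ((INR (fact (2 * p)) * (s - (INR (2 * p) + 1)) / s ^ S (2 * p)
    + 1 * INR (fact (2 * p)) / s ^ S (2 * p)) / 2) by (field; exact Hp).
lra.
Qed.

Lemma mode_lower (p : nat) (s : R) : (1 <= p)%nat -> INR (2 * p) <= s ->
  - exp (1 - s) - del <= F s - even_factorial_sum p s.
Proof.
intros Hp Hs.
assert (H1 : 1 <= s).
{ apply Rle_trans with (INR (2 * p)); [apply (le_INR 1); lia | exact Hs]. }
assert (A := decaying_mode_lower P eps del Heps is_derive_P Hinit (pred (2 * p)) s).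
replace (S (pred (2 * p))) with (2 * p)%nat in A by lia.
specialize (A Hs).
assert (B := growing_mode_sign Q eps del K Heps is_derive_Q HK (-1) (2 * p) s H1).
rewrite pow_1_even in B.
specialize (B ltac:(ring) ltac:(rewrite Rabs_left; lra)).
assert (E := even_factorial_sum_split p s ltac:(lra)).
unfold P, Q in A, B; lra.
Qed.

End Mode.

(** * The sine transform of the Poisson kernel *)

(** The Poisson kernel of the half-plane s > 0, up to the factor pi, and its
    first two derivatives in s. *)
Definition poisson (s y : R) : R := s / (y ^ 2 + s ^ 2).
Definition poisson_s (s y : R) : R := (y ^ 2 - s ^ 2) / (y ^ 2 + s ^ 2) ^ 2.
Definition poisson_ss (s y : R) : R :=
  (2 * s ^ 3 - 6 * s * y ^ 2) / (y ^ 2 + s ^ 2) ^ 3.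

Lemma sum_sq_pos (s y : R) : 0 < s -> 0 < y ^ 2 + s ^ 2.
Proof. intros Hs; assert (H := pow2_ge_0 y); assert (0 < s ^ 2) by now apply pow_lt. lra. Qed.

Lemma is_derive_poisson (s y : R) : 0 < s ->
  is_derive (fun u => poisson u y) s (poisson_s s y).
Proof.
intros Hs; assert (H := sum_sq_pos s y Hs).
unfold poisson, poisson_s; auto_derive; [lra | field; simpl in H |- *; lra].
Qed.

Lemma is_derive_poisson_s (s y : R) : 0 < s ->
  is_derive (fun u => poisson_s u y) s (poisson_ss s y).
Proof.
intros Hs; assert (H := sum_sq_pos s y Hs).
unfold poisson_s, poisson_ss; auto_derive.
- simpl in H; apply Rmult_integral_contrapositive_currified; lra.
- field; simpl in H |- *; lra.
Qed.

Lemma continuity_2d_pt_pow (f : R -> R -> R) (n : nat) (x y : R) :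
  continuity_2d_pt f x y -> continuity_2d_pt (fun u v => f u v ^ n) x y.
Proof.
intros H; induction n as [|n IH]; [exact (continuity_2d_pt_const x y 1)|].
now apply (continuity_2d_pt_mult f (fun u v => f u v ^ n)).
Qed.

Lemma continuity_2d_pt_sum_sq_inv (n : nat) (s y : R) : 0 < s ->
  continuity_2d_pt (fun u v => / (v ^ 2 + u ^ 2) ^ n) s y.
Proof.
intros Hs; apply continuity_2d_pt_inv.
- apply continuity_2d_pt_pow, continuity_2d_pt_plus; apply continuity_2d_pt_pow;
    [apply continuity_2d_pt_id2 | apply continuity_2d_pt_id1].
- apply pow_nonzero; assert (H := sum_sq_pos s y Hs); lra.
Qed.

Lemma continuity_2d_pt_poisson_s (s y : R) : 0 < s -> continuity_2d_pt poisson_s s y.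
Proof.
intros Hs; apply (continuity_2d_pt_mult (fun u v => v ^ 2 - u ^ 2)).
- apply continuity_2d_pt_minus; apply continuity_2d_pt_pow;
    [apply continuity_2d_pt_id2 | apply continuity_2d_pt_id1].
- now apply continuity_2d_pt_sum_sq_inv.
Qed.

Lemma continuity_2d_pt_poisson_ss (s y : R) : 0 < s -> continuity_2d_pt poisson_ss s y.
Proof.
intros Hs; apply (continuity_2d_pt_mult (fun u v => 2 * u ^ 3 - 6 * u * v ^ 2)).
- apply continuity_2d_pt_minus.
  + apply (continuity_2d_pt_mult (fun _ _ => 2) (fun u _ => u ^ 3));
      [apply continuity_2d_pt_const|].
    apply continuity_2d_pt_pow, continuity_2d_pt_id1.
  + apply (continuity_2d_pt_mult (fun u _ => 6 * u) (fun _ v => v ^ 2)).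
    * apply (continuity_2d_pt_mult (fun _ _ => 6) (fun u _ => u));
        [apply continuity_2d_pt_const | apply continuity_2d_pt_id1].
    * apply continuity_2d_pt_pow, continuity_2d_pt_id2.
- now apply continuity_2d_pt_sum_sq_inv.
Qed.

Lemma continuous_sin_mul_poisson (s y : R) : 0 < s ->
  continuous (fun y => sin y * poisson s y) y.
Proof.
intros Hs; assert (H := sum_sq_pos s y Hs).
apply (@ex_derive_continuous R_AbsRing R_NormedModule).
unfold poisson; auto_derive; simpl in H; lra.
Qed.

Lemma continuous_sin_mul_poisson_s (s y : R) : 0 < s ->
  continuous (fun y => sin y * poisson_s s y) y.
Proof.
intros Hs; assert (H := sum_sq_pos s y Hs).
apply (@ex_derive_continuous R_AbsRing R_NormedModule).
unfold poisson_s; auto_derive; simpl in H.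
apply Rmult_integral_contrapositive_currified; lra.
Qed.

Lemma continuous_sin_mul_poisson_ss (s y : R) : 0 < s ->
  continuous (fun y => sin y * poisson_ss s y) y.
Proof.
intros Hs; assert (H := sum_sq_pos s y Hs).
apply (@ex_derive_continuous R_AbsRing R_NormedModule).
unfold poisson_ss; auto_derive; simpl in H.
repeat apply Rmult_integral_contrapositive_currified; lra.
Qed.

Lemma is_derive_RInt_sin (k k1 : R -> R -> R) (M s : R) : 0 < s ->
  (forall u y, 0 < u -> is_derive (fun u => k u y) u (k1 u y)) ->
  (forall y, continuity_2d_pt k1 s y) ->
  (forall u y, 0 < u -> continuous (fun y => sin y * k u y) y) ->
  is_derive (fun u => RInt (fun y => sin y * k u y) 0 M) s
    (RInt (fun y => sin y * k1 s y) 0 M).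
Proof.
intros Hs Hk Hk1 Hc.
assert (Hloc : locally s (fun u : R => 0 < u)).
{ exists (mkposreal s Hs); intros u Hu; apply Rabs_def2 in Hu.
  unfold minus, plus, opp in Hu; simpl in Hu; lra. }
assert (D : forall u y, 0 < u -> is_derive (fun u => sin y * k u y) u (sin y * k1 u y)).
{ intros u y Hu; apply is_derive_scal; now apply Hk. }
assert (E : RInt (fun y => sin y * k1 s y) 0 M
  = RInt (fun y => Derive (fun u => sin y * k u y) s) 0 M).
{ apply RInt_ext; intros y _; symmetry; apply is_derive_unique, D, Hs. }
rewrite E.
apply (is_derive_RInt_param (fun u y => sin y * k u y)).
- apply (filter_imp _ _ (fun u (Hu : 0 < u) y _ => ex_intro _ _ (D u y Hu)) Hloc).
- intros y _.
  apply (continuity_2d_pt_ext_loc (fun u v => sin v * k1 u v)).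
  + exists (mkposreal s Hs); intros u v Hu _; apply Rabs_def2 in Hu.
    symmetry; apply is_derive_unique, D; simpl in Hu; lra.
  + apply (continuity_2d_pt_mult (fun _ v => sin v)); [|apply Hk1].
    apply (continuity_1d_2d_pt_comp sin (fun _ v => v)).
    * apply continuity_sin.
    * apply continuity_2d_pt_id2.
- apply (filter_imp (fun u => 0 < u)); [|exact Hloc].
  intros u Hu; apply (@ex_RInt_continuous R_CompleteNormedModule).
  intros y _; now apply Hc.
Qed.

Section StokesMode.

Variable M : R.
Hypothesis HM : 0 < M.
Hypothesis HsinM : sin M = 0.
Hypothesis HcosM : cos M = 1.

(** With y = s v this is the integral of sin (s v) / (1 + v^2) cut at v = M / s.
    In the variable y the two derivatives in s stay integrable. *)
Definition stokes_mode (s : R) : R := RInt (fun y => sin y * poisson s y) 0 M.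
Definition stokes_mode' (s : R) : R := RInt (fun y => sin y * poisson_s s y) 0 M.

Lemma is_RInt_stokes_mode (s : R) : 0 < s ->
  is_RInt (fun y => sin y * poisson s y) 0 M (stokes_mode s).
Proof.
intros Hs; apply (RInt_correct (V := R_CompleteNormedModule)).
apply (@ex_RInt_continuous R_CompleteNormedModule); intros.
now apply continuous_sin_mul_poisson.
Qed.

Lemma is_RInt_stokes_mode' (s : R) : 0 < s ->
  is_RInt (fun y => sin y * poisson_s s y) 0 M (stokes_mode' s).
Proof.
intros Hs; apply (RInt_correct (V := R_CompleteNormedModule)).
apply (@ex_RInt_continuous R_CompleteNormedModule); intros.
now apply continuous_sin_mul_poisson_s.
Qed.

Lemma is_derive_stokes_mode (s : R) : 0 < s -> is_derive stokes_mode s (stokes_mode' s).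
Proof.
intros Hs; apply is_derive_RInt_sin; [exact Hs | | |].
- exact is_derive_poisson.
- intros y; now apply continuity_2d_pt_poisson_s.
- exact continuous_sin_mul_poisson.
Qed.

(** The kernel is harmonic in (s, y), so its second derivative in s is minus the
    one in y; two integrations by parts in y give back the integral itself, with
    the values of the kernel at 0 and M as boundary terms. *)
Lemma is_derive_stokes_mode' (s : R) : 0 < s ->
  is_derive stokes_mode' s (stokes_mode s - 1 / s + poisson s M).
Proof.
intros Hs.
enough (E : RInt (fun y => sin y * poisson_ss s y) 0 M = stokes_mode s - 1 / s + poisson s M).
{ rewrite <- E; apply is_derive_RInt_sin; [exact Hs | | |].
  - exact is_derive_poisson_s.
  - intros y; now apply continuity_2d_pt_poisson_ss.
  - exact continuous_sin_mul_poisson_s. }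
apply is_RInt_unique.
assert (B : is_RInt (fun y => sin y * poisson s y - sin y * poisson_ss s y) 0 M
  (1 / s - poisson s M)).
{ apply (is_RInt_primitive
    (fun y => sin y * (- 2 * s * y / (y ^ 2 + s ^ 2) ^ 2) - cos y * poisson s y)); [lra | | |].
  - intros y _; assert (H := sum_sq_pos s y Hs).
    unfold poisson, poisson_ss; auto_derive.
    + simpl in H; repeat split; try (repeat apply Rmult_integral_contrapositive_currified); lra.
    + field; simpl in H |- *; lra.
  - intros y _; apply (continuous_minus (fun y => sin y * poisson s y));
      [now apply continuous_sin_mul_poisson | now apply continuous_sin_mul_poisson_ss].
  - rewrite HsinM, HcosM, sin_0, cos_0; unfold poisson.
    assert (H := sum_sq_pos s M Hs); field; split; lra. }
assert (D := is_RInt_minus _ _ _ _ _ _ (is_RInt_stokes_mode s Hs) B).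
replace (stokes_mode s - 1 / s + poisson s M) with (minus (stokes_mode s) (1 / s - poisson s M))
  by (unfold minus, plus, opp; simpl; ring).
eapply is_RInt_ext; [|exact D].
intros y _; unfold minus, plus, opp; simpl; ring.
Qed.

Lemma poisson_boundary_bound (s : R) : 0 < s -> Rabs (poisson s M) <= / (2 * M).
Proof.
intros Hs; assert (H := sum_sq_pos s M Hs); unfold poisson.
rewrite Rabs_pos_eq by (left; now apply Rdiv_lt_0_compat).
apply (Rmult_le_reg_r (M ^ 2 + s ^ 2)); [exact H|].
apply (Rmult_le_reg_l (2 * M)); [lra|].
replace (2 * M * (s / (M ^ 2 + s ^ 2) * (M ^ 2 + s ^ 2))) with (2 * M * s) by (field; lra).
replace (2 * M * (/ (2 * M) * (M ^ 2 + s ^ 2))) with (M ^ 2 + s ^ 2) by (field; lra).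
assert (P := pow2_ge_0 (M - s)); replace ((M - s) ^ 2) with (M ^ 2 + s ^ 2 - 2 * M * s) in P
  by ring; lra.
Qed.

(** At s = 1 the two kernels combine into 2 / (1 + y^2)^2, and |sin y| <= y makes
    the majorant integrable in closed form. *)
Lemma stokes_mode_initial : Rabs (stokes_mode 1 - stokes_mode' 1) <= 1.
Proof.
assert (I := is_RInt_minus _ _ _ _ _ _ (is_RInt_stokes_mode 1 Rlt_0_1) (is_RInt_stokes_mode' 1 Rlt_0_1)).
assert (B : is_RInt (fun y => 2 * y / (y ^ 2 + 1) ^ 2) 0 M (1 - 1 / (M ^ 2 + 1))).
{ apply (is_RInt_primitive (fun y => - (1 / (y ^ 2 + 1)))); [lra | | |].
  - intros y _; assert (H := pow2_ge_0 y); auto_derive; [simpl in H; lra|].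
    field; simpl in H |- *; lra.
  - intros y _; assert (H := pow2_ge_0 y).
    apply (@ex_derive_continuous R_AbsRing R_NormedModule); auto_derive.
    simpl in H; apply Rmult_integral_contrapositive_currified; lra.
  - assert (H := pow2_ge_0 M); field; lra. }
refine (Rle_trans _ _ _ (norm_RInt_le (V := R_NormedModule) _ _ _ _ _ _
  (Rlt_le _ _ HM) _ I B) _); cycle 1.
{ assert (0 < 1 / (M ^ 2 + 1)) by (apply Rdiv_lt_0_compat; [lra|];
    assert (Z := pow2_ge_0 M); lra).
  lra. }
intros y Hy.
change (Rabs (sin y * poisson 1 y - sin y * poisson_s 1 y) <= 2 * y / (y ^ 2 + 1) ^ 2).
assert (Z := pow2_ge_0 y).
replace (sin y * poisson 1 y - sin y * poisson_s 1 y)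
  with (sin y * (2 / (y ^ 2 + 1) ^ 2)) by (unfold poisson, poisson_s; field; lra).
assert (Hp : 0 < 2 / (y ^ 2 + 1) ^ 2) by (apply Rdiv_lt_0_compat; [lra | apply pow_lt; lra]).
rewrite Rabs_mult, (Rabs_pos_eq (2 / _)) by lra.
replace (2 * y / (y ^ 2 + 1) ^ 2) with (y * (2 / (y ^ 2 + 1) ^ 2)) by (field; lra).
apply Rmult_le_compat_r; [lra|].
assert (T := Rabs_increment_le sin cos 0 y 1 ltac:(lra) (fun x _ => is_derive_sin x)
  (fun x _ => Rabs_le _ _ (COS_bound x))).
rewrite sin_0, !Rminus_0_r in T; lra.
Qed.

(** The bound depends on M, which is harmless: any bound excludes the growth
    e^s of the sum of the mode and its derivative. *)
Lemma stokes_mode_sum_bounded (s : R) : 1 <= s -> Rabs (stokes_mode s + stokes_mode' s) <= M * 2.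
Proof.
intros Hs.
assert (I := is_RInt_plus _ _ _ _ _ _ (is_RInt_stokes_mode s ltac:(lra))
  (is_RInt_stokes_mode' s ltac:(lra))).
replace (M * 2) with ((M - 0) * 2) by ring.
refine (norm_RInt_le_const (V := R_NormedModule) _ _ _ _ _ (Rlt_le _ _ HM) _ I).
intros y Hy.
change (Rabs (sin y * poisson s y + sin y * poisson_s s y) <= 2).
assert (H := sum_sq_pos s y ltac:(lra)); assert (Z := pow2_ge_0 y).
assert (Hs2 : s <= s ^ 2) by (simpl; rewrite Rmult_1_r;
  rewrite <- (Rmult_1_l s) at 1; apply Rmult_le_compat_r; lra).
rewrite <- Rmult_plus_distr_l, Rabs_mult.
rewrite <- (Rmult_1_l 2); apply Rmult_le_compat; try apply Rabs_pos.
- apply Rabs_le, SIN_bound.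
- eapply Rle_trans; [apply Rabs_triang|].
  replace 2 with (1 + 1) by ring; apply Rplus_le_compat.
  + unfold poisson; rewrite Rabs_pos_eq by (left; apply Rdiv_lt_0_compat; lra).
    apply (Rmult_le_reg_r (y ^ 2 + s ^ 2)); [exact H|].
    unfold Rdiv; rewrite Rmult_assoc, Rinv_l; lra.
  + unfold poisson_s; assert (H2 : 0 < (y ^ 2 + s ^ 2) ^ 2) by now apply pow_lt.
    rewrite Rabs_div, (Rabs_pos_eq (_ ^ 2)) by lra.
    apply (Rmult_le_reg_r ((y ^ 2 + s ^ 2) ^ 2)); [exact H2|].
    unfold Rdiv; rewrite Rmult_assoc, Rinv_l, Rmult_1_r, Rmult_1_l by lra.
    apply Rle_trans with (y ^ 2 + s ^ 2); [apply Rabs_le; lra|].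
    assert (Hd : 1 <= y ^ 2 + s ^ 2) by lra.
    generalize dependent (y ^ 2 + s ^ 2); intros d _ _ Hd; nra.
Qed.

Lemma stokes_mode_upper (p : nat) (s : R) : INR (S (2 * p)) <= s ->
  stokes_mode s - even_factorial_sum p s
    <= exp (1 - s) / 2 + INR (fact (2 * p)) * (s - INR (2 * p)) / (2 * s ^ S (2 * p))
       + / (2 * M).
Proof.
apply (mode_upper stokes_mode stokes_mode' (fun s => poisson s M) (/ (2 * M)) (M * 2)).
- intros u Hu; apply poisson_boundary_bound; lra.
- intros u Hu; apply is_derive_stokes_mode; lra.
- intros u Hu; apply is_derive_stokes_mode'; lra.
- apply stokes_mode_initial.
- intros u Hu; now apply stokes_mode_sum_bounded.
Qed.

Lemma stokes_mode_lower (p : nat) (s : R) : (1 <= p)%nat -> INR (2 * p) <= s ->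
  - exp (1 - s) - / (2 * M) <= stokes_mode s - even_factorial_sum p s.
Proof.
apply (mode_lower stokes_mode stokes_mode' (fun s => poisson s M) (/ (2 * M)) (M * 2)).
- intros u Hu; apply poisson_boundary_bound; lra.
- intros u Hu; apply is_derive_stokes_mode; lra.
- intros u Hu; apply is_derive_stokes_mode'; lra.
- apply stokes_mode_initial.
- intros u Hu; now apply stokes_mode_sum_bounded.
Qed.

End StokesMode.

(** The derivative of the arctangent is the Poisson kernel, so one integration
    by parts and the substitution y = a x give the mode. *)
Lemma RInt_arctan_cos (t a X : R) : 0 < t -> 0 < a -> 0 < X -> sin (a * X) = 0 ->
  is_RInt (fun x => (PI / 2 - atan (x / t)) * cos (a * x)) 0 X (stokes_mode (a * X) (a * t) / a).
Proof.
intros Ht Ha HX HsX.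
assert (Hat : 0 < a * t) by now apply Rmult_lt_0_compat.
assert (I : is_RInt (fun x => scal a (sin (a * x + 0) * poisson (a * t) (a * x + 0))) 0 X
  (stokes_mode (a * X) (a * t))).
{ apply (is_RInt_comp_lin (V := R_NormedModule) (fun y => sin y * poisson (a * t) y)).
  rewrite Rmult_0_r, !Rplus_0_r; now apply is_RInt_stokes_mode. }
assert (B : is_RInt (fun x => (PI / 2 - atan (x / t)) * cos (a * x)
   - sin (a * x) * poisson (a * t) (a * x)) 0 X 0).
{ apply (is_RInt_primitive (fun x => (PI / 2 - atan (x / t)) * sin (a * x) / a)); [lra | | |].
  - intros x _; assert (H := sum_sq_pos t x Ht); unfold poisson; auto_derive; [lra|].
    assert (H' := sum_sq_pos (a * t) (a * x) Hat).
    unfold Rdiv; field; repeat split; lra.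
  - intros x _; assert (H' := sum_sq_pos (a * t) (a * x) Hat).
    apply (@ex_derive_continuous R_AbsRing R_NormedModule); unfold poisson; auto_derive.
    simpl in H'; repeat split; lra.
  - replace (a * 0) with 0 by ring; rewrite HsX, sin_0; unfold Rdiv; ring. }
assert (D := is_RInt_plus _ _ _ _ _ _ B (is_RInt_scal _ _ _ (/ a) _ I)).
replace (stokes_mode (a * X) (a * t) / a)
  with (plus 0 (scal (/ a) (stokes_mode (a * X) (a * t))))
  by (unfold plus, scal; simpl; unfold mult; simpl; field; lra).
eapply is_RInt_ext; [|exact D].
intros x _; unfold plus, scal; simpl; unfold mult; simpl.
rewrite Rplus_0_r; field; lra.
Qed.

(** * The argument of Gamma on the line Re z = 1/2 *)

Definition polar (r th : R) : C := (r * cos th, r * sin th).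

Lemma polar_mult (r1 r2 th1 th2 : R) :
  Cmult (polar r1 th1) (polar r2 th2) = polar (r1 * r2) (th1 + th2).
Proof. unfold polar, Cmult; simpl; rewrite cos_plus, sin_plus; f_equal; ring. Qed.

Lemma polar_div (r1 r2 th1 th2 : R) : r2 <> 0 ->
  Cdiv (polar r1 th1) (polar r2 th2) = polar (r1 / r2) (th1 - th2).
Proof.
intros H.
assert (H2 : polar r2 th2 <> RtoC 0).
{ intros E; unfold polar, RtoC in E; injection E as E1 E2.
  assert (T := sin2_cos2 th2); unfold Rsqr in T.
  assert (cos th2 = 0) by (apply (Rmult_eq_reg_l r2); lra).
  assert (sin th2 = 0) by (apply (Rmult_eq_reg_l r2); lra).
  replace (cos th2) with 0 in T; replace (sin th2) with 0 in T; lra. }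
replace (polar r1 th1) with (Cmult (polar (r1 / r2) (th1 - th2)) (polar r2 th2)).
- unfold Cdiv; rewrite <- Cmult_assoc, Cinv_r, Cmult_1_r by exact H2; reflexivity.
- rewrite polar_mult; f_equal; [field; exact H | ring].
Qed.

Definition critical_line (y : R) : C := (1 / 2, y).

Fixpoint rising_sq (y : R) (n : nat) : R :=
  match n with
  | O => 1
  | S m => rising_sq y m * ((INR m + 1 / 2) ^ 2 + y ^ 2)
  end.

Fixpoint rising_arg (y : R) (n : nat) : R :=
  match n with
  | O => 0
  | S m => rising_arg y m + atan (y / (INR m + 1 / 2))
  end.

Lemma half_sq_pos (n : nat) (y : R) : 0 < (INR n + 1 / 2) ^ 2 + y ^ 2.
Proof.
assert (H := pos_INR n); assert (H1 := pow2_ge_0 y).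
assert (0 < (INR n + 1 / 2) ^ 2) by (apply pow_lt; lra); lra.
Qed.

Lemma rising_sq_pos (y : R) (n : nat) : 0 < rising_sq y n.
Proof.
induction n as [|n IH]; [simpl; lra|].
apply Rmult_lt_0_compat; [exact IH | apply half_sq_pos].
Qed.

Lemma polar_atan (c y : R) : 0 < c ->
  polar (sqrt (c ^ 2 + y ^ 2)) (atan (y / c)) = (c, y).
Proof.
intros Hc; unfold polar; rewrite cos_atan, sin_atan.
assert (Hy := pow2_ge_0 y).
assert (Hc2 : 0 < c ^ 2) by now apply pow_lt.
assert (E : sqrt (1 + (y / c)²) = sqrt (c ^ 2 + y ^ 2) / c).
{ transitivity (sqrt ((c ^ 2 + y ^ 2) / c ^ 2)).
  - f_equal; unfold Rsqr; field; lra.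
  - rewrite sqrt_div_alt, sqrt_pow2 by lra; reflexivity. }
assert (Hs : sqrt (c ^ 2 + y ^ 2) <> 0) by (apply Rgt_not_eq, sqrt_lt_R0; lra).
rewrite E; f_equal; field; lra.
Qed.

Lemma rising_polar (y : R) (n : nat) :
  rising (critical_line y) n = polar (sqrt (rising_sq y n)) (rising_arg y n).
Proof.
induction n as [|n IH].
- simpl; unfold polar, RtoC; rewrite sqrt_1, cos_0, sin_0; f_equal; ring.
- cbn [rising rising_sq rising_arg]; rewrite IH.
  replace (Cplus (critical_line y) (RtoC (INR n)))
    with (polar (sqrt ((INR n + 1 / 2) ^ 2 + y ^ 2)) (atan (y / (INR n + 1 / 2)))).
  + rewrite polar_mult, <- sqrt_mult_alt by (left; apply rising_sq_pos); reflexivity.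
  + rewrite polar_atan by (assert (H := pos_INR n); lra).
    unfold critical_line, Cplus, RtoC; simpl; f_equal; ring.
Qed.

Definition theta_approx (n : nat) (y : R) : R := y * ln (INR n) - rising_arg y (S n).

Definition modulus_sq (y : R) (n : nat) : R :=
  INR (fact n) ^ 2 * INR n / rising_sq y (S n).

Lemma Gamma_approx_polar (y : R) (n : nat) : (1 <= n)%nat ->
  Gamma_approx (critical_line y) n = polar (sqrt (modulus_sq y n)) (theta_approx n y).
Proof.
intros Hn; unfold Gamma_approx; rewrite rising_polar.
assert (Hn0 : 0 < INR n) by (apply lt_0_INR; lia).
assert (Hf := INR_fact_lt_0 n).
assert (Hr := rising_sq_pos y (S n)).
replace (Cmult (RtoC (INR (fact n))) (Cexp (Cmult (critical_line y) (RtoC (ln (INR n))))))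
  with (polar (INR (fact n) * sqrt (INR n)) (y * ln (INR n))).
- rewrite polar_div by (apply Rgt_not_eq, sqrt_lt_R0; exact Hr).
  unfold modulus_sq, theta_approx; f_equal.
  rewrite sqrt_div_alt by exact Hr.
  rewrite sqrt_mult_alt by apply pow2_ge_0.
  rewrite sqrt_pow2 by lra; reflexivity.
- unfold polar, Cexp, critical_line, Cmult, RtoC, Re, Im; simpl.
  replace (exp (1 / 2 * ln (INR n) - y * 0)) with (sqrt (INR n)).
  + replace (1 / 2 * 0 + y * ln (INR n)) with (y * ln (INR n)) by ring.
    f_equal; ring.
  + rewrite <- Rpower_sqrt by exact Hn0; unfold Rpower; f_equal; field.
Qed.

(** The squared modulus times (n+1)/n decreases: the ratio of consecutive values
    is (n+1) (n+2) / ((n + 3/2)^2 + y^2). *)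
Lemma modulus_converges (y : R) :
  exists r, 0 <= r /\ is_lim_seq (fun n => sqrt (modulus_sq y (S n))) r.
Proof.
set (w := fun n => modulus_sq y (S n) * (INR (S n) + 1) / INR (S n)).
assert (Hn : forall n, 0 < INR (S n)) by (intros n; apply lt_0_INR; lia).
assert (Hpos : forall n, 0 <= modulus_sq y (S n)).
{ intros n; unfold modulus_sq; apply Rmult_le_pos.
  - apply Rmult_le_pos; [apply pow2_ge_0 | apply pos_INR].
  - left; apply Rinv_0_lt_compat, rising_sq_pos. }
assert (Hw : ex_finite_lim_seq w).
{ apply ex_finite_lim_seq_decr with (M := 0).
  - intros n; assert (H := Hn n).
    assert (Hr := rising_sq_pos y (S (S n))); assert (Hh := half_sq_pos (S (S n)) y).
    assert (E : w (S n) = w n * ((INR (S n) + 1) * (INR (S n) + 2)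
      / ((INR (S (S n)) + 1 / 2) ^ 2 + y ^ 2))).
    { unfold w, modulus_sq.
      change (rising_sq y (S (S (S n)))) with (rising_sq y (S (S n))
        * ((INR (S (S n)) + 1 / 2) ^ 2 + y ^ 2)).
      rewrite fact_simpl, mult_INR.
      generalize dependent ((INR (S (S n)) + 1 / 2) ^ 2 + y ^ 2).
      rewrite (S_INR (S n)); intros D HD.
      generalize dependent (rising_sq y (S (S n))); generalize (INR (fact (S n))).
      generalize dependent (INR (S n)).
      intros x Hx f A HA; field; repeat split; lra. }
    rewrite E; apply Rle_trans with (w n * 1); [apply Rmult_le_compat_l | lra].
    + unfold w; apply Rmult_le_pos; [|left; now apply Rinv_0_lt_compat].
      apply Rmult_le_pos; [apply Hpos | lra].
    + apply (Rmult_le_reg_r ((INR (S (S n)) + 1 / 2) ^ 2 + y ^ 2)); [exact Hh|].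
      unfold Rdiv; rewrite Rmult_assoc, Rinv_l, Rmult_1_r by lra.
      rewrite (S_INR (S n)); assert (Hy := pow2_ge_0 y); nra.
  - intros n; unfold w; apply Rmult_le_pos; [|left; now apply Rinv_0_lt_compat].
    apply Rmult_le_pos; [apply Hpos | assert (H := Hn n); lra]. }
destruct Hw as [l Hl].
assert (Hinv : is_lim_seq (fun n => / INR (S n)) 0).
{ apply (is_lim_seq_inv _ p_infty); [|discriminate].
  apply (is_lim_seq_incr_1 INR), is_lim_seq_INR. }
assert (Hq : is_lim_seq (fun n => modulus_sq y (S n)) l).
{ apply (is_lim_seq_ext (fun n => w n / (1 + / INR (S n)))).
  - intros n; assert (H := Hn n); unfold w; field; lra.
  - replace (Finite l) with (Finite (l / (1 + 0))) by (f_equal; field).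
    apply is_lim_seq_div'; [exact Hl | | lra].
    apply is_lim_seq_plus'; [apply is_lim_seq_const | exact Hinv]. }
exists (sqrt l); split; [apply sqrt_pos|].
apply (is_lim_seq_continuous sqrt); [|exact Hq].
apply continuity_pt_sqrt.
apply (is_lim_seq_le (fun _ => 0) _ 0 l Hpos (is_lim_seq_const 0) Hq).
Qed.

(** The derivative in y of [theta_approx].  A bound uniform in n on [0, T] makes
    the arguments equi-Lipschitz, which bounds the increasing sequence that they
    form and makes its limit continuous. *)
Definition theta_slope (n : nat) (y : R) : R :=
  ln (INR n)
  - sum_f_R0 (fun j => (INR j + 1 / 2) / ((INR j + 1 / 2) ^ 2 + y ^ 2)) n.

Lemma rising_arg_sum (n : nat) (y : R) :
  rising_arg y (S n) = sum_f_R0 (fun j => atan (y / (INR j + 1 / 2))) n.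
Proof.
induction n as [|n IH]; [simpl; ring|].
rewrite tech5, <- IH; reflexivity.
Qed.

Lemma is_derive_theta_approx (n : nat) (y : R) :
  is_derive (theta_approx n) y (theta_slope n y).
Proof.
apply (is_derive_ext (fun y => ln (INR n) * y
  + - sum_f_R0 (fun j => atan (y / (INR j + 1 / 2))) n)).
- intros x; unfold theta_approx; rewrite rising_arg_sum.
  apply (Rplus_eq_compat_r _ (ln (INR n) * x)), Rmult_comm.
- apply is_derive_Rplus; [apply is_derive_Rmult_const|].
  apply (is_derive_opp (V := R_NormedModule)).
  apply (is_derive_sum_f_R0 (fun j y => atan (y / (INR j + 1 / 2)))
    (fun j y => (INR j + 1 / 2) / ((INR j + 1 / 2) ^ 2 + y ^ 2))).
  intros j _; cbv beta; assert (H := half_sq_pos j y).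
  assert (Hc : 0 < INR j + 1 / 2) by (assert (Hj := pos_INR j); lra).
  generalize dependent (INR j + 1 / 2); intros c H Hc.
  auto_derive; [lra|].
  unfold Rdiv; field; repeat split; simpl in H; lra.
Qed.

Lemma ln_succ_ratio_bounds (n : nat) :
  / (INR (S n) + 1) <= ln (INR (S (S n))) - ln (INR (S n)) <= / INR (S n).
Proof.
assert (Hn : 0 < INR (S n)) by (apply lt_0_INR; lia).
rewrite (S_INR (S n)).
assert (Hmono : forall x, 0 < x -> ln x <= x - 1).
{ intros x Hx; rewrite <- (exp_ln x Hx) at 2.
  assert (E := exp_ineq1_le (ln x)); lra. }
split.
- assert (H := Hmono (INR (S n) / (INR (S n) + 1)) ltac:(apply Rdiv_lt_0_compat; lra)).
  unfold Rdiv in H; rewrite ln_mult, ln_Rinv in H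
    by (try apply Rinv_0_lt_compat; lra).
  replace (INR (S n) * / (INR (S n) + 1) - 1) with (- / (INR (S n) + 1)) in H by (field; lra).
  lra.
- assert (H := Hmono ((INR (S n) + 1) / INR (S n)) ltac:(apply Rdiv_lt_0_compat; lra)).
  unfold Rdiv in H; rewrite ln_mult, ln_Rinv in H
    by (try apply Rinv_0_lt_compat; lra).
  replace ((INR (S n) + 1) * / INR (S n) - 1) with (/ INR (S n)) in H by (field; lra).
  lra.
Qed.

(** The increment is ln ((n+1)/n) minus a term close to 1/(n + 3/2), hence
    nonnegative and of order 1/n^2; the majorant is written in telescoping
    form. *)
Lemma theta_slope_step (n : nat) (y T : R) : Rabs y <= T ->
  0 <= theta_slope (S (S n)) y - theta_slope (S n) y
    <= (2 + T ^ 2) * (/ INR (S n) - / INR (S (S n))).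
Proof.
intros Hy; unfold theta_slope; rewrite tech5.
assert (Hn : 1 <= INR (S n)) by (apply (le_INR 1); lia).
destruct (ln_succ_ratio_bounds n) as [H1 H2].
assert (Hyy : y ^ 2 <= T ^ 2).
{ rewrite <- pow2_abs; apply pow_incr; split; [apply Rabs_pos | exact Hy]. }
assert (Hy0 := pow2_ge_0 y).
assert (Hh := half_sq_pos (S (S n)) y).
rewrite (S_INR (S n)) in *; set (x := INR (S n)) in *.
set (c := x + 1 + 1 / 2) in *.
assert (Hc : c = x + 3 / 2) by (unfold c; field).
assert (A : c / (c ^ 2 + y ^ 2) <= / (x + 1)).
{ apply (Rmult_le_reg_r ((c ^ 2 + y ^ 2) * (x + 1))).
  - apply Rmult_lt_0_compat; lra.
  - replace (c / (c ^ 2 + y ^ 2) * ((c ^ 2 + y ^ 2) * (x + 1))) with (c * (x + 1))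
      by (field; lra).
    replace (/ (x + 1) * ((c ^ 2 + y ^ 2) * (x + 1))) with (c ^ 2 + y ^ 2) by (field; lra).
    rewrite Hc; nra. }
assert (B : / x - c / (c ^ 2 + y ^ 2) <= (2 + T ^ 2) * (/ x - / (x + 1))).
{ apply (Rmult_le_reg_r ((c ^ 2 + y ^ 2) * (x * (x + 1)))).
  - repeat apply Rmult_lt_0_compat; lra.
  - replace ((/ x - c / (c ^ 2 + y ^ 2)) * ((c ^ 2 + y ^ 2) * (x * (x + 1))))
      with ((c ^ 2 + y ^ 2 - x * c) * (x + 1)) by (field; lra).
    replace ((2 + T ^ 2) * (/ x - / (x + 1)) * ((c ^ 2 + y ^ 2) * (x * (x + 1))))
      with ((2 + T ^ 2) * (c ^ 2 + y ^ 2)) by (field; lra).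
    replace (c ^ 2 + y ^ 2 - x * c) with (3 / 2 * c + y ^ 2) by (rewrite Hc; field).
    assert (D1 : 3 / 2 * c * (x + 1) <= 2 * (c ^ 2 + y ^ 2)) by (rewrite Hc in *; nra).
    assert (D2 : y ^ 2 * (x + 1) <= T ^ 2 * (c ^ 2 + y ^ 2)).
    { apply Rle_trans with (T ^ 2 * (x + 1)); [apply Rmult_le_compat_r; lra|].
      apply Rmult_le_compat_l; [apply pow2_ge_0 | rewrite Hc; nra]. }
    lra. }
lra.
Qed.

Lemma theta_slope_bounded (n : nat) (y T : R) : Rabs y <= T ->
  Rabs (theta_slope (S n) y) <= 5 + T ^ 2.
Proof.
intros Hy.
assert (H : theta_slope 1 y <= theta_slope (S n) y
  <= theta_slope 1 y + (2 + T ^ 2) * (1 - / INR (S n))).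
{ induction n as [|n IH]; [simpl; rewrite Rinv_1; lra|].
  assert (St := theta_slope_step n y T Hy); lra. }
assert (Hn : 0 < / INR (S n)) by (apply Rinv_0_lt_compat, lt_0_INR; lia).
assert (HT := pow2_ge_0 T).
assert (Hprod : 0 <= (2 + T ^ 2) * / INR (S n)) by (apply Rmult_le_pos; lra).
assert (Hhalf : forall c, 1 / 2 <= c -> 0 <= c / (c ^ 2 + y ^ 2) <= / c).
{ intros c Hc; assert (Hy0 := pow2_ge_0 y).
  assert (0 < c ^ 2) by (apply pow_lt; lra).
  split; [apply Rmult_le_pos; [lra | left; apply Rinv_0_lt_compat; lra]|].
  replace (/ c) with (c / c ^ 2) by (field; lra).
  apply Rmult_le_compat_l; [lra | apply Rinv_le_contravar; lra]. }
assert (B0 := Hhalf (INR 0 + 1 / 2) ltac:(simpl; lra)).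
assert (B1 := Hhalf (INR 1 + 1 / 2) ltac:(simpl; lra)).
assert (E : theta_slope 1 y = ln 1
  - ((INR 0 + 1 / 2) / ((INR 0 + 1 / 2) ^ 2 + y ^ 2)
     + (INR 1 + 1 / 2) / ((INR 1 + 1 / 2) ^ 2 + y ^ 2))) by reflexivity.
change (INR 1) with 1 in *; change (INR 0) with 0 in *; rewrite ln_1 in E.
assert (E0 : / (0 + 1 / 2) = 2) by field.
assert (E1 : / (1 + 1 / 2) = 2 / 3) by field.
apply Rabs_le; lra.
Qed.

Lemma theta_approx_0 (n : nat) : theta_approx n 0 = 0.
Proof.
unfold theta_approx; rewrite rising_arg_sum, sum_f_R0_eq0; [ring|].
intros i _; unfold Rdiv; rewrite Rmult_0_l; apply atan_0.
Qed.

Lemma theta_approx_lipschitz (n : nat) (T x y : R) :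
  0 <= x <= T -> 0 <= y <= T ->
  Rabs (theta_approx (S n) x - theta_approx (S n) y) <= (5 + T ^ 2) * Rabs (x - y).
Proof.
assert (W : forall a b, 0 <= a <= b -> b <= T ->
  Rabs (theta_approx (S n) b - theta_approx (S n) a) <= (5 + T ^ 2) * (b - a)).
{ intros a b Ha Hb; apply Rabs_increment_le with (df := theta_slope (S n)); [lra | |].
  - intros u _; apply is_derive_theta_approx.
  - intros u Hu; apply theta_slope_bounded; rewrite Rabs_pos_eq; lra. }
intros Hx Hy; destruct (Rle_dec x y) as [H|H].
- rewrite Rabs_minus_sym, (Rabs_minus_sym x), (Rabs_pos_eq (y - x)) by lra.
  apply W; lra.
- rewrite (Rabs_pos_eq (x - y)) by lra; apply W; lra.
Qed.

Definition theta_lim (y : R) : R := real (Lim_seq (fun n => theta_approx (S n) y)).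

Lemma theta_lim_correct (y : R) : 0 <= y ->
  is_lim_seq (fun n => theta_approx (S n) y) (theta_lim y).
Proof.
intros Hy.
enough (H : ex_finite_lim_seq (fun n => theta_approx (S n) y)).
{ apply Lim_seq_correct' in H; exact H. }
apply ex_finite_lim_seq_incr with (M := (5 + y ^ 2) * y).
- intros n.
  assert (H := le_of_derive_nonneg
    (fun u => theta_approx (S (S n)) u - theta_approx (S n) u)
    (fun u => theta_slope (S (S n)) u - theta_slope (S n) u) 0 y Hy).
  cbv beta in H; rewrite !theta_approx_0 in H.
  enough (0 - 0 <= theta_approx (S (S n)) y - theta_approx (S n) y) by lra.
  apply H; intros u Hu.
  + apply (is_derive_minus (V := R_NormedModule)); apply is_derive_theta_approx.
  + apply (theta_slope_step n u (Rabs u)); lra.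
- intros n; assert (H := theta_approx_lipschitz n y y 0 ltac:(lra) ltac:(lra)).
  rewrite theta_approx_0, !Rminus_0_r, (Rabs_pos_eq y) in H by exact Hy.
  eapply Rle_trans; [apply Rle_abs | exact H].
Qed.

Lemma theta_lim_lipschitz (T x y : R) :
  0 <= x <= T -> 0 <= y <= T ->
  Rabs (theta_lim x - theta_lim y) <= (5 + T ^ 2) * Rabs (x - y).
Proof.
intros Hx Hy.
assert (L := is_lim_seq_minus' _ _ _ _ (theta_lim_correct x (proj1 Hx))
  (theta_lim_correct y (proj1 Hy))).
apply is_lim_seq_abs in L.
apply (is_lim_seq_le _ _ _ _ (fun n => theta_approx_lipschitz n T x y Hx Hy) L
  (is_lim_seq_const _)).
Qed.

Lemma Gamma_critical_line (y : R) : 0 <= y ->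
  exists r, 0 <= r /\ Gamma (critical_line y) = polar r (theta_lim y).
Proof.
intros Hy; destruct (modulus_converges y) as [r [Hr Lr]].
exists r; split; [exact Hr|].
assert (Lt := theta_lim_correct y Hy).
assert (E : forall n, Gamma_approx (critical_line y) (S n)
  = polar (sqrt (modulus_sq y (S n))) (theta_approx (S n) y))
  by (intros n; apply Gamma_approx_polar; lia).
assert (G : forall (u : nat -> R) (l : R), is_lim_seq (fun n => u (S n)) l ->
  real (Lim_seq u) = l).
{ intros u l Hl; apply is_lim_seq_incr_1 in Hl; now rewrite (is_lim_seq_unique _ _ Hl). }
unfold Gamma, polar; f_equal; apply G.
- apply (is_lim_seq_ext (fun n => sqrt (modulus_sq y (S n)) * cos (theta_approx (S n) y))).
  + intros n; rewrite E; reflexivity.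
  + apply is_lim_seq_mult'; [exact Lr|].
    apply (is_lim_seq_continuous cos); [apply continuity_cos | exact Lt].
- apply (is_lim_seq_ext (fun n => sqrt (modulus_sq y (S n)) * sin (theta_approx (S n) y))).
  + intros n; rewrite E; reflexivity.
  + apply is_lim_seq_mult'; [exact Lr|].
    apply (is_lim_seq_continuous sin); [apply continuity_sin | exact Lt].
Qed.

Lemma slit_plane_critical_line (y : R) : slit_plane (critical_line y).
Proof. unfold slit_plane, critical_line; simpl; lra. Qed.

Lemma continuous_Im_critical_line (L : C -> C) (y : R) :
  (forall z, slit_plane z -> @ex_derive C_AbsRing C_NormedModule L z) ->
  continuous (fun y => Im (L (critical_line y))) y.
Proof.
intros HL.
assert (H := ex_derive_continuous L (critical_line y) (HL _ (slit_plane_critical_line y))).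
intros P [eps HP].
destruct (H (fun w => ball (L (critical_line y)) eps w)) as [del Hdel].
{ exists eps; intros w Hw; exact Hw. }
exists del; intros y' Hy'; apply HP.
assert (B : ball (L (critical_line y)) eps (L (critical_line y'))).
{ apply Hdel.
  unfold ball in *; simpl in *; unfold AbsRing_ball in *; unfold abs, minus, plus, opp in *;
    simpl in *.
  unfold critical_line, Cplus, Copp; simpl.
  replace (1 / 2 + - (1 / 2)) with 0 by ring.
  unfold Cmod; simpl.
  replace (0 * (0 * 1) + (y' + - y) * ((y' + - y) * 1)) with (Rsqr (y' + - y))
    by (unfold Rsqr; ring).
  now rewrite sqrt_Rsqr_abs. }
exact (proj2 B).
Qed.

(** Composing with the absolute value extends the function to the whole line, on
    which the intermediate value theorem asks for continuity. *)
Lemma continuous_theta_lim_abs (y : R) : continuous (fun y => theta_lim (Rabs y)) y.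
Proof.
set (T := Rabs y + 1); set (K := 5 + T ^ 2).
assert (HT := Rabs_pos y); assert (HT2 := pow2_ge_0 T).
intros P [eps HP].
assert (Heps := cond_pos eps).
assert (Hd : 0 < Rmin 1 (eps / K)).
{ apply Rmin_pos; [lra | apply Rdiv_lt_0_compat; unfold K; lra]. }
exists (mkposreal _ Hd); intros z Hz; apply HP.
change (Rabs (theta_lim (Rabs z) - theta_lim (Rabs y)) < eps).
change (Rabs (z - y) < Rmin 1 (eps / K)) in Hz.
assert (Hz1 := Rlt_le_trans _ _ _ Hz (Rmin_l _ _)).
assert (Hz2 := Rlt_le_trans _ _ _ Hz (Rmin_r _ _)).
assert (Hzy := Rabs_triang_inv2 z y).
assert (Hzt : Rabs z <= T).
{ unfold T; assert (Q := Rabs_triang_inv z y); lra. }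
eapply Rle_lt_trans.
- apply (theta_lim_lipschitz T); split; try apply Rabs_pos; unfold T in *; lra.
- fold K; apply Rle_lt_trans with (K * Rabs (z - y)).
  + apply Rmult_le_compat_l; [unfold K; lra | exact Hzy].
  + replace (pos eps) with (K * (eps / K)) by (field; unfold K; lra).
    apply Rmult_lt_compat_l; [unfold K; lra | exact Hz2].
Qed.

(** Both sides are arguments of Gamma (1/2 + i y), so their difference g takes
    its values in 2 pi Z; it is continuous and vanishes at y = 0. *)
Lemma Im_lnGamma_critical_line (L : C -> C) (y : R) : is_lnGamma L -> 0 <= y ->
  Im (L (critical_line y)) = theta_lim y.
Proof.
intros [Han Hexp Hreal] Hy.
set (g := fun u => Im (L (critical_line (Rabs u))) - theta_lim (Rabs u)).
assert (Hc : continuity g).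
{ intros u; apply continuity_pt_filterlim.
  apply (continuous_minus (fun u => Im (L (critical_line (Rabs u)))));
    [|apply continuous_theta_lim_abs].
  apply (continuous_comp Rabs (fun v => Im (L (critical_line v)))).
  - apply continuous_Rabs.
  - now apply continuous_Im_critical_line. }
assert (Hcos : forall u, cos (g u) = 1).
{ intros u; unfold g; assert (Hu := Rabs_pos u); generalize dependent (Rabs u).
  intros v Hv; destruct (Gamma_critical_line v Hv) as [r [Hr E]].
  rewrite <- (Hexp _ (slit_plane_critical_line v)) in E.
  unfold Cexp, polar in E; injection E as E1 E2.
  set (a := exp (Re (L (critical_line v)))) in *; set (b := Im (L (critical_line v))) in *.
  set (th := theta_lim v) in *.
  assert (Ha : 0 < a) by apply exp_pos.
  assert (T1 := sin2_cos2 b); assert (T2 := sin2_cos2 th); unfold Rsqr in T1, T2.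
  assert (Hsq : a * a = r * r).
  { replace (a * a) with ((a * cos b) * (a * cos b) + (a * sin b) * (a * sin b))
      by (rewrite <- (Rmult_1_r (a * a)), <- T1; ring).
    rewrite E1, E2, <- (Rmult_1_r (r * r)), <- T2; ring. }
  assert (Har : a = r) by (apply Rsqr_inj; unfold Rsqr; lra).
  rewrite cos_minus.
  rewrite <- Har in E1, E2.
  apply Rmult_eq_reg_l in E1; [|lra]; apply Rmult_eq_reg_l in E2; [|lra].
  rewrite E1, E2; lra. }
assert (Hg0 : g 0 = 0).
{ unfold g; rewrite Rabs_R0.
  change (critical_line 0) with (RtoC (1 / 2)); rewrite Hreal by lra; simpl.
  assert (E := theta_lim_correct 0 (Rle_refl 0)).
  apply (is_lim_seq_ext _ (fun _ => 0)) in E; [|intros; apply theta_approx_0].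
  apply is_lim_seq_unique in E; rewrite Lim_seq_const in E; injection E as <-; ring. }
enough (Hgy : g y = 0) by (unfold g in Hgy; rewrite Rabs_pos_eq in Hgy by exact Hy; lra).
destruct (Req_dec (g y) 0) as [|Hne]; [assumption | exfalso].
(* An intermediate value of absolute value in (0, 1] has cosine different from 1. *)
set (w := Rmax (-1) (Rmin 1 (g y))).
assert (Hw : w <> 0 /\ -1 <= w <= 1 /\ Rmin (g 0) (g y) <= w <= Rmax (g 0) (g y)).
{ rewrite Hg0; unfold w, Rmax, Rmin; repeat destruct Rle_dec; repeat split; lra. }
destruct Hw as [Hw0 [Hw1 Hw2]].
destruct (IVT_gen g 0 y w Hc Hw2) as [x [_ Hx]].
assert (C1 := Hcos x); rewrite Hx in C1.
assert (T := sin2_cos2 w); rewrite C1 in T; unfold Rsqr in T.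
assert (Hs : sin w = 0) by nra.
assert (Hpi := PI2_3_2); assert (Hpi2 : PI / 2 < PI) by (assert (Q := PI_RGT_0); lra).
destruct (Rlt_dec 0 w) as [Hp|Hp].
- assert (0 < sin w) by (apply sin_gt_0; lra); lra.
- assert (0 < sin (- w)) by (apply sin_gt_0; lra); rewrite sin_neg in *; lra.
Qed.

(** * Numerical bound for one mode *)

Lemma PI_bounds : 3.14 < PI < 3.142.
Proof.
assert (H := PI_2_3_7_ineq 2); cbn [sum_f_R0 Nat.mul Nat.add] in H.
unfold tg_alt, PI_2_3_7_tg, Ratan_seq in H; rewrite !INR_IZR_INZ in H.
simpl Z.of_nat in H; cbn [Nat.mul Nat.add pow] in H; lra.
Qed.

Lemma exp_PI_ge : 23 <= exp PI.
Proof.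
apply Rle_trans with (exp 3.14).
- eapply Rle_trans; [|apply (exp_ge_taylor 3.14 9); lra].
  cbn [sum_f_R0]; rewrite !fact_simpl, !mult_INR.
  change (INR (fact 0)) with 1; rewrite !INR_IZR_INZ; simpl Z.of_nat; simpl pow; lra.
- left; apply exp_increasing, PI_bounds.
Qed.

(** For n = 2k and x = s, the quotient of the terms of index k + j and k of the
    even factorial sum. *)
Definition fact_ratio (n j : nat) (x : R) : R :=
  INR (fact (n + 2 * j)) / (INR (fact n) * x ^ (2 * j)).

Lemma fact_ratio_0 (n : nat) (x : R) : fact_ratio n 0 x = 1.
Proof.
unfold fact_ratio; rewrite Nat.mul_0_r, Nat.add_0_r; simpl.
field; apply INR_fact_neq_0.
Qed.

Lemma fact_ratio_S (n j : nat) (x : R) : 0 < x ->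
  fact_ratio n (S j) x =
  fact_ratio n j x * ((INR n + 2 * INR j + 1) * (INR n + 2 * INR j + 2) / x ^ 2).
Proof.
intros Hx; unfold fact_ratio.
replace (n + 2 * S j)%nat with (S (S (n + 2 * j))) by lia.
replace (2 * S j)%nat with (2 * j + 2)%nat by lia.
rewrite !fact_simpl, !mult_INR, pow_add.
replace (INR (S (S (n + 2 * j)))) with (INR n + 2 * INR j + 2)
  by (rewrite !S_INR, plus_INR, mult_INR; simpl; ring).
replace (INR (S (n + 2 * j))) with (INR n + 2 * INR j + 1)
  by (rewrite !S_INR, plus_INR, mult_INR; simpl; ring).
field; repeat split; try apply INR_fact_neq_0; try apply pow_nonzero; lra.
Qed.

Lemma fact_ratio_pos (n j : nat) (x : R) : 0 < x -> 0 < fact_ratio n j x.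
Proof.
intros Hx; apply Rdiv_lt_0_compat; [apply INR_fact_lt_0|].
apply Rmult_lt_0_compat; [apply INR_fact_lt_0 | now apply pow_lt].
Qed.

Lemma fact_ratio_decr (n j : nat) (x y : R) : 0 < x <= y ->
  fact_ratio n j y <= fact_ratio n j x.
Proof.
intros H; unfold fact_ratio, Rdiv.
apply Rmult_le_compat_l; [apply pos_INR|].
assert (Hf := INR_fact_lt_0 n).
apply Rinv_le_contravar.
- apply Rmult_lt_0_compat; [exact Hf | apply pow_lt; lra].
- apply Rmult_le_compat_l; [lra | apply pow_incr; lra].
Qed.

Fixpoint fact_ratio_sum (n m : nat) (x : R) : R :=
  match m with
  | O => 0
  | S j => fact_ratio_sum n j x + fact_ratio n j x
  end.

Lemma fact_ratio_sum_decr (n m : nat) (x y : R) : 0 < x <= y ->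
  fact_ratio_sum n m y <= fact_ratio_sum n m x.
Proof.
intros H; induction m as [|m IH]; [apply Rle_refl|].
apply Rplus_le_compat; [exact IH | now apply fact_ratio_decr].
Qed.

Lemma even_factorial_sum_add (k m : nat) (s : R) : 0 < s ->
  even_factorial_sum (k + m) s = even_factorial_sum k s
    + INR (fact (2 * k)) / s ^ (2 * k + 1) * fact_ratio_sum (2 * k) m s.
Proof.
intros Hs; induction m as [|m IH].
- rewrite Nat.add_0_r; simpl; ring.
- rewrite Nat.add_succ_r; cbn [even_factorial_sum fact_ratio_sum]; rewrite IH.
  unfold fact_ratio.
  replace (2 * (k + m) + 1)%nat with (2 * k + 1 + 2 * m)%nat by lia.
  replace (2 * (k + m))%nat with (2 * k + 2 * m)%nat by lia.
  rewrite (pow_add s (2 * k + 1)).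
  field; repeat split; try apply INR_fact_neq_0; try apply pow_nonzero; lra.
Qed.

Lemma one_plus_inv_pow_bounds (n : nat) : (1 <= n)%nat ->
  2 <= (1 + / INR n) ^ n <= 3.
Proof.
intros Hn.
assert (H : 0 < INR n) by (apply lt_0_INR; lia).
assert (Hi : 0 < / INR n) by now apply Rinv_0_lt_compat.
split.
- assert (P := poly n (/ INR n) Hi).
  rewrite Rinv_r in P by lra; lra.
- apply Rle_trans with (exp (/ INR n) ^ n).
  + apply pow_incr; split; [lra | apply exp_ineq1_le].
  + replace (exp (/ INR n) ^ n) with (exp 1); [apply exp_le_3|].
    rewrite <- Rpower_pow by apply exp_pos.
    unfold Rpower; rewrite ln_exp, Rinv_r by lra; reflexivity.
Qed.

(** A computation at n = 8; then the ratio of consecutive values is at most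
    (n+1) (2n+1) / (pi n^2), by Bernoulli's inequality (1 + 1/n)^n >= 2. *)
Lemma central_term_small (n : nat) : (8 <= n)%nat ->
  INR n ^ 2 * (INR (fact (2 * n)) / (INR (fact n) * (PI * INR n) ^ n)) <= 0.21.
Proof.
assert (Hpi := PI_bounds).
intros Hn; induction Hn as [|n Hn IH].
- replace (INR (fact (2 * 8)) / (INR (fact 8) * (PI * INR 8) ^ 8))
    with (fact_ratio 8 4 (PI * INR 8)) by reflexivity.
  assert (P8 : 0 < PI * INR 8) by (apply Rmult_lt_0_compat; simpl; lra).
  rewrite !fact_ratio_S, fact_ratio_0 by exact P8.
  rewrite !INR_IZR_INZ; simpl Z.of_nat.
  assert (Hw : 9.8596 <= PI ^ 2) by nra.
  assert (Hw4 : 97.2 <= (PI ^ 2) ^ 2) by nra.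
  assert (Hw8 : 9447.8 <= ((PI ^ 2) ^ 2) ^ 2) by nra.
  apply (Rmult_le_reg_r (((PI ^ 2) ^ 2) ^ 2)); [lra|].
  match goal with |- ?A * _ <= _ =>
    replace A with (64 * (16 * 15 * 14 * 13 * 12 * 11 * 10 * 9) / 8 ^ 8
      / ((PI ^ 2) ^ 2) ^ 2) by (field; lra) end.
  unfold Rdiv at 1; rewrite Rmult_assoc, Rinv_l by lra.
  lra.
- assert (Hx : 8 <= INR n) by (apply (le_INR 8) in Hn; simpl in Hn; lra).
  assert (P := one_plus_inv_pow_bounds n ltac:(lia)).
  eapply Rle_trans; [|exact IH].
  set (r := (1 + / INR n) ^ n) in *.
  assert (Er : INR (S n) ^ n = INR n ^ n * r).
  { unfold r; rewrite <- Rpow_mult_distr; f_equal; rewrite S_INR; field; lra. }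
  replace (2 * S n)%nat with (S (S (2 * n))) by lia.
  rewrite !fact_simpl, !mult_INR, !Rpow_mult_distr.
  replace (INR (S n) ^ S n) with (INR (S n) * INR (S n) ^ n) by reflexivity.
  rewrite Er.
  replace (INR (S (S (2 * n)))) with (2 * (INR n + 1))
    by (rewrite !S_INR, mult_INR; simpl; ring).
  replace (INR (S (2 * n))) with (2 * INR n + 1)
    by (rewrite !S_INR, mult_INR; simpl; ring).
  rewrite S_INR; replace (PI ^ S n) with (PI * PI ^ n) by reflexivity.
  assert (Hf2 := INR_fact_lt_0 (2 * n)); assert (Hf := INR_fact_lt_0 n).
  assert (Hpn : 0 < PI ^ n) by (apply pow_lt; lra).
  assert (Hnn : 0 < INR n ^ n) by (apply pow_lt; lra).
  generalize dependent (INR n ^ n); generalize dependent (PI ^ n).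
  generalize dependent (INR (fact n)); generalize dependent (INR (fact (2 * n))).
  generalize dependent r; generalize dependent (INR n).
  intros x Hx r Hr A HA f Hf; intros.
  match goal with |- ?X <= ?Y => replace X with
    (Y * (2 * (x + 1) * (2 * x + 1) / (x ^ 2 * PI * r)))
    by (field; repeat split; lra) end.
  match goal with |- ?Y * ?q <= _ => assert (0 <= Y) end.
  { repeat apply Rmult_le_pos; try lra.
    left; apply Rinv_0_lt_compat; repeat apply Rmult_lt_0_compat; lra. }
  match goal with |- ?Y * ?q <= _ =>
    apply Rle_trans with (Y * 1); [apply Rmult_le_compat_l; [assumption|] | lra] end.
  assert (Hx2 : 64 <= x ^ 2) by nra.
  assert (Hxpi : x ^ 2 * 3.14 <= x ^ 2 * PI) by (apply Rmult_le_compat_l; lra).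
  assert (Hxr : x ^ 2 * PI * 2 <= x ^ 2 * PI * r) by (apply Rmult_le_compat_l; lra).
  assert (Hden : 0 < x ^ 2 * PI * r) by lra.
  apply (Rmult_le_reg_r _ _ _ Hden).
  unfold Rdiv; rewrite Rmult_assoc, Rinv_l, Rmult_1_r, Rmult_1_l by lra.
  nra.
Qed.

(** A bound for e^(-s) s^(n+1) / n! at s = pi n, with 23 for e^pi. *)
Definition stokes_exp_term (n : nat) : R :=
  (PI * INR n) ^ S n / (INR (fact n) * 23 ^ n).

Lemma stokes_exp_term_pos (n : nat) : (1 <= n)%nat -> 0 < stokes_exp_term n.
Proof.
intros Hn; assert (Hpi := PI_RGT_0); assert (Hx : 0 < INR n) by (apply lt_0_INR; lia).
apply Rdiv_lt_0_compat; [apply pow_lt; now apply Rmult_lt_0_compat|].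
apply Rmult_lt_0_compat; [apply INR_fact_lt_0 | apply pow_lt; lra].
Qed.

Lemma stokes_exp_term_S (n : nat) : (1 <= n)%nat ->
  stokes_exp_term (S n)
    <= stokes_exp_term n * ((1 + / INR n) * (3 * 3.142 / 23)).
Proof.
intros Hn; assert (Hpi := PI_bounds).
assert (Hx : 0 < INR n) by (apply lt_0_INR; lia).
assert (Hi : 0 < / INR n) by now apply Rinv_0_lt_compat.
assert (P := one_plus_inv_pow_bounds n Hn); assert (He := stokes_exp_term_pos n Hn).
set (r := (1 + / INR n) ^ n) in *.
assert (Er : INR (S n) ^ n = INR n ^ n * r).
{ unfold r; rewrite <- Rpow_mult_distr; f_equal; rewrite S_INR; field; lra. }
replace (stokes_exp_term (S n)) with
  (stokes_exp_term n * ((1 + / INR n) * (r * PI / 23))).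
- apply Rmult_le_compat_l; [lra|]; apply Rmult_le_compat_l; [lra|].
  apply Rmult_le_compat_r; [lra|]; apply Rmult_le_compat; lra.
- unfold stokes_exp_term; rewrite !fact_simpl, !mult_INR, !Rpow_mult_distr.
  replace (INR (S n) ^ S (S n)) with (INR (S n) * INR (S n) * INR (S n) ^ n)
    by (rewrite Rmult_assoc; reflexivity).
  rewrite Er.
  replace (INR n ^ S n) with (INR n * INR n ^ n) by reflexivity.
  rewrite S_INR; replace (PI ^ S (S n)) with (PI * PI ^ S n) by reflexivity.
  replace (23 ^ S n) with (23 * 23 ^ n) by reflexivity.
  assert (Hf := INR_fact_lt_0 n).
  assert (Hd : 0 < 23 ^ n) by (apply pow_lt; lra).
  field; repeat split; lra.
Qed.

Lemma stokes_exp_term_le_half (n : nat) : (1 <= n)%nat -> stokes_exp_term n <= 1 / 2.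
Proof.
assert (Hpi := PI_bounds).
intros Hn; induction Hn as [|n Hn IH].
- unfold stokes_exp_term; simpl; nra.
- assert (St := stokes_exp_term_S n Hn); assert (He := stokes_exp_term_pos n Hn).
  assert (/ INR n <= 1) by (rewrite <- Rinv_1; apply Rinv_le_contravar;
    [lra | apply (le_INR 1); lia]).
  nra.
Qed.

Lemma stokes_exp_term_small (n : nat) : (8 <= n)%nat ->
  INR n * stokes_exp_term n <= 0.0103.
Proof.
assert (Hpi := PI_bounds).
intros Hn; induction Hn as [|n Hn IH].
- unfold stokes_exp_term; rewrite !fact_simpl, !mult_INR; change (INR (fact 0)) with 1.
  rewrite !INR_IZR_INZ; simpl Z.of_nat.
  assert (H2 : PI ^ 2 <= 9.8722) by nra.
  assert (H3 : PI ^ 3 <= 31.019) by (replace (PI ^ 3) with (PI ^ 2 * PI) by ring; nra).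
  assert (H3' : 0 < PI ^ 3) by (apply pow_lt; lra).
  assert (H6 : PI ^ 3 * PI ^ 3 <= 962.18) by nra.
  assert (H9 : PI ^ 3 * PI ^ 3 * PI ^ 3 <= 29846) by nra.
  match goal with |- ?A <= _ => replace A with
    (PI ^ 3 * PI ^ 3 * PI ^ 3 * (8 * 8 ^ 9 / (40320 * 23 ^ 8))) by field end.
  lra.
- assert (Hx : 8 <= INR n) by (apply (le_INR 8) in Hn; simpl in Hn; lra).
  assert (St := stokes_exp_term_S n ltac:(lia)).
  assert (He := stokes_exp_term_pos n ltac:(lia)).
  eapply Rle_trans; [|exact IH]; rewrite S_INR.
  apply Rle_trans with ((INR n + 1)
    * (stokes_exp_term n * ((1 + / INR n) * (3 * 3.142 / 23)))).
  { apply Rmult_le_compat_l; lra. }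
  replace ((INR n + 1) * (stokes_exp_term n * ((1 + / INR n) * (3 * 3.142 / 23))))
    with (INR n * stokes_exp_term n
      * ((1 + / INR n) * (1 + / INR n) * (3 * 3.142 / 23))) by (field; lra).
  assert (/ INR n <= / 8) by (apply Rinv_le_contravar; lra).
  assert (0 < / INR n) by (apply Rinv_0_lt_compat; lra).
  assert (0 < INR n * stokes_exp_term n) by (apply Rmult_lt_0_compat; lra).
  match goal with |- ?A * _ <= _ =>
    apply Rle_trans with (A * 1); [apply Rmult_le_compat_l; [lra | nra] | lra] end.
Qed.

(** As s = 2 pi nu t, the bound (k / t)^2 / (pi^2 - 1) relative to the term
    (n-2)! / s^(n-1) of the mode, with n = 2k, becomes this constant times
    nu^2 n! / s^(n+1). *)
Definition stokes_constant (n : nat) : R :=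
  INR n * PI ^ 2 / ((INR n - 1) * (PI ^ 2 - 1)).

Lemma fact_ratio_PI_S (n j : nat) : (1 <= n)%nat ->
  fact_ratio n (S j) (PI * INR n) = fact_ratio n j (PI * INR n)
    * (/ PI ^ 2 * ((1 + (2 * INR j + 1) / INR n) * (1 + (2 * INR j + 2) / INR n))).
Proof.
intros Hn; assert (Hpi := PI_RGT_0).
assert (H : 0 < INR n) by (apply lt_0_INR; lia).
rewrite fact_ratio_S by (apply Rmult_lt_0_compat; lra).
f_equal; field; split; lra.
Qed.

Lemma inv_PI_sq_bounds : 0.10129 <= / PI ^ 2 <= 0.101425.
Proof.
assert (H := PI_bounds).
assert (H1 : 9.8596 <= PI ^ 2) by nra.
assert (H2 : PI ^ 2 <= 9.872165) by nra.
split.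
- apply Rle_trans with (/ 9.872165); [lra | apply Rinv_le_contravar; lra].
- apply Rle_trans with (/ 9.8596); [apply Rinv_le_contravar; lra | lra].
Qed.

(** With w = 1 / pi^2 the left-hand side is w^(j+1) times the product of the
    1 + i/n for i <= 2j + 2.  If the product up to 2j is at most 1 + c/n, the
    next two factors g satisfy (1 + c/n) g <= g + 4 c/n and
    g <= 1 + (6j+3)/n, so c becomes at most 4 c + 6 j + 3; the sequence
    7/4 (4^j - 1) - 2j, with value 13/4 at j = 1, grows at least that fast. *)
Lemma fact_ratio_le (n j : nat) : (8 <= n)%nat -> (2 * S j + 2 <= n)%nat ->
  fact_ratio n (S j) (PI * INR n)
    <= (/ PI ^ 2) ^ S j * (1 + (7 / 4 * (4 ^ S j - 1) - 2 * INR (S j)) / INR n).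
Proof.
intros Hn; assert (Hw := inv_PI_sq_bounds).
assert (Hx : 8 <= INR n) by (apply (le_INR 8) in Hn; simpl in Hn; lra).
assert (Hi : 0 < / INR n) by (apply Rinv_0_lt_compat; lra).
induction j as [|j IH]; intros Hj.
- rewrite fact_ratio_PI_S, fact_ratio_0 by lia; change (INR 0) with 0; change (INR 1) with 1.
  rewrite Rmult_1_l, !pow_1; apply Rmult_le_compat_l; [lra|].
  assert (H8 : / INR n <= / 8) by (apply Rinv_le_contravar; lra). 
  unfold Rdiv; nra.
- specialize (IH ltac:(lia)).
  rewrite fact_ratio_PI_S by lia.
  assert (Hy : 1 <= INR (S j)) by (apply (le_INR 1); lia).
  assert (Hyn : 2 * INR (S j) + 4 <= INR n).
  { apply le_INR in Hj; rewrite plus_INR, mult_INR, (S_INR (S j)) in Hj.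
    simpl (INR 2) in Hj; lra. }
  rewrite (S_INR (S j)).
  replace ((/ PI ^ 2) ^ S (S j)) with ((/ PI ^ 2) ^ S j * / PI ^ 2) by (simpl; ring).
  replace (4 ^ S (S j)) with (4 * 4 ^ S j) by reflexivity.
  assert (Hwj : 0 < (/ PI ^ 2) ^ S j) by (apply pow_lt; lra).
  set (y := INR (S j)) in *; set (x := INR n) in *.
  assert (H4 : 1 + 3 * y <= 4 ^ S j).
  { replace 4 with (1 + 3) by ring.
    assert (P := poly (S j) 3 ltac:(lra)); fold y in P; lra. }
  set (q := 4 ^ S j) in *.
  set (wj := (/ PI ^ 2) ^ S j) in *; set (w := / PI ^ 2) in *.
  set (c := 7 / 4 * (q - 1) - 2 * y) in *.
  set (F := fact_ratio n (S j) (PI * x)) in *.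
  assert (Hc : 0 <= c) by (unfold c; lra).
  set (g := (1 + (2 * y + 1) / x) * (1 + (2 * y + 2) / x)).
  assert (Ha : 0 <= (2 * y + 1) / x <= 1).
  { split; [apply Rmult_le_pos; lra|].
    apply (Rmult_le_reg_r x); [lra|]; unfold Rdiv; rewrite Rmult_assoc, Rinv_l; lra. }
  assert (Hb : 0 <= (2 * y + 2) / x <= 1).
  { split; [apply Rmult_le_pos; lra|].
    apply (Rmult_le_reg_r x); [lra|]; unfold Rdiv; rewrite Rmult_assoc, Rinv_l; lra. }
  assert (Hg4 : 0 <= g <= 4).
  { unfold g; split; [apply Rmult_le_pos; lra | nra]. }
  assert (Hg : g <= 1 + (6 * y + 3) / x).
  { replace g with (1 + (4 * y + 3) / x + (2 * y + 1) * (2 * y + 2) / x / x)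
      by (unfold g; field; lra).
    replace (1 + (6 * y + 3) / x) with (1 + (4 * y + 3) / x + 2 * y / x) by (field; lra).
    apply Rplus_le_compat_l, Rmult_le_compat_r; [lra|].
    apply (Rmult_le_reg_r x); [lra|]; unfold Rdiv; rewrite Rmult_assoc, Rinv_l by lra; nra. }
  apply Rle_trans with (wj * (1 + c / x) * (w * g)).
  { apply Rmult_le_compat_r; [apply Rmult_le_pos; lra | exact IH]. }
  replace (wj * (1 + c / x) * (w * g)) with (wj * w * ((1 + c / x) * g)) by ring.
  apply Rmult_le_compat_l; [apply Rmult_le_pos; lra|].
  assert (Hcx : 0 <= c / x) by (apply Rmult_le_pos; lra).
  assert (c / x * g <= c / x * 4) by (apply Rmult_le_compat_l; lra).
  apply Rle_trans with (1 + (6 * y + 3) / x + c / x * 4); [lra|].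
  replace (1 + (6 * y + 3) / x + c / x * 4) with (1 + (4 * c + 6 * y + 3) / x) by (field; lra).
  apply Rplus_le_compat_l, Rmult_le_compat_r; [lra|].
  unfold c; lra.
Qed.

(** Geometric sums of w^j and of (4 w)^j.  Of the negative corrections in
    [fact_ratio_le] only the one for j = 1, equal to - 15/4, is kept. *)
Lemma fact_ratio_sum_le (n m : nat) : (8 <= n)%nat -> (2 * S (S m) <= n)%nat ->
  fact_ratio_sum n (S (S m)) (PI * INR n)
    <= (1 - (/ PI ^ 2) ^ S (S m)) / (1 - / PI ^ 2)
     + (7 / 4 * (4 * / PI ^ 2 - (4 * / PI ^ 2) ^ S (S m)) / (1 - 4 * / PI ^ 2)
        - 15 / 4 * / PI ^ 2) / INR n.
Proof.
intros Hn; assert (Hw := inv_PI_sq_bounds).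
assert (Hx : 8 <= INR n) by (apply (le_INR 8) in Hn; simpl in Hn; lra).
assert (Hi : 0 < / INR n) by (apply Rinv_0_lt_compat; lra).
induction m as [|m IH]; intros Hm.
- cbn [fact_ratio_sum]; rewrite fact_ratio_0.
  assert (B := fact_ratio_le n 0 Hn ltac:(lia)).
  rewrite !pow_1 in B; change (INR 1) with 1 in B.
  set (w := / PI ^ 2) in *.
  eapply Rle_trans; [apply Rplus_le_compat_l, B|].
  right; field; lra.
- specialize (IH ltac:(lia)).
  assert (B := fact_ratio_le n (S m) Hn ltac:(lia)).
  change (fact_ratio_sum n (S (S (S m))) (PI * INR n)) with
    (fact_ratio_sum n (S (S m)) (PI * INR n) + fact_ratio n (S (S m)) (PI * INR n)).
  eapply Rle_trans; [apply Rplus_le_compat; [exact IH | exact B]|].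
  assert (Hy := pos_INR (S (S m))).
  rewrite !Rpow_mult_distr.
  replace ((/ PI ^ 2) ^ S (S (S m))) with (/ PI ^ 2 * (/ PI ^ 2) ^ S (S m)) by reflexivity.
  replace (4 ^ S (S (S m))) with (4 * 4 ^ S (S m)) by reflexivity.
  assert (Hwj : 0 < (/ PI ^ 2) ^ S (S m)) by (apply pow_lt; lra).
  clear IH B; generalize dependent (INR (S (S m))); intros y Hy.
  generalize dependent ((/ PI ^ 2) ^ S (S m)); intros wj Hwj.
  generalize dependent (/ PI ^ 2); intros w Hw.
  generalize (4 ^ S (S m)); intros q.
  set (x := INR n) in *.
  replace ((1 - w * wj) / (1 - w)) with ((1 - wj) / (1 - w) + wj) by (field; lra).
  replace ((7 / 4 * (4 * w - 4 * q * (w * wj)) / (1 - 4 * w) - 15 / 4 * w) / x)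
    with ((7 / 4 * (4 * w - q * wj) / (1 - 4 * w) - 15 / 4 * w) / x + wj * (7 / 4 * q) / x)
    by (field; lra).
  assert (wj * (1 + (7 / 4 * (q - 1) - 2 * y) / x) <= wj + wj * (7 / 4 * q) / x); [|lra].
  replace (wj + wj * (7 / 4 * q) / x) with (wj * (1 + 7 / 4 * q / x)) by (field; lra).
  apply Rmult_le_compat_l; [lra|].
  apply Rplus_le_compat_l, Rmult_le_compat_r; lra.
Qed.

(** With n = 2k, a bound for the remainder of the mode at s = pi n, in units of
    n! / s^(n+1): the terms of index k to 2k - 1, what is left after them, and
    the exponentially small part. *)
Definition stokes_total (k : nat) : R :=
  fact_ratio_sum (2 * k) k (PI * INR (2 * k))
  + 5 / 8 * INR (2 * k) * fact_ratio (2 * k) k (PI * INR (2 * k))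
  + 3 / 2 * stokes_exp_term (2 * k).

(** Both sides tend to 1 / (1 - w) with w = 1 / pi^2, so what matters is the
    corrections of order 1/n: on the left they are at most
    (0.82 + 0.1313 + 0.0155) / n, which is less than 1/(n-1). *)
Lemma stokes_total_le_large (k : nat) : (4 <= k)%nat ->
  stokes_total k <= stokes_constant (2 * k).
Proof.
intros Hk; unfold stokes_total, stokes_constant.
assert (Hw := inv_PI_sq_bounds); assert (Hpi := PI_bounds).
assert (Hn : (8 <= 2 * k)%nat) by lia.
assert (A := fact_ratio_sum_le (2 * k) (k - 2) Hn ltac:(lia)).
replace (S (S (k - 2))) with k in A by lia.
assert (B := central_term_small (2 * k) Hn).
assert (D := stokes_exp_term_small (2 * k) Hn).
replace (INR (fact (2 * (2 * k))) / (INR (fact (2 * k)) * (PI * INR (2 * k)) ^ (2 * k)))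
  with (fact_ratio (2 * k) k (PI * INR (2 * k))) in B
  by (unfold fact_ratio; do 3 f_equal; lia).
assert (Hx : 8 <= INR (2 * k)) by (apply (le_INR 8) in Hn; simpl in Hn |- *; lra).
set (x := INR (2 * k)) in *.
set (S0 := fact_ratio_sum (2 * k) k (PI * x)) in *.
set (F := fact_ratio (2 * k) k (PI * x)) in *.
set (E := stokes_exp_term (2 * k)) in *.
assert (HP2 : 0 < PI ^ 2) by (apply pow_lt; lra).
replace (x * PI ^ 2 / ((x - 1) * (PI ^ 2 - 1))) with
  (/ (1 - / PI ^ 2) * (1 + / (x - 1))).
2: { assert (9 < PI ^ 2) by nra; field; repeat split; lra. }
assert (Hwk : 0 < (/ PI ^ 2) ^ k) by (apply pow_lt; lra).
assert (H4k : 0 < (4 * / PI ^ 2) ^ k) by (apply pow_lt; lra).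
set (w := / PI ^ 2) in *.
assert (Hxi : 0 < / x) by (apply Rinv_0_lt_compat; lra).
assert (A1 : (1 - w ^ k) / (1 - w) <= / (1 - w)).
{ unfold Rdiv; rewrite <- (Rmult_1_l (/ (1 - w))) at 2.
  apply Rmult_le_compat_r; [left; apply Rinv_0_lt_compat|]; lra. }
assert (A2 : 7 / 4 * (4 * w - (4 * w) ^ k) / (1 - 4 * w) - 15 / 4 * w <= 0.82).
{ apply Rle_trans with (7 / 4 * 0.4057 / (1 - 0.4057) - 15 / 4 * 0.10129); [|lra].
  apply Rplus_le_compat; [|lra].
  unfold Rdiv; apply Rmult_le_compat; try lra.
  - apply Rmult_le_pos; [lra|].
    assert ((4 * w) ^ k <= (4 * w) ^ 1); [|simpl in *; lra].
    replace k with (1 + (k - 1))%nat by lia; rewrite pow_add.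
    rewrite <- (Rmult_1_r ((4 * w) ^ 1)) at 2; apply Rmult_le_compat_l; [simpl; lra|].
    rewrite <- (pow1 (k - 1)); apply pow_incr; lra.
  - left; apply Rinv_0_lt_compat; lra.
  - apply Rinv_le_contravar; lra. }
assert (B1 : 5 / 8 * x * F <= 0.1313 * / x).
{ apply (Rmult_le_reg_l x); [lra|].
  replace (x * (0.1313 * / x)) with 0.1313 by (field; lra).
  simpl pow in B; lra. }
assert (D1 : 3 / 2 * E <= 0.0155 * / x).
{ apply (Rmult_le_reg_l x); [lra|].
  replace (x * (0.0155 * / x)) with 0.0155 by (field; lra); lra. }
assert (A3 : (7 / 4 * (4 * w - (4 * w) ^ k) / (1 - 4 * w) - 15 / 4 * w) / x <= 0.82 * / x)
  by (apply Rmult_le_compat_r; lra).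
assert (G : 1 <= / (1 - w)).
{ rewrite <- Rinv_1; apply Rinv_le_contravar; lra. }
assert (Hx1 : / x <= / (x - 1)) by (apply Rinv_le_contravar; lra).
assert (/ (x - 1) <= / (1 - w) * / (x - 1)).
{ rewrite <- (Rmult_1_l (/ (x - 1))) at 1; apply Rmult_le_compat_r; lra. }
lra.
Qed.

(** For k <= 3 the sum has at most three terms, which are evaluated with numerical
    bounds on pi. *)
Lemma stokes_total_le (k : nat) : (1 <= k)%nat ->
  stokes_total k <= stokes_constant (2 * k).
Proof.
intros Hk.
destruct (le_lt_dec 4 k) as [H4|H4]; [now apply stokes_total_le_large|].
assert (Hw := inv_PI_sq_bounds); assert (Hpi := PI_bounds).
assert (HP2 : 9.8596 <= PI ^ 2) by nra.
assert (HP3 : PI ^ 3 <= 31.019) by (replace (PI ^ 3) with (PI * PI * PI) by ring; nra).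
assert (HP3' : 0 < PI ^ 3) by (apply pow_lt; lra).
assert (HP5 : PI ^ 3 * PI ^ 2 <= 306.23).
{ assert (PI ^ 2 <= 9.872165) by nra; nra. }
assert (HP7 : PI ^ 3 * PI ^ 3 * PI <= 3023.2).
{ assert (PI ^ 3 * PI ^ 3 <= 962.18) by nra.
  assert (0 <= PI ^ 3 * PI ^ 3) by (apply Rmult_le_pos; lra). nra. }
assert (EG : forall n, (2 <= n)%nat -> stokes_constant n
  = INR n / (INR n - 1) * / (1 - / PI ^ 2)).
{ intros n Hn; apply (le_INR 2) in Hn; simpl in Hn.
  unfold stokes_constant; field; repeat split; lra. }
assert (G : 1.1127 <= / (1 - / PI ^ 2)).
{ apply Rle_trans with (/ (1 - 0.10129)); [lra | apply Rinv_le_contravar; lra]. }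
rewrite EG by lia; unfold stokes_total.
assert (X : stokes_exp_term 2 = PI ^ 3 * (8 / (2 * 23 ^ 2))).
{ unfold stokes_exp_term; rewrite !fact_simpl, !mult_INR; change (INR (fact 0)) with 1.
  rewrite !INR_IZR_INZ; simpl Z.of_nat; field. }
assert (X4 : stokes_exp_term 4 = PI ^ 3 * PI ^ 2 * (4 ^ 5 / (24 * 23 ^ 4))).
{ unfold stokes_exp_term; rewrite !fact_simpl, !mult_INR; change (INR (fact 0)) with 1.
  rewrite !INR_IZR_INZ; simpl Z.of_nat; field. }
assert (X6 : stokes_exp_term 6 = PI ^ 3 * PI ^ 3 * PI * (6 ^ 7 / (720 * 23 ^ 6))).
{ unfold stokes_exp_term; rewrite !fact_simpl, !mult_INR; change (INR (fact 0)) with 1.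
  rewrite !INR_IZR_INZ; simpl Z.of_nat; field. }
set (G0 := / (1 - / PI ^ 2)) in *; clearbody G0.
destruct k as [|[|[|[|k]]]]; try lia.
- cbn [Nat.mul Nat.add fact_ratio_sum].
  rewrite !fact_ratio_PI_S, !fact_ratio_0, X by lia.
  rewrite !INR_IZR_INZ; simpl Z.of_nat.
  set (w := / PI ^ 2) in *; lra.
- cbn [Nat.mul Nat.add fact_ratio_sum].
  rewrite !fact_ratio_PI_S, !fact_ratio_0, X4 by lia.
  rewrite !INR_IZR_INZ; simpl Z.of_nat.
  set (w := / PI ^ 2) in *.
  assert (w * w <= 0.0102871) by nra; lra.
- cbn [Nat.mul Nat.add fact_ratio_sum].
  rewrite !fact_ratio_PI_S, !fact_ratio_0, X6 by lia.
  rewrite !INR_IZR_INZ; simpl Z.of_nat.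
  set (w := / PI ^ 2) in *.
  assert (W2 : w * w <= 0.0102871) by nra.
  assert (W3 : w * w * w <= 0.00104337) by nra; lra.
Qed.

Lemma fact_ratio_sum_ge_1 (n m : nat) (x : R) : 0 < x ->
  1 <= fact_ratio_sum n (S m) x.
Proof.
intros Hx; induction m as [|m IH].
- simpl; rewrite fact_ratio_0; lra.
- assert (P := fact_ratio_pos n (S m) x Hx).
  change (fact_ratio_sum n (S (S m)) x)
    with (fact_ratio_sum n (S m) x + fact_ratio n (S m) x); lra.
Qed.

(** In units of n! / s^(n+1) the parts of the estimate decrease in s, so that
    s = pi n is the worst case, except for (s - 2n) s^(- n), which is bounded
    through s - 2n <= 5/4 n (s / (pi n))^2. *)
Lemma stokes_mode_bound (k : nat) (M s : R) : (1 <= k)%nat ->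
  0 < M -> sin M = 0 -> cos M = 1 -> PI * INR (2 * k) <= s ->
  Rabs (stokes_mode M s - even_factorial_sum k s)
    <= stokes_constant (2 * k) * (INR (fact (2 * k)) / s ^ (2 * k + 1)) + / (2 * M).
Proof.
intros Hk HM HsM HcM Hs.
replace (2 * k + 1)%nat with (S (2 * k)) by lia.
assert (Hpi := PI_bounds).
assert (Tot := stokes_total_le k Hk); unfold stokes_total in Tot.
assert (Hx : 2 <= INR (2 * k)) by (apply (le_INR 2); lia).
assert (EN : INR (2 * (2 * k)) = 2 * INR (2 * k)) by (rewrite (mult_INR 2); simpl; ring).
set (n := (2 * k)%nat) in *; set (x := INR n) in *.
set (s0 := PI * x) in *.
assert (Hs0 : 3.14 * x <= s0) by (apply Rmult_le_compat_r; lra).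
assert (Hf := INR_fact_lt_0 n).
set (Q := INR (fact n) / s ^ S n).
assert (Hsn : 0 < s ^ S n) by (apply pow_lt; lra).
assert (HQ : 0 < Q) by (apply Rdiv_lt_0_compat; lra).
assert (Hexp : exp (1 - s) / 2 <= Q * (3 / 2 * stokes_exp_term n)).
{ assert (Mono : exp_over_pow (S n) s0 <= exp_over_pow (S n) s).
  { apply exp_over_pow_incr; [lra | rewrite S_INR; fold x; lra | exact Hs]. }
  unfold exp_over_pow in Mono.
  assert (Hs0n : 0 < s0 ^ S n) by (apply pow_lt; lra).
  assert (H23 : 23 ^ n <= exp s0).
  { replace (exp s0) with (exp PI ^ n).
    - apply pow_incr; split; [lra | apply exp_PI_ge].
    - rewrite <- Rpower_pow by apply exp_pos.
      unfold Rpower; rewrite ln_exp; f_equal; unfold s0; fold x; ring. }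
  assert (H23p : 0 < 23 ^ n) by (apply pow_lt; lra).
  assert (E1 : exp (1 - s) = exp 1 / exp s)
    by (unfold Rminus; rewrite exp_plus, exp_Ropp; reflexivity).
  assert (He := exp_pos s).
  assert (L1 : 23 ^ n / s0 ^ S n <= exp s / s ^ S n).
  { eapply Rle_trans; [|exact Mono].
    apply Rmult_le_compat_r; [left; now apply Rinv_0_lt_compat | exact H23]. }
  assert (L2 : / exp s <= s0 ^ S n / (23 ^ n * s ^ S n)).
  { apply (Rmult_le_reg_l (exp s)); [exact He|]; rewrite Rinv_r by lra.
    apply (Rmult_le_reg_r (23 ^ n / s0 ^ S n)); [now apply Rdiv_lt_0_compat|].
    replace (exp s * (s0 ^ S n / (23 ^ n * s ^ S n)) * (23 ^ n / s0 ^ S n))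
      with (exp s / s ^ S n) by (field; repeat split; lra).
    lra. }
  rewrite E1; unfold stokes_exp_term; fold x; fold s0; unfold Q.
  replace (INR (fact n) / s ^ S n * (3 / 2 * (s0 ^ S n / (INR (fact n) * 23 ^ n))))
    with (3 * (s0 ^ S n / (23 ^ n * s ^ S n)) / 2) by (field; repeat split; lra).
  unfold Rdiv; apply Rmult_le_compat_r; [lra|].
  apply Rmult_le_compat; [left; apply exp_pos | left; now apply Rinv_0_lt_compat
    | apply exp_le_3 | exact L2]. }
assert (Hr := fact_ratio_pos n k s0 ltac:(lra)).
assert (Hsum1 : 1 <= fact_ratio_sum n k s0).
{ replace k with (S (pred k)) by lia; apply fact_ratio_sum_ge_1; lra. }
assert (Hexp0 := stokes_exp_term_pos n ltac:(unfold n; lia)).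
apply Rabs_le; split.
- assert (L := stokes_mode_lower M HM HsM HcM k s Hk).
  fold n in L; specialize (L ltac:(fold x; lra)).
  assert (Hcrude : 2 * (3 / 2 * stokes_exp_term n) <= stokes_constant n).
  { assert (He := stokes_exp_term_le_half n ltac:(unfold n; lia)).
    assert (0 <= 5 / 8 * x * fact_ratio n k s0) by (apply Rmult_le_pos; lra).
    lra. }
  assert (2 * (Q * (3 / 2 * stokes_exp_term n)) <= stokes_constant n * Q) by nra.
  lra.
(* Truncating at index 2k instead of k gives the factor s - 4k, of order k, a
   coefficient that decays geometrically in k. *)
- assert (Up := stokes_mode_upper M HM HsM HcM n s).
  rewrite EN in Up; rewrite S_INR, EN in Up; specialize (Up ltac:(lra)).
  assert (Esum := even_factorial_sum_add k k s ltac:(lra)).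
  replace (k + k)%nat with n in Esum by (unfold n; lia).
  replace (2 * k + 1)%nat with (S n) in Esum by (unfold n; lia).
  fold n in Esum; fold Q in Esum.
  assert (Hfs : fact_ratio_sum n k s <= fact_ratio_sum n k s0)
    by (apply fact_ratio_sum_decr; lra).
  assert (Hlast : INR (fact (2 * n)) * (s - 2 * x) / (2 * s ^ S (2 * n))
    <= Q * (5 / 8 * x * fact_ratio n k s0)).
  { set (tau := s / s0).
    assert (Htau : 1 <= tau).
    { unfold tau; apply (Rmult_le_reg_r s0); [lra|].
      unfold Rdiv; rewrite Rmult_assoc, Rinv_l; lra. }
    assert (Es : s = s0 * tau) by (unfold tau; field; lra).
    (* The discriminant of 5/4 tau^2 - pi tau + 2 is pi^2 - 10 < 0. *)
    assert (Hquad : s - 2 * x <= 5 / 4 * x * tau ^ 2).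
    { rewrite Es; unfold s0.
      assert (PI * tau - 2 <= 5 / 4 * tau ^ 2).
      { assert (PI * tau <= 3.142 * tau) by (apply Rmult_le_compat_r; lra).
        assert (Sq := pow2_ge_0 (tau - 1.2568)); nra. }
      assert (x * (PI * tau - 2) <= x * (5 / 4 * tau ^ 2)) by (apply Rmult_le_compat_l; lra).
      lra. }
    assert (Htn : tau ^ 2 <= tau ^ n) by (apply Rle_pow; [lra | unfold n; lia]).
    assert (Htp : 0 < tau ^ n) by (apply pow_lt; lra).
    assert (Hs0n : 0 < s0 ^ n) by (apply pow_lt; lra).
    assert (Hf2 := INR_fact_lt_0 (2 * n)).
    unfold Q, fact_ratio; replace (n + 2 * k)%nat with (2 * n)%nat by (unfold n; lia).
    fold n; replace (S (2 * n)) with (S n + n)%nat by lia.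
    rewrite (pow_add s (S n) n).
    assert (Esn : s ^ n = s0 ^ n * tau ^ n) by (rewrite Es at 1; apply Rpow_mult_distr).
    rewrite Esn.
    replace (INR (fact (2 * n)) * (s - 2 * x) / (2 * (s ^ S n * (s0 ^ n * tau ^ n))))
      with (INR (fact (2 * n)) / (s ^ S n * s0 ^ n) / 2 * ((s - 2 * x) / tau ^ n))
      by (field; repeat split; lra).
    replace (INR (fact n) / s ^ S n
      * (5 / 8 * x * (INR (fact (2 * n)) / (INR (fact n) * s0 ^ n))))
      with (INR (fact (2 * n)) / (s ^ S n * s0 ^ n) / 2 * (5 / 4 * x))
      by (field; repeat split; lra).
    apply Rmult_le_compat_l.
    - apply Rmult_le_pos; [|lra]; left; apply Rdiv_lt_0_compat; [exact Hf2|].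
      now apply Rmult_lt_0_compat.
    - apply (Rmult_le_reg_r (tau ^ n)); [exact Htp|].
      unfold Rdiv; rewrite Rmult_assoc, Rinv_l, Rmult_1_r by lra.
      eapply Rle_trans; [exact Hquad|].
      apply Rmult_le_compat_l; lra. }
  assert (HQs : Q * fact_ratio_sum n k s <= Q * fact_ratio_sum n k s0)
    by (apply Rmult_le_compat_l; lra).
  assert (Q * (fact_ratio_sum n k s0 + 5 / 8 * x * fact_ratio n k s0
    + 3 / 2 * stokes_exp_term n) <= Q * stokes_constant n)
    by (apply Rmult_le_compat_l; lra).
  lra.
Qed.

(** * The remainder as a sum of modes *)

Definition freq (i : nat) : R := 2 * PI * INR (S i).

Lemma freq_pos (i : nat) : 0 < freq i.
Proof.
assert (H := PI_RGT_0); assert (0 < INR (S i)) by (apply lt_0_INR; lia).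
unfold freq; apply Rmult_lt_0_compat; lra.
Qed.

Lemma Cpow_imaginary (t : R) (m : nat) :
  Cpow (Cmult Ci (RtoC t)) (2 * m + 1) = (0, (-1) ^ m * t ^ (2 * m + 1)).
Proof.
induction m as [|m IH].
- simpl; unfold Ci, RtoC, Cmult; simpl; f_equal; ring.
- replace (2 * S m + 1)%nat with (S (S (2 * m + 1))) by lia.
  cbn [Cpow]; rewrite IH; unfold Ci, RtoC, Cmult; simpl; f_equal; ring.
Qed.

Lemma Im_That_imaginary (m : nat) (t : R) : 0 < t ->
  Im (That (S m) (Cmult Ci (RtoC t)))
  = (-1) ^ S m * bernoulli_poly (2 * S m) (1 / 2)
    / ((2 * INR m + 2) * (2 * INR m + 1) * t ^ (2 * m + 1)).
Proof.
intros Ht; unfold That.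
replace (2 * S m - 1)%nat with (2 * m + 1)%nat by lia.
rewrite Cpow_imaginary.
generalize (bernoulli_poly (2 * S m) (1 / 2)); intros b.
assert (Hm := pos_INR m).
assert (Hp : 0 < t ^ (2 * m + 1)) by now apply pow_lt.
assert (Hs : (-1) ^ m * (-1) ^ m = 1)
  by (rewrite <- Rpow_mult_distr; replace (-1 * -1) with 1 by ring; apply pow1).
set (e := (-1) ^ m) in *.
assert (He : e <> 0) by (intros Z; rewrite Z in Hs; lra).
replace ((-1) ^ S m) with (- e) by (simpl; fold e; ring).
rewrite S_INR; generalize dependent (t ^ (2 * m + 1)); intros p Hp.
generalize dependent (INR m); intros x Hx.
assert (Hden : (2 * (x + 1) * (2 * (x + 1) - 1)) * (e * p) <> 0).
{ repeat apply Rmult_integral_contrapositive_currified; lra. }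
replace (Cmult (RtoC (2 * (x + 1) * (2 * (x + 1) - 1))) (0, e * p))
  with ((0, (2 * (x + 1) * (2 * (x + 1) - 1)) * (e * p)) : C)
  by (unfold Cmult, RtoC; simpl; f_equal; ring).
unfold Cdiv, Cinv, Cmult, RtoC; simpl.
transitivity (- b * (e * e) / ((2 * x + 2) * (2 * x + 1) * (e * p))); [|].
- rewrite Hs; field; repeat split; lra.
- field; repeat split; lra.
Qed.

(** The sign of B_(2m+2) (1/2) cancels the one of i^(2m+1), so on the imaginary
    axis the mode of lowest frequency contributes positively for every m. *)
Lemma Im_That_series (m : nat) (t : R) : 0 < t ->
  is_lim_seq (fun V => sum_f_R0
    (fun i => (-1) ^ i * (2 / freq i) * (INR (fact (2 * m)) / (freq i * t) ^ (2 * m + 1))) V)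
    (Im (That (S m) (Cmult Ci (RtoC t)))).
Proof.
intros Ht; rewrite Im_That_imaginary by exact Ht.
assert (Hm := pos_INR m).
assert (Hp : 0 < t ^ (2 * m + 1)) by now apply pow_lt.
set (den := (2 * INR m + 2) * (2 * INR m + 1) * t ^ (2 * m + 1)).
assert (Hden : 0 < den) by (unfold den; repeat apply Rmult_lt_0_compat; lra).
assert (L := is_lim_seq_scal_l _ ((-1) ^ S m / den) _ (bernoulli_half_series m)).
replace (Rbar_mult ((-1) ^ S m / den) (bernoulli_poly (2 * S m) (1 / 2))) with
  (Finite ((-1) ^ S m * bernoulli_poly (2 * S m) (1 / 2) / den)) in L
  by (simpl; f_equal; field; lra).
eapply is_lim_seq_ext; [|exact L].
intros V; cbv beta; rewrite scal_sum; apply sum_eq; intros i _.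
fold (freq i); assert (Hf := freq_pos i).
replace (2 * S m)%nat with (S (S (2 * m))) by lia.
rewrite !fact_simpl, !mult_INR.
replace (INR (S (S (2 * m)))) with (2 * INR m + 2) by (rewrite !S_INR, mult_INR; simpl; ring).
replace (INR (S (2 * m))) with (2 * INR m + 1) by (rewrite !S_INR, mult_INR; simpl; ring).
unfold den; clear L Hden den.
replace (2 * m + 1)%nat with (S (2 * m)) in * by lia.
rewrite Rpow_mult_distr.
assert (Hs : (-1) ^ m * (-1) ^ m = 1)
  by (rewrite <- Rpow_mult_distr; replace (-1 * -1) with 1 by ring; apply pow1).
replace ((-1) ^ S m) with (- (-1) ^ m) by (simpl; ring).
replace ((-1) ^ S i) with (- (-1) ^ i) by (simpl; ring).
assert (Hfp : 0 < freq i ^ S (2 * m)) by now apply pow_lt.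
replace (freq i ^ S (S (2 * m))) with (freq i * freq i ^ S (2 * m)) by reflexivity.
generalize dependent (freq i ^ S (2 * m)); intros q Hq.
generalize dependent (t ^ S (2 * m)); intros p Hp.
generalize dependent ((-1) ^ m); intros e He.
transitivity ((-1) ^ i * (2 / freq i) * (INR (fact (2 * m)) / (q * p)) * (e * e)).
- field; repeat split; lra.
- rewrite He; ring.
Qed.

Lemma Im_That_sum_series (k : nat) (t : R) : 0 < t ->
  is_lim_seq (fun V => sum_f_R0
    (fun i => (-1) ^ i * (2 / freq i) * even_factorial_sum k (freq i * t)) V)
    (Im (@sum_n_m C_AbelianMonoid (fun j => That j (Cmult Ci (RtoC t))) 1 k)).
Proof.
intros Ht; induction k as [|k IH].
- rewrite sum_n_m_zero by lia.
  apply (is_lim_seq_ext (fun _ => 0)); [|apply is_lim_seq_const].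
  intros V; symmetry; apply sum_f_R0_eq0; intros i _; simpl; ring.
- rewrite sum_n_Sm by lia.
  change (Im (plus ?a ?b)) with (Im a + Im b).
  eapply is_lim_seq_ext; [|apply (is_lim_seq_plus' _ _ _ _ IH (Im_That_series k t Ht))].
  intros V; cbv beta; rewrite <- sum_plus; apply sum_eq; intros i _.
  cbn [even_factorial_sum]; ring.
Qed.

(** The integral of pi/2 - arctan (x/t), that is of arctan (t/x), over [0, X]. *)
Definition arctan_area (t X : R) : R :=
  X * (PI / 2 - atan (X / t)) + t / 2 * ln (X ^ 2 + t ^ 2) - t * ln t.

Lemma RInt_arctan (t X : R) : 0 < t -> 0 < X ->
  is_RInt (fun x => PI / 2 - atan (x / t)) 0 X (arctan_area t X).
Proof.
intros Ht HX.
apply (is_RInt_primitive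
  (fun x => x * (PI / 2 - atan (x / t)) + t / 2 * ln (x ^ 2 + t ^ 2))); [lra | | |].
- intros x _; assert (H := sum_sq_pos t x Ht); auto_derive; [simpl in H; lra|].
  unfold Rdiv; field; simpl in H |- *; repeat split; lra.
- intros x _; apply (@ex_derive_continuous R_AbsRing R_NormedModule); auto_derive; lra.
- unfold arctan_area; replace (0 ^ 2 + t ^ 2) with (t * t) by ring.
  rewrite ln_mult by lra; field.
Qed.

Lemma arctan_sum_series (t : R) (n : nat) : 0 < t ->
  is_lim_seq (fun V => sum_f_R0 (fun i => (-1) ^ i * (2 / freq i)
      * stokes_mode (freq i * INR (S n)) (freq i * t)) V)
    (arctan_area t (INR (S n)) - rising_arg t (S n)).
Proof.
intros Ht.
assert (HX : 0 < INR (S n)) by (apply lt_0_INR; lia).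
assert (M := midpoint_sum_fourier (fun x => PI / 2 - atan (x / t))
  (fun x => - (t / (x ^ 2 + t ^ 2))) (fun x => 2 * t * x / (x ^ 2 + t ^ 2) ^ 2) n
  (arctan_area t (INR (S n)))
  (fun i => stokes_mode (freq i * INR (S n)) (freq i * t) / freq i)).
assert (L : is_lim_seq (fun V => sum_f_R0 (fun i => 2 * (-1) ^ S i
   * (stokes_mode (freq i * INR (S n)) (freq i * t) / freq i)) V)
   (rising_arg t (S n) - arctan_area t (INR (S n)))).
{ rewrite rising_arg_sum.
  rewrite (sum_eq _ (fun j => PI / 2 - atan ((INR j + 1 / 2) / t))).
  - apply M.
    + intros x; assert (H := sum_sq_pos t x Ht); auto_derive; [lra|].
      unfold Rdiv; field; simpl in H |- *; repeat split; lra.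
    + intros x; assert (H := sum_sq_pos t x Ht); auto_derive; [simpl in H; lra|].
      field; simpl in H |- *; lra.
    + intros x; assert (H := sum_sq_pos t x Ht).
      apply (@ex_derive_continuous R_AbsRing R_NormedModule); auto_derive.
      simpl in H; apply Rmult_integral_contrapositive_currified; lra.
    + now apply RInt_arctan.
    + intros i; apply RInt_arctan_cos; [exact Ht | apply freq_pos | exact HX |].
      unfold freq; rewrite Rmult_assoc, <- mult_INR; apply sin_2PI_INR.
  - intros j _; assert (Hj := pos_INR j).
    rewrite <- atan_inv by (apply Rdiv_lt_0_compat; lra).
    f_equal; field; lra. }
apply is_lim_seq_opp in L.
replace (Rbar_opp (rising_arg t (S n) - arctan_area t (INR (S n))))
  with (Finite (arctan_area t (INR (S n)) - rising_arg t (S n))) in L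
  by (simpl; f_equal; ring).
eapply is_lim_seq_ext; [|exact L].
intros V; cbv beta.
replace (- sum_f_R0 _ V) with (-1 * sum_f_R0 (fun i => 2 * (-1) ^ S i
   * (stokes_mode (freq i * INR (S n)) (freq i * t) / freq i)) V) by ring.
rewrite scal_sum; apply sum_eq; intros i _.
assert (Hf := freq_pos i); simpl pow; field; lra.
Qed.

Lemma atan_bounds (x : R) : 0 <= x -> x - x ^ 3 <= atan x <= x.
Proof.
intros Hx.
assert (D : forall u, is_derive atan u (/ (1 + u ^ 2))).
{ intros u; replace (u ^ 2) with (Rsqr u) by (unfold Rsqr; ring); apply is_derive_atan. }
split.
- assert (H := le_of_derive_nonneg (fun u => atan u - u + u ^ 3)
    (fun u => / (1 + u ^ 2) - 1 + 3 * u ^ 2) 0 x Hx).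
  cbv beta in H; rewrite atan_0 in H.
  enough (0 - 0 + 0 ^ 3 <= atan x - x + x ^ 3) by (simpl in *; lra).
  apply H; intros u Hu; assert (Hu2 := pow2_ge_0 u).
  + auto_derive; [trivial|]; unfold Rsqr; field; simpl in Hu2; lra.
  + replace (/ (1 + u ^ 2) - 1 + 3 * u ^ 2)
      with (u ^ 2 * (2 + 3 * u ^ 2) / (1 + u ^ 2)) by (field; lra).
    apply Rmult_le_pos; [nra | left; apply Rinv_0_lt_compat; lra].
- assert (H := le_of_derive_nonneg (fun u => u - atan u)
    (fun u => 1 - / (1 + u ^ 2)) 0 x Hx).
  cbv beta in H; rewrite atan_0 in H.
  enough (0 - 0 <= x - atan x) by lra.
  apply H; intros u Hu; assert (Hu2 := pow2_ge_0 u).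
  + auto_derive; [trivial|]; unfold Rsqr; field; simpl in Hu2; lra.
  + assert (/ (1 + u ^ 2) <= / 1) by (apply Rinv_le_contravar; lra).
    rewrite Rinv_1 in *; lra.
Qed.

Lemma arctan_area_limit (t : R) : 0 < t ->
  is_lim_seq (fun n => arctan_area t (INR (S (S n))) - t * ln (INR (S n))) (t - t * ln t).
Proof.
intros Ht.
assert (L0 : is_lim_seq (fun n => / INR (S n)) 0).
{ apply (is_lim_seq_inv _ p_infty); [|discriminate].
  apply (is_lim_seq_incr_1 INR), is_lim_seq_INR. }
assert (L : forall c, is_lim_seq (fun n => (t - t * ln t) + c * / INR (S n)) (t - t * ln t)).
{ intros c; replace (Finite (t - t * ln t)) with (Finite (t - t * ln t + c * 0))
    by (f_equal; ring).
  apply is_lim_seq_plus'; [apply is_lim_seq_const|].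
  now apply (is_lim_seq_scal_l _ c 0). }
apply (is_lim_seq_le_le (fun n => (t - t * ln t) + (- t ^ 3) * / INR (S n)) _
  (fun n => (t - t * ln t) + (t / 2 * (3 + t ^ 2)) * / INR (S n))); [|apply L|apply L].
intros n.
assert (Hx : 1 <= INR (S n)) by (apply (le_INR 1); lia).
unfold arctan_area; rewrite (S_INR (S n)).
set (x := INR (S n)) in *; set (X := x + 1).
assert (Hxi : 0 < / x) by (apply Rinv_0_lt_compat; lra).
assert (Ht2 := pow2_ge_0 t).
assert (Ht3 : 0 < t ^ 3) by now apply pow_lt.
assert (HX : 0 < X) by (unfold X; lra).
assert (E : PI / 2 - atan (X / t) = atan (t / X)).
{ rewrite <- atan_inv by now apply Rdiv_lt_0_compat.
  f_equal; field; lra. }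
rewrite E.
assert (B := atan_bounds (t / X) (Rlt_le _ _ (Rdiv_lt_0_compat _ _ Ht HX))).
assert (B1 : t - t ^ 3 * / x <= X * atan (t / X) <= t).
{ split.
  - apply Rle_trans with (X * (t / X - (t / X) ^ 3)); [|apply Rmult_le_compat_l; lra].
    replace (X * (t / X - (t / X) ^ 3)) with (t - t ^ 3 * / X ^ 2) by (field; lra).
    assert (/ X ^ 2 <= / x) by (apply Rinv_le_contravar; [lra | unfold X; nra]).
    nra.
  - apply Rle_trans with (X * (t / X)); [apply Rmult_le_compat_l; lra | right; field; lra]. }
assert (EL : ln (X ^ 2 + t ^ 2) = 2 * ln x + ln ((X ^ 2 + t ^ 2) / x ^ 2)).
{ unfold Rdiv; rewrite ln_mult, ln_Rinv.
  - simpl (x ^ 2); rewrite Rmult_1_r, ln_mult by lra; ring.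
  - nra.
  - nra.
  - apply Rinv_0_lt_compat; nra. }
assert (B2 : 0 <= ln ((X ^ 2 + t ^ 2) / x ^ 2) <= (3 + t ^ 2) * / x).
{ assert (Hx2 : 0 < x ^ 2) by nra.
  assert (Er : (X ^ 2 + t ^ 2) / x ^ 2 = 1 + (2 * x + 1 + t ^ 2) * / x ^ 2)
    by (unfold X; field; lra).
  assert (Hq : 0 <= (2 * x + 1 + t ^ 2) * / x ^ 2)
    by (apply Rmult_le_pos; [lra | left; now apply Rinv_0_lt_compat]).
  rewrite Er; split.
  - rewrite <- ln_1; apply ln_le; lra.
  - apply Rle_trans with ((2 * x + 1 + t ^ 2) * / x ^ 2).
    + rewrite <- (ln_exp ((2 * x + 1 + t ^ 2) * / x ^ 2)) at 2.
      apply ln_le; [lra | apply exp_ineq1_le].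
    + apply (Rmult_le_reg_r (x ^ 2)); [exact Hx2|].
      rewrite Rmult_assoc, Rinv_l by lra.
      replace ((3 + t ^ 2) * / x * x ^ 2) with ((3 + t ^ 2) * x) by (field; lra).
      nra. }
rewrite EL.
assert (t / 2 * ln ((X ^ 2 + t ^ 2) / x ^ 2) <= t / 2 * ((3 + t ^ 2) * / x))
  by (apply Rmult_le_compat_l; lra).
assert (0 <= t / 2 * ln ((X ^ 2 + t ^ 2) / x ^ 2)) by (apply Rmult_le_pos; lra).
lra.
Qed.

Definition zeta_partial (p V : nat) : R := sum_f_R0 (fun i => / INR (S i) ^ p) V.

Lemma zeta_partial_2_le (V : nat) : zeta_partial 2 V <= 2 - / INR (S V).
Proof.
unfold zeta_partial; induction V as [|V IH]; [simpl; lra|].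
rewrite tech5; eapply Rle_trans; [apply Rplus_le_compat_r, IH|].
assert (H : 0 < INR (S V)) by (apply lt_0_INR; lia).
rewrite (S_INR (S V)); set (x := INR (S V)) in *.
assert (/ (x + 1) ^ 2 <= / x - / (x + 1)); [|lra].
replace (/ x - / (x + 1)) with (/ (x * (x + 1))) by (field; lra).
apply Rinv_le_contravar; [apply Rmult_lt_0_compat; lra | nra].
Qed.

Lemma zeta_partial_le_2 (p V : nat) : (2 <= p)%nat -> zeta_partial p V <= 2.
Proof.
intros Hp; apply Rle_trans with (zeta_partial 2 V).
- apply sum_Rle; intros i _.
  assert (H : 1 <= INR (S i)) by (apply (le_INR 1); lia).
  apply Rinv_le_contravar; [apply pow_lt; lra | now apply Rle_pow].
- assert (Z := zeta_partial_2_le V).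
  assert (0 < / INR (S V)) by (apply Rinv_0_lt_compat, lt_0_INR; lia).
  lra.
Qed.

Lemma zeta_converges (p : nat) : (2 <= p)%nat ->
  exists z : R, is_lim_seq (zeta_partial p) z.
Proof.
intros Hp; apply ex_finite_lim_seq_incr with (M := 2).
- intros n; unfold zeta_partial; rewrite tech5.
  assert (0 < / INR (S (S n)) ^ p)
    by (apply Rinv_0_lt_compat, pow_lt, lt_0_INR; lia).
  lra.
- intros n; now apply zeta_partial_le_2.
Qed.

(** With n + 1 cells, the cut of the integrals costs at most 1/(2 a (n+1)) in the
    mode of frequency a; after multiplication by 2/a the sum over the modes
    converges and is at most 1/(n+1).  The limit over the modes is taken first,
    for fixed n. *)
Lemma theta_remainder_le (k : nat) (t Z : R) : (1 <= k)%nat -> INR k <= t ->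
  (forall V, zeta_partial (2 * k + 2) V <= Z) ->
  Rabs (theta_lim t - (t * ln t - t)
     - Im (@sum_n_m C_AbelianMonoid (fun j => That j (Cmult Ci (RtoC t))) 1 k))
  <= 2 * stokes_constant (2 * k) * INR (fact (2 * k))
       / (t ^ (2 * k + 1) * (2 * PI) ^ (2 * k + 2)) * Z.
Proof.
intros Hk Hkt HZ.
assert (Hpi := PI_bounds).
assert (Ht : 0 < t) by (apply Rlt_le_trans with (INR k); [apply lt_0_INR; lia | exact Hkt]).
assert (HU : 0 < stokes_constant (2 * k)).
{ assert (Hx : 2 <= INR (2 * k)) by (apply (le_INR 2); lia).
  assert (9 < PI ^ 2) by nra.
  unfold stokes_constant; apply Rdiv_lt_0_compat; apply Rmult_lt_0_compat; lra. }
set (U := stokes_constant (2 * k)) in *.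
set (T := Im _).
set (C0 := 2 * U * INR (fact (2 * k)) / (t ^ (2 * k + 1) * (2 * PI) ^ (2 * k + 2))).
assert (Htp : 0 < t ^ (2 * k + 1)) by now apply pow_lt.
assert (Hpp : 0 < (2 * PI) ^ (2 * k + 2)) by (apply pow_lt; lra).
assert (HC0 : 0 <= C0).
{ unfold C0; apply Rmult_le_pos.
  - apply Rmult_le_pos; [lra | apply pos_INR].
  - left; apply Rinv_0_lt_compat; now apply Rmult_lt_0_compat. }
assert (Hfin : forall n, Rabs (arctan_area t (INR (S n)) - rising_arg t (S n) - T)
  <= C0 * Z + / INR (S n)).
{ intros n; assert (HX : 0 < INR (S n)) by (apply lt_0_INR; lia).
  assert (L := is_lim_seq_minus' _ _ _ _ (arctan_sum_series t n Ht)
    (Im_That_sum_series k t Ht)).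
  apply is_lim_seq_abs in L; fold T in L.
  refine (is_lim_seq_le _ (fun _ => C0 * Z + / INR (S n)) _ _ _ L (is_lim_seq_const _)).
  intros V; cbv beta; rewrite <- minus_sum.
  eapply Rle_trans; [apply Rsum_abs|].
  apply Rle_trans with (C0 * zeta_partial (2 * k + 2) V
    + / INR (S n) * / (2 * PI) ^ 2 * zeta_partial 2 V).
  - unfold zeta_partial; rewrite !scal_sum, <- sum_plus.
    apply sum_Rle; intros i _.
    assert (Hf := freq_pos i).
    assert (Hi : 1 <= INR (S i)) by (apply (le_INR 1); lia).
    replace ((-1) ^ i * (2 / freq i) * stokes_mode (freq i * INR (S n)) (freq i * t) -
      (-1) ^ i * (2 / freq i) * even_factorial_sum k (freq i * t))
      with ((-1) ^ i * ((2 / freq i) * (stokes_mode (freq i * INR (S n)) (freq i * t)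
         - even_factorial_sum k (freq i * t)))) by ring.
    rewrite Rabs_mult, pow_1_abs, Rmult_1_l, Rabs_mult.
    rewrite (Rabs_pos_eq (2 / freq i)) by (left; apply Rdiv_lt_0_compat; lra).
    assert (B := stokes_mode_bound k (freq i * INR (S n)) (freq i * t) Hk
      ltac:(now apply Rmult_lt_0_compat)).
    assert (EM : freq i * INR (S n) = 2 * PI * INR (S i * S n))
      by (unfold freq; rewrite mult_INR; ring).
    rewrite EM, sin_2PI_INR, cos_2PI_INR in B.
    specialize (B eq_refl eq_refl).
    rewrite <- EM in B; fold U in B.
    eapply Rle_trans.
    + apply Rmult_le_compat_l; [left; apply Rdiv_lt_0_compat; lra|]; apply B.
      replace (PI * INR (2 * k)) with (2 * PI * INR k) by (rewrite mult_INR; simpl; ring).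
      unfold freq.
      apply Rle_trans with (2 * PI * t); [apply Rmult_le_compat_l; lra|].
      rewrite (Rmult_assoc (2 * PI)); apply Rmult_le_compat_l; [lra|].
      rewrite <- (Rmult_1_l t) at 1; apply Rmult_le_compat_r; lra.
    + right; unfold C0, freq; rewrite !Rpow_mult_distr.
      replace (2 * k + 2)%nat with (S (2 * k + 1)) by lia.
      rewrite <- !tech_pow_Rmult.
      rewrite !pow_O.
      assert (H2 : 0 < 2 ^ (2 * k + 1)) by (apply pow_lt; lra).
      assert (H3 : 0 < PI ^ (2 * k + 1)) by (apply pow_lt; lra).
      assert (H4 : 0 < INR (S i) ^ (2 * k + 1)) by (apply pow_lt; lra).
      revert H2 H3 H4 Htp; clear - Hi HX Hpi Ht.
      generalize (2 ^ (2 * k + 1)) (PI ^ (2 * k + 1)) (INR (S i) ^ (2 * k + 1))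
        (t ^ (2 * k + 1)).
      intros; field; repeat split; lra.
  - apply Rplus_le_compat; [apply Rmult_le_compat_l; [exact HC0 | apply HZ]|].
    assert (Z2 := zeta_partial_le_2 2 V (Nat.le_refl 2)).
    assert (H4 : 0 < / (2 * PI) ^ 2 <= / 4).
    { split; [apply Rinv_0_lt_compat, pow_lt; lra | apply Rinv_le_contravar; nra]. }
    assert (Hxi : 0 < / INR (S n)) by now apply Rinv_0_lt_compat.
    rewrite Rmult_assoc; rewrite <- (Rmult_1_r (/ INR (S n))) at 2.
    apply Rmult_le_compat_l; [lra|].
    assert (0 <= zeta_partial 2 V).
    { apply cond_pos_sum; intros i; left; apply Rinv_0_lt_compat, pow_lt, lt_0_INR; lia. }
    nra. }
assert (L1 := is_lim_seq_plus' _ _ _ _ (arctan_area_limit t Ht)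
  (theta_lim_correct t (Rlt_le _ _ Ht))).
assert (L2 := is_lim_seq_minus' _ _ _ _ L1 (is_lim_seq_const T)).
apply is_lim_seq_abs in L2.
replace (t - t * ln t + theta_lim t - T) with (theta_lim t - (t * ln t - t) - T) in L2 by ring.
assert (L3 : is_lim_seq (fun n => C0 * Z + / INR (S (S n))) (C0 * Z + 0)).
{ apply is_lim_seq_plus'; [apply is_lim_seq_const|].
  apply (is_lim_seq_inv _ p_infty); [|discriminate].
  apply (is_lim_seq_incr_1 (fun n => INR (S n))), (is_lim_seq_incr_1 INR), is_lim_seq_INR. }
rewrite Rplus_0_r in L3.
refine (is_lim_seq_le _ _ _ _ _ L2 L3).
intros n; eapply Rle_trans; [|apply (Hfin (S n))].
right; f_equal; unfold theta_approx; ring.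
Qed.

(** * Zeta values and the final estimate *)

(** The terms of index 1 coincide and those of index 2 give the gap. *)
Lemma zeta_strict (p : nat) (z z' : R) :
  is_lim_seq (zeta_partial p) z -> is_lim_seq (zeta_partial (p + 2)) z' ->
  z' + (/ 2 ^ p - / 2 ^ (p + 2)) <= z.
Proof.
intros L L'.
apply is_lim_seq_incr_1 in L; apply is_lim_seq_incr_1 in L'.
assert (L2 := is_lim_seq_plus' _ _ _ _ L' (is_lim_seq_const (/ 2 ^ p - / 2 ^ (p + 2)))).
refine (is_lim_seq_le _ _ _ _ _ L2 L).
intros n; unfold zeta_partial; induction n as [|n IH].
- cbn [sum_f_R0]; change (INR 1) with 1; change (INR 2) with 2; rewrite !pow1; lra.
- assert (T : forall f, sum_f_R0 f (S (S n)) = sum_f_R0 f (S n) + f (S (S n)))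
    by reflexivity.
  rewrite !T.
  assert (H : 1 <= INR (S (S (S n)))) by (apply (le_INR 1); lia).
  assert (/ INR (S (S (S n))) ^ (p + 2) <= / INR (S (S (S n))) ^ p).
  { apply Rinv_le_contravar; [apply pow_lt; lra | apply Rle_pow; [exact H | lia]]. }
  lra.
Qed.

(** Changing the sign of the even terms subtracts twice the sum of the
    (2 nu)^(-p). *)
Lemma alternating_zeta_partial (p V : nat) :
  sum_f_R0 (fun i => (-1) ^ i * / INR (S i) ^ p) (2 * V + 1)
  = zeta_partial p (2 * V + 1) - 2 / 2 ^ p * zeta_partial p V.
Proof.
assert (H2 : 0 < 2 ^ p) by (apply pow_lt; lra).
unfold zeta_partial; induction V as [|V IH].
- cbn [Nat.mul Nat.add sum_f_R0]; change (INR 1) with 1; change (INR 2) with 2.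
  rewrite pow1; simpl pow; field; lra.
- replace (2 * S V + 1)%nat with (S (S (2 * V + 1))) by lia.
  rewrite !tech5, IH.
  replace (S (2 * V + 1)) with (2 * S V)%nat by lia.
  rewrite pow_1_even, pow_1_odd.
  replace (INR (S (S (2 * S V)))) with (2 * INR (S (S V)))
    by (rewrite !S_INR, mult_INR, !S_INR; simpl; ring).
  rewrite Rpow_mult_distr.
  assert (Hv : 0 < INR (S (S V)) ^ p) by (apply pow_lt, lt_0_INR; lia).
  assert (Hw : 0 < INR (S (2 * S V)) ^ p) by (apply pow_lt, lt_0_INR; lia).
  revert Hv Hw; generalize (INR (S (S V)) ^ p) (INR (S (2 * S V)) ^ p).
  intros; field; repeat split; lra.
Qed.

Lemma Rabs_bernoulli_half (k : nat) (z : R) : (1 <= k)%nat ->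
  is_lim_seq (zeta_partial (2 * k)) z -> 0 < z ->
  Rabs (bernoulli_poly (2 * k) (1 / 2))
    = 2 * INR (fact (2 * k)) / (2 * PI) ^ (2 * k) * (1 - 2 / 2 ^ (2 * k)) * z.
Proof.
intros Hk Lz Hz.
assert (Hpi := PI_RGT_0).
assert (Hp2 : 0 < (2 * PI) ^ (2 * k)) by (apply pow_lt; lra).
assert (H22 : 2 ^ 2 <= 2 ^ (2 * k)) by (apply Rle_pow; [lra | lia]).
set (A := 2 * INR (fact (2 * k)) / (2 * PI) ^ (2 * k)).
assert (HA : 0 < A).
{ unfold A; apply Rdiv_lt_0_compat; [assert (F := INR_fact_lt_0 (2 * k)); lra | lra]. }
set (b := bernoulli_poly (2 * k) (1 / 2)).
assert (L : is_lim_seq (fun V => sum_f_R0 (fun i => (-1) ^ i * / INR (S i) ^ (2 * k)) V)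
  ((-1) ^ k * b / A)).
{ assert (BS := bernoulli_half_series (pred k)).
  replace (S (pred k)) with k in BS by lia; fold b in BS.
  apply (is_lim_seq_scal_l _ ((-1) ^ k / A)) in BS.
  replace (Rbar_mult ((-1) ^ k / A) b) with (Finite ((-1) ^ k * b / A)) in BS
    by (simpl; f_equal; field; lra).
  eapply is_lim_seq_ext; [|exact BS].
  intros V; cbv beta; rewrite scal_sum; apply sum_eq; intros i _.
  assert (Hi : 0 < INR (S i)) by (apply lt_0_INR; lia).
  assert (Hip : 0 < INR (S i) ^ (2 * k)) by now apply pow_lt.
  assert (Hs : (-1) ^ k * (-1) ^ k = 1)
    by (rewrite <- Rpow_mult_distr; replace (-1 * -1) with 1 by ring; apply pow1).
  assert (Ek : (-1) ^ pred k = - (-1) ^ k).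
  { replace k with (S (pred k)) at 2 by lia; simpl; ring. }
  rewrite Ek, (Rpow_mult_distr (2 * PI)); unfold A; simpl ((-1) ^ S i).
  assert (F := INR_fact_lt_0 (2 * k)).
  transitivity ((-1) ^ i * / INR (S i) ^ (2 * k) * ((-1) ^ k * (-1) ^ k)).
  - field; repeat split; lra.
  - rewrite Hs; ring. }
assert (Sub : filterlim (fun V => (2 * V + 1)%nat) eventually eventually).
{ apply eventually_subseq; intros n; lia. }
assert (L1 := is_lim_seq_subseq _ _ _ Sub L).
assert (L2 := is_lim_seq_subseq _ _ _ Sub Lz).
assert (L3 := is_lim_seq_minus' _ _ _ _ L2 (is_lim_seq_scal_l _ (2 / 2 ^ (2 * k)) _ Lz)).
assert (E : (-1) ^ k * b / A = z - 2 / 2 ^ (2 * k) * z).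
{ apply is_lim_seq_unique in L1; apply is_lim_seq_unique in L3.
  rewrite (Lim_seq_ext _ _ (alternating_zeta_partial (2 * k))) in L1.
  rewrite L1 in L3; now injection L3. }
replace (Rabs b) with (Rabs ((-1) ^ k * b / A * A)).
- rewrite E, Rabs_pos_eq; [ring|].
  apply Rmult_le_pos; [|lra].
  replace (z - 2 / 2 ^ (2 * k) * z) with ((1 - 2 / 2 ^ (2 * k)) * z) by ring.
  apply Rmult_le_pos; [|lra].
  assert (2 / 2 ^ (2 * k) <= 1); [|lra].
  apply (Rmult_le_reg_r (2 ^ (2 * k))); [lra|].
  unfold Rdiv; rewrite Rmult_assoc, Rinv_l; lra.
- replace ((-1) ^ k * b / A * A) with ((-1) ^ k * b) by (field; lra).
  rewrite Rabs_mult, pow_1_abs; ring.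
Qed.

Lemma eta_eq (k : nat) : eta k = 1 / (1 - 2 / 2 ^ (2 * k)).
Proof.
unfold eta; do 2 f_equal.
replace (1 - 2 * Z.of_nat k)%Z with (1 + - Z.of_nat (2 * k))%Z by lia.
rewrite powerRZ_add by lra; rewrite powerRZ_neg', <- pow_powerRZ.
simpl (powerRZ 2 1); rewrite Rmult_1_r; reflexivity.
Qed.

(** As Re (i t) = 0, the argument of i t enters only the real part of
    z log z. *)
Lemma Rtilde_eq (L : C -> C) (k : nat) (t : R) : is_lnGamma L -> 0 < t ->
  Rtilde L (k + 1) t = 1 / 2 * (theta_lim t - (t * ln t - t)
     - Im (@sum_n_m C_AbelianMonoid (fun j => That j (Cmult Ci (RtoC t))) 1 k)).
Proof.
intros HL Ht; unfold Rtilde, Rhat.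
replace (k + 1 - 1)%nat with k by lia.
set (sigma := @sum_n_m C_AbelianMonoid _ 1 k).
rewrite <- (Im_lnGamma_critical_line L t HL) by lra.
replace (Cplus (Cmult Ci (RtoC t)) (RtoC (1 / 2))) with (critical_line t)
  by (unfold critical_line, Ci, RtoC, Cplus, Cmult; simpl; f_equal; ring).
replace (Clog (Cmult Ci (RtoC t))) with ((ln t, Carg (Cmult Ci (RtoC t))) : C).
- unfold Im, Ci, RtoC, Cplus, Cminus, Cmult, Copp; simpl.
  unfold Im; destruct (L (critical_line t)) as [lr li]; destruct sigma as [sr si]; simpl; ring.
- unfold Clog; f_equal; f_equal.
  rewrite Cmod_mult, Cmod_R, Rabs_pos_eq by lra.
  replace (Cmod Ci) with 1; [ring|].
  unfold Cmod, Ci; simpl; replace (0 * (0 * 1) + 1 * (1 * 1)) with 1 by ring.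
  now rewrite sqrt_1.
Qed.

Theorem corollary4 (lnGamma : C -> C) (hL : is_lnGamma lnGamma)
    (k : nat) (t : R) (hk : (1 <= k)%nat) (ht : INR k <= t) :
  Rabs (Rtilde lnGamma (k + 1) t / Ttilde k t)
    < eta k * ((INR k / t) ^ 2 / (PI ^ 2 - 1)).
Proof.
assert (Hk : 1 <= INR k) by now apply (le_INR 1).
assert (Ht : 0 < t) by lra.
assert (Hpi := PI_bounds).
assert (HP : 9 < PI ^ 2) by nra.
destruct (zeta_converges (2 * k) ltac:(lia)) as [z Lz].
destruct (zeta_converges (2 * k + 2) ltac:(lia)) as [z' Lz'].
assert (Hzz : z' < z).
{ assert (Z := zeta_strict (2 * k) z z' Lz Lz').
  assert (/ 2 ^ (2 * k + 2) < / 2 ^ (2 * k)).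
  { assert (0 < 2 ^ (2 * k)) by (apply pow_lt; lra).
    rewrite pow_add; replace (2 ^ 2) with 4 by ring.
    apply Rinv_lt_contravar; [apply Rmult_lt_0_compat|]; lra. }
  lra. }
assert (Hle : forall V, zeta_partial (2 * k + 2) V <= z').
{ intros V; apply (is_lim_seq_incr_compare _ _ Lz'); intros n.
  unfold zeta_partial; rewrite tech5.
  assert (0 < / INR (S (S n)) ^ (2 * k + 2))
    by (apply Rinv_0_lt_compat, pow_lt, lt_0_INR; lia).
  lra. }
assert (Hz' : 1 <= z').
{ eapply Rle_trans; [|apply (Hle O)].
  unfold zeta_partial; cbn [sum_f_R0]; change (INR 1) with 1; rewrite pow1; lra. }
assert (B := theta_remainder_le k t z' hk ht Hle).
assert (HR : Rabs (Rtilde lnGamma (k + 1) t) <= 1 / 2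
  * (2 * stokes_constant (2 * k) * INR (fact (2 * k))
       / (t ^ (2 * k + 1) * (2 * PI) ^ (2 * k + 2)) * z')).
{ rewrite (Rtilde_eq lnGamma k t hL Ht), Rabs_mult, (Rabs_pos_eq (1 / 2)) by lra.
  apply Rmult_le_compat_l; [lra | exact B]. }
assert (HT : Ttilde k t = _) by exact (Ttilde_eq k t hk Ht).
rewrite (Rabs_bernoulli_half k z hk Lz ltac:(lra)) in HT.
assert (H22 : 2 ^ 2 <= 2 ^ (2 * k)) by (apply Rle_pow; [lra | lia]).
assert (Hf := INR_fact_lt_0 (2 * k)).
assert (Hpp : 0 < (2 * PI) ^ (2 * k)) by (apply pow_lt; lra).
set (d := 1 - 2 / 2 ^ (2 * k)) in *.
assert (Hd : 0 < d).
{ replace (2 ^ 2) with 4 in H22 by ring.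
  unfold d; assert (2 / 2 ^ (2 * k) <= 2 / 4); [|lra].
  apply Rmult_le_compat_l; [lra | apply Rinv_le_contravar; lra]. }
assert (Hq : 0 < t ^ (2 * k - 1)) by now apply pow_lt.
assert (HTpos : 0 < Ttilde k t).
{ rewrite HT; apply Rdiv_lt_0_compat.
  - repeat apply Rmult_lt_0_compat; try lra; apply Rinv_0_lt_compat; lra.
  - repeat apply Rmult_lt_0_compat; lra. }
rewrite Rabs_div, (Rabs_pos_eq (Ttilde k t)) by lra.
apply (Rmult_lt_reg_r (Ttilde k t)); [exact HTpos|].
replace (Rabs (Rtilde lnGamma (k + 1) t) / Ttilde k t * Ttilde k t)
  with (Rabs (Rtilde lnGamma (k + 1) t)) by (field; lra).
eapply Rle_lt_trans; [exact HR|].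
set (A := INR k * INR (fact (2 * k))
  / (2 * (2 * INR k - 1) * (PI ^ 2 - 1) * (t ^ 2 * t ^ (2 * k - 1)) * (2 * PI) ^ (2 * k))).
assert (HA : 0 < A).
{ unfold A; apply Rdiv_lt_0_compat; repeat apply Rmult_lt_0_compat; lra. }
apply Rle_lt_trans with (A * z').
- right; unfold A, stokes_constant.
  replace (INR (2 * k)) with (2 * INR k) by (rewrite mult_INR; simpl; ring).
  replace (2 * k + 1)%nat with (2 + (2 * k - 1))%nat by lia.
  rewrite (pow_add t 2), (pow_add (2 * PI) (2 * k) 2).
  replace ((2 * PI) ^ 2) with (4 * PI ^ 2) by ring.
  field; repeat split; lra.
- replace (eta k * ((INR k / t) ^ 2 / (PI ^ 2 - 1)) * Ttilde k t) with (A * z).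
  + now apply Rmult_lt_compat_l.
  + rewrite HT, eta_eq; fold d; unfold A; field; repeat split; lra.
Qed.
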